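(* Let $N\ge 2$, $s\in(0,1)$, and let $\Omega=B_r\subset\mathbb{R}^N$ be an open ball of radius $r>0$. Let $g_0\in L^q(\Omega)$ with $q>\frac{N}{2s}$ and $g_0^+=\max\{g_0,0\}\not\equiv 0$, and let $V_0=0$. Let $\underline{g}\in\mathcal{E}(g_0)$ be a minimizing weight, i.e. $$\lambda_1(\underline{g},0)=\min\{\lambda_1(g,0): g\in\mathcal{E}(g_0)\},$$ and let $u$ be a first eigenfunction associated to $\underline{g}$ (with $V=0$). Then $u$ and $\underline{g}$ are radial in $\Omega$ (i.e. they depend only on the distance to the center of the ball).
   Context: $C_{N,s}$ is the normalization constant of the fractional Laplacian $(-\Delta)^s u(x)=C_{N,s}\,\mathrm{P.V.}\int_{\mathbb{R}^N}\frac{u(x)-u(y)}{|x-y|^{N+2s}}\,dy$. Put $[u]_s=\left(\int_{\mathbb{R}^N}\int_{\mathbb{R}^N}\frac{|u(x)-u(y)|^2}{|x-y|^{N+2s}}\,dx\,dy\right)^{1/2}$ and $H_0^s(\Omega)=\{u\in L^2(\mathbb{R}^N):[u]_s<\infty,\ u=0\text{ in }\mathbb{R}^N\setminus\Omega\}$. The eigenvalue problem is $(-\Delta)^s u+Vu=\lambda g u$ in $\Omega$, $u=0$ in $\mathbb{R}^N\setminus\Omega$ (understood weakly in $H_0^s(\Omega)$), here with $V=0$. Set $$\lambda_1(g,0)=\inf\left\{\frac{\frac{C_{N,s}}{2}[u]_s^2}{\int_\Omega g|u|^2dx}: u\in H_0^s(\Omega),\ \int_\Omega g|u|^2dx>0\right\}.$$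 A first eigenfunction associated to $g$ is a function $u\in H_0^s(\Omega)$ at which this infimum is attained. For measurable $\phi:\Omega\to\mathbb{R}$, $\mathcal{E}(\phi)$ is the rearrangement class of $\phi$: the set of measurable $\psi:\Omega\to\mathbb{R}$ with $|\{x\in\Omega:\psi(x)>t\}|=|\{x\in\Omega:\phi(x)>t\}|$ for all $t\in\mathbb{R}$ ($|\cdot|$ = Lebesgue measure). Functions equal a.e. are identified. *)

(* Defs.v *)
From HB Require Import structures.
From mathcomp Require Import all_boot all_order all_algebra.
From mathcomp Require Import all_classical all_reals all_analysis.

Set Implicit Arguments.
Unset Strict Implicit.
Unset Printing Implicit Defensive.
Import Order.TTheory GRing.Theory Num.Theory.
Import numFieldNormedType.Exports.

Local Open Scope classical_set_scope.
Local Open Scope ring_scope.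

(* R^N as N-tuples with the product (= Borel) sigma-algebra.  Every class of
   a.e. equal Lebesgue measurable functions has a Borel representative, so
   nothing is lost by taking "measurable" with respect to it. *)
Notation Rspace R N := (N.-tuple (measurableTypeR R)).

Definition tuple_of_pair (R : realType) (n : nat)
    (p : measurableTypeR R * Rspace R n) : Rspace R n.+1 :=
  [the n.+1.-tuple _ of p.1 :: p.2].

Lemma measurable_tuple_of_pair (R : realType) (n : nat) :
  measurable_fun [set: measurableTypeR R * Rspace R n]
    (@tuple_of_pair R n).
Proof. exact: measurable_cons. Qed.

Definition cons_measure (R : realType) (n : nat)
    (mu : {sigma_finite_measure set (Rspace R n) -> \bar R}) :
    set (Rspace R n.+1) -> \bar R :=
  pushforward (@lebesgue_measure R \x mu)%E (@tuple_of_pair R n).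

HB.instance Definition _ (R : realType) (n : nat)
    (mu : {sigma_finite_measure set (Rspace R n) -> \bar R}) :=
  Measure.copy (cons_measure mu)
    (measure_function_pushforward__canonical__measure_function_Measure
       (@lebesgue_measure R \x mu)%E (@measurable_tuple_of_pair R n)).

Lemma cons_measure_sigma_finite (R : realType) (n : nat)
    (mu : {sigma_finite_measure set (Rspace R n) -> \bar R}) :
  sigma_finite setT (cons_measure mu).
Proof.
pose split (x : Rspace R n.+1) : measurableTypeR R * Rspace R n :=
  (thead x, [tuple of behead x]).
have splitK : split \o @tuple_of_pair R n = id.
  by apply/funext => -[a t]; congr pair; exact: val_inj.
have msplit : measurable_fun setT split.
  by apply/measurable_fun_pair; [exact: measurable_tnth|exact: measurable_behead].
have /sigma_finiteP[F [FT Fnd Foo]] := sigma_finiteT (@lebesgue_measure R).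
have /sigma_finiteP[G [GT Gnd Goo]] := sigma_finiteT mu.
exists (fun i => split @^-1` (F i `*` G i)).
  rewrite -preimage_bigcup (_ : \bigcup_i _ = setT) ?preimage_setT//.
  apply/seteqP; split => // -[a t] _.
  have [i _ Fa] : (\bigcup_i F i) a by rewrite -FT.
  have [j _ Gt] : (\bigcup_i G i) t by rewrite -GT.
  exists (maxn i j) => //; split => /=.
    by move: (a) Fa; exact/subsetPset/Fnd/leq_maxl.
  by move: (t) Gt; exact/subsetPset/Gnd/leq_maxr.
move=> i; have [mF Fi] := Foo i; have [mG Gi] := Goo i; split.
  rewrite -[X in measurable X]setTI; apply: msplit => //.
  exact: measurableX.
rewrite /cons_measure /pushforward -comp_preimage splitK preimage_id.
by rewrite product_measure1E// lte_mul_pinfty// ge0_fin_numE.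
Qed.

HB.instance Definition _ (R : realType) (n : nat)
    (mu : {sigma_finite_measure set (Rspace R n) -> \bar R}) :=
  Measure_isSigmaFinite.Build _ _ _ (cons_measure mu)
    (cons_measure_sigma_finite mu).

(* N-dimensional Lebesgue measure, as an iterated product measure (see
   leb_box below). *)
Fixpoint leb (R : realType) (n : nat) :
    {sigma_finite_measure set (Rspace R n) -> \bar R} :=
  match n with
  | 0%N => \d_ ([tuple] : Rspace R 0)
  | m.+1 => cons_measure (leb R m)
  end.

Lemma leb_box (R : realType) (n : nat) (A : set (measurableTypeR R))
    (B : set (Rspace R n)) : measurable A -> measurable B ->
  leb R n.+1 [set x | A (thead x) /\ B [tuple of behead x]] =
  (lebesgue_measure A * leb R n B)%E.
Proof.
move=> mA mB; rewrite /= /cons_measure /pushforward -product_measure1E//.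
congr (_ _); apply/seteqP; split => -[a t] /=;
  rewrite /tuple_of_pair theadE => -[Aa Bt]; split => //=;
  by congr B: Bt; exact/val_inj.
Qed.

Definition eucl_dist (R : realType) (N : nat) (x y : Rspace R N) : R :=
  Num.sqrt (\sum_(i < N) (tnth x i - tnth y i) ^+ 2).

Definition eball (R : realType) (N : nat) (c : Rspace R N) (r : R) :
    set (Rspace R N) :=
  [set x | eucl_dist x c < r].

(* Integrals over the diagonal are unaffected by the convention 0^-1 = 0,
   the diagonal being negligible. *)
Definition gagliardo (R : realType) (N : nat) (s : R) (u : Rspace R N -> R) :
    \bar R :=
  ((\int[leb R N]_y \int[leb R N]_x
      (`|u x - u y| ^+ 2 / eucl_dist x y `^ (N%:R + 2 * s))%:E) `^ 2^-1)%E.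

(* C_{N,s} = (\int_{R^N} (1 - cos z_1) / |z|^{N+2s} dz)^-1, the value for which
   (-Delta)^s has Fourier symbol |xi|^{2s}. *)
Definition fraclap_const (R : realType) (N : nat) (s : R) : R :=
  (\int[leb R N]_z
     ((1 - cos (nth 0 z 0%N)) / eucl_dist z [tuple of nseq N 0] `^ (N%:R + 2 * s)))^-1.

Definition H0s (R : realType) (N : nat) (s : R) (Omega : set (Rspace R N)) :
    set (Rspace R N -> R) :=
  [set u | [/\ u \in Lfun (leb R N) 2%:E,
               (gagliardo s u < +oo)%E &
               {ae leb R N, forall x, ~ Omega x -> u x = 0}]].

Definition weighted_mass (R : realType) (N : nat) (Omega : set (Rspace R N))
    (g u : Rspace R N -> R) : R :=
  \int[leb R N]_(x in Omega) (g x * `|u x| ^+ 2).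

Definition rayleigh (R : realType) (N : nat) (s : R) (Omega : set (Rspace R N))
    (g u : Rspace R N -> R) : R :=
  (fraclap_const N s / 2 * fine (gagliardo s u) ^+ 2) / weighted_mass Omega g u.

Definition admissible (R : realType) (N : nat) (s : R)
    (Omega : set (Rspace R N)) (g : Rspace R N -> R) : set (Rspace R N -> R) :=
  [set u | H0s s Omega u /\ 0 < weighted_mass Omega g u].

(* lambda_1(g, 0) *)
Definition lambda1 (R : realType) (N : nat) (s : R) (Omega : set (Rspace R N))
    (g : Rspace R N -> R) : \bar R :=
  ereal_inf [set (rayleigh s Omega g u)%:E | u in admissible s Omega g].

Definition first_eigenfunction (R : realType) (N : nat) (s : R)
    (Omega : set (Rspace R N)) (g u : Rspace R N -> R) : Prop :=
  admissible s Omega g u /\ (rayleigh s Omega g u)%:E = lambda1 s Omega g.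

Definition rearrangement_class (R : realType) (N : nat)
    (Omega : set (Rspace R N)) (phi : Rspace R N -> R) :
    set (Rspace R N -> R) :=
  [set psi | measurable_fun Omega psi /\
     forall t : R, leb R N (Omega `&` [set x | t < psi x]) =
                   leb R N (Omega `&` [set x | t < phi x])].

Definition minimizing_weight (R : realType) (N : nat) (s : R)
    (Omega : set (Rspace R N)) (g0 g : Rspace R N -> R) : Prop :=
  rearrangement_class Omega g0 g /\
  forall h, rearrangement_class Omega g0 h ->
    (lambda1 s Omega g <= lambda1 s Omega h)%E.

(* Functions are identified when equal a.e., hence the a.e. quantifier. *)
Definition radial_in (R : realType) (N : nat) (c : Rspace R N)
    (Omega : set (Rspace R N)) (f : Rspace R N -> R) : Prop :=
  exists F : R -> R, {ae leb R N, forall x, Omega x -> f x = F (eucl_dist x c)}.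

(* Main.v *)
Require Import Defs.
From HB Require Import structures.
From mathcomp Require Import all_boot all_order all_algebra.
From mathcomp Require Import all_classical all_reals all_analysis.
From mathcomp Require Import measurable_realfun ess_sup_inf ring lra.

Set Implicit Arguments.
Unset Strict Implicit.
Unset Printing Implicit Defensive.
Import Order.TTheory GRing.Theory Num.Theory.
Import numFieldNormedType.Exports.

Local Open Scope classical_set_scope.
Local Open Scope ring_scope.

(** Write [E f] for the energy (the squared Gagliardo seminorm) and [m h f] for the
    integral of [h * f ^ 2] over the ball. The weight [g] minimises the first
    eigenvalue over its rearrangements and [u] realises it for [g], so that
    [E u * m h f <= E f * m g u] for all rearrangements [h] of [g] and all
    admissible [f] ([rayleigh_optimal]). The whole proof feeds this inequality
    with competitors.

    Sign. Replacing [u] by [|u|] keeps the mass and cannot increase the energy, so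
    [|u|] is optimal as well ([optimal_pair_abs]); and equality of the energies
    forces [u] to have a constant sign ([eigenfunction_sign]). It remains to treat
    [v = |u|]. The energy being nonlocal, the competitor [max v (t * tent)] shows
    that [v] is positive in the ball ([eigenfunction_positive]).

    The eigenfunction. Consider a hyperplane that misses the centre. Polarisation
    moves the larger of the values of [v] at two mirror points to the side of the
    centre. It composes [v] with a measure-preserving map of the ball; composing
    [g] with the same map gives a rearrangement of [g] and keeps the mass, while
    the energy does not increase. By optimality it is unchanged, and
    the equality case ([energy_polarize_eq]) says that either [v] was already
    polarised or its larger values all lie on the other side of the hyperplane.
    The second case is impossible, as some points of the ball on the side of the
    centre have their mirror images outside of it, where [v] vanishes. Applied to
    the bisectors of all pairs of points, this shows that [v] decreases with the
    distance to the centre ([eigenfunction_decreasing]); the finite energy of [v]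
    provides the Lebesgue points needed to go from one null set for each
    hyperplane to a single one.

    The weight. If [g] failed to decrease with the distance to the centre, a
    translation would carry a set of positive measure, far from the centre and
    with large values of [g], to a set close to the centre with smaller values.
    Exchanging these values gives a rearrangement of [g] which favours the
    places where [v] is larger. As [v] might take the same value at
    both places, [v] is perturbed at the same time by a small multiple of a
    strictly decreasing function; perturbing it in the opposite direction for the
    unchanged [g] makes the first variations cancel, and the sum of the
    two inequalities is contradictory ([outer_inner_null]).

    A function that decreases with the distance to the centre, off a null set, is
    almost everywhere a function of that distance: a monotone profile can only
    jump at countably many radii, and spheres are null ([radial_of_monotone]).

    Two facts of measure theory support this: reflections preserve the iterated
    Lebesgue measure, by the argument for the uniqueness of Haar measure
    ([leb_linear_isometry]), and [min 1 |z|^2] is integrable against the kernel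
    ([kern_integral_lty]). *)

(** * Measure-preserving maps and Lebesgue measure *)

Definition mpres d (T : measurableType d) (R : realType)
    (mu : set T -> \bar R) (f : T -> T) : Prop :=
  measurable_fun setT f /\
  forall A, measurable A -> mu (f @^-1` A) = mu A.

Lemma measurable_indic_comp (R : realType) d d' (U : measurableType d)
    (V : measurableType d') (C : set U) (f : V -> U) :
  measurable C -> measurable_fun setT f ->
  measurable_fun setT (fun x => (\1_C (f x))%:E : \bar R).
Proof.
move=> mC mf.
have m1 : measurable_fun setT (fun x => (\1_C x)%:E : \bar R).
  by apply/measurable_EFinP; exact: measurable_indic.
exact: (measurableT_comp m1 mf).
Qed.

Section measure_preserving.
Context (R : realType).
Local Open Scope ereal_scope.

Lemma mpres_ge0_integral d (T : measurableType d)
    (mu : {measure set T -> \bar R}) (f : T -> T) (g : T -> \bar R) :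
  mpres mu f -> measurable_fun setT g -> (forall x, 0 <= g x) ->
  \int[mu]_x g (f x) = \int[mu]_x g x.
Proof.
move=> [mf muf] mg g0.
transitivity (\int[pushforward mu f]_y g y).
  by rewrite (ge0_integral_pushforward mf)// => y _; exact: g0.
by apply: eq_measure_integral => A mA _; exact: muf.
Qed.

Lemma mpres_comp d (T : measurableType d) (mu : set T -> \bar R) (f g : T -> T) :
  mpres mu f -> mpres mu g -> mpres mu (f \o g).
Proof.
move=> [mf muf] [mg mug]; split; first exact: measurableT_comp.
move=> A mA; rewrite comp_preimage mug ?muf//.
by rewrite -[X in measurable X]setTI; exact: mf.
Qed.

(** By Tonelli, the measure of a preimage is an iterated integral in which each
    coordinate can be straightened separately. *)
Lemma mpres_prod d1 d2 (T1 : measurableType d1) (T2 : measurableType d2)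
    (m1 : {sigma_finite_measure set T1 -> \bar R})
    (m2 : {sigma_finite_measure set T2 -> \bar R}) (f1 : T1 -> T1) (f2 : T2 -> T2) :
  mpres m1 f1 -> mpres m2 f2 ->
  mpres (m1 \x m2) (fun z => (f1 z.1, f2 z.2)).
Proof.
move=> [mf1 pf1] [mf2 pf2].
have mf : measurable_fun setT (fun z : T1 * T2 => (f1 z.1, f2 z.2)).
  by apply/measurable_fun_pair => /=; exact: measurableT_comp.
split => // A mA.
have mi (B : set (T1 * T2)) : measurable B ->
    measurable_fun setT (fun z => (\1_B z)%:E : \bar R).
  by move=> mB; apply/measurable_EFinP; exact: measurable_indic.
have mA' : measurable ((fun z : T1 * T2 => (f1 z.1, f2 z.2)) @^-1` A).
  by rewrite -[X in measurable X]setTI; exact: mf.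
have i0 (B : set (T1 * T2)) z : 0 <= (\1_B z)%:E :> \bar R by rewrite lee_fin.
have muE B : measurable B -> (m1 \x m2) B = \int[m1 \x m2]_z (\1_B z)%:E.
  by move=> mB; rewrite integral_indic// setIT.
rewrite !muE//.
rewrite (fubini_tonelli1 _ (mi _ mA') (i0 _)) (fubini_tonelli1 _ (mi _ mA) (i0 _)).
rewrite /fubini_F.
transitivity (\int[m1]_x (fun x => \int[m2]_y (\1_A (x, y))%:E) (f1 x)).
  apply: eq_integral => x _.
  rewrite -(mpres_ge0_integral (f := f2) (g := fun y => (\1_A (f1 x, y))%:E))//.
  by apply: (measurableT_comp (mi _ mA)); exact: measurable_pair1.
rewrite (mpres_ge0_integral (f := f1) (g := fun x => \int[m2]_y (\1_A (x, y))%:E))//.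
  exact: (measurable_fun_fubini_tonelli_F (fun z => (\1_A z)%:E) (mi _ mA)).
by move=> x; apply: integral_ge0.
Qed.

(** The pushforward of Lebesgue measure by a translation agrees with it on the
    half-open intervals, which determine it. *)
Lemma mpres_translation1 (a : R) :
  mpres (@lebesgue_measure R) (fun x : measurableTypeR R => (x + a)%R).
Proof.
have mf : @measurable_fun _ _ (measurableTypeR R) (measurableTypeR R) setT
    (fun x => (x + a)%R).
  by apply: measurable_funD.
split => // A mA.
rewrite [RHS](lebesgue_measure_unique
  (mu := measure_function_pushforward__canonical__measure_function_Measure
       (@lebesgue_measure R) mf))//.
move=> X [[b c]/= bc] <-; rewrite /pushforward.
have -> : (fun x : R => (x + a)%R) @^-1` `]b, c]%classic =
    `](b - a)%R, (c - a)%R]%classic.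
  by apply/seteqP; split => x /=; rewrite !in_itv/= ltrBlDr lerBrDr.
rewrite /= !lebesgue_measure_itv/= !lte_fin ltrD2r; case: ifP => // _.
by rewrite -!EFinB; congr EFin; ring.
Qed.

End measure_preserving.

Section vectors.
Context (R : realType) (n : nat).
Local Notation X := (Rspace R n).
Implicit Types (x y z h e : X).

Definition tmap (F : 'I_n -> R) : X := [tuple F i | i < n].
Definition tadd x h : X := tmap (fun i => tnth x i + tnth h i).
Definition topp x : X := tmap (fun i => - tnth x i).
Definition tzero : X := tmap (fun=> 0).
Definition dot x y : R := \sum_(i < n) tnth x i * tnth y i.

Lemma tnth_tmap F i : tnth (tmap F) i = F i. Proof. exact: tnth_mktuple. Qed.

Lemma tnth_tadd x h i : tnth (tadd x h) i = tnth x i + tnth h i.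
Proof. exact: tnth_tmap. Qed.

Lemma tnth_topp x i : tnth (topp x) i = - tnth x i.
Proof. exact: tnth_tmap. Qed.

Lemma tnth_tzero i : tnth tzero i = 0. Proof. exact: tnth_tmap. Qed.

Definition tE := (tnth_tmap, tnth_tadd, tnth_topp, tnth_tzero).

Lemma taddK x h : tadd (tadd x h) (topp h) = x.
Proof. by apply/eq_from_tnth => i; rewrite !tE addrK. Qed.

Lemma taddNK x h : tadd (tadd x (topp h)) h = x.
Proof. by apply/eq_from_tnth => i; rewrite !tE subrK. Qed.

Lemma taddC x h : tadd x h = tadd h x.
Proof. by apply/eq_from_tnth => i; rewrite !tE addrC. Qed.

Definition sqd x y : R := \sum_(i < n) (tnth x i - tnth y i) ^+ 2.

Lemma sqd_ge0 x y : 0 <= sqd x y.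
Proof. by apply: sumr_ge0 => i _; exact: sqr_ge0. Qed.

Lemma eucl_distE x y : eucl_dist x y = Num.sqrt (sqd x y).
Proof. by []. Qed.

Lemma eucl_dist_ge0 x y : 0 <= eucl_dist x y.
Proof. exact: sqrtr_ge0. Qed.

Lemma sqdC x y : sqd x y = sqd y x.
Proof. by apply: eq_bigr => i _; rewrite -sqrrN opprB. Qed.

Lemma eucl_distC x y : eucl_dist x y = eucl_dist y x.
Proof. by rewrite !eucl_distE sqdC. Qed.

Lemma sqd_eq0 x y : sqd x y = 0 -> x = y.
Proof.
move=> /eqP; rewrite psumr_eq0 => [/allP xy|i _]; last exact: sqr_ge0.
apply/eq_from_tnth => i; apply/eqP.
by have := xy i (mem_index_enum _); rewrite sqrf_eq0 subr_eq0.
Qed.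

Lemma eucl_dist_eq0 x y : eucl_dist x y = 0 -> x = y.
Proof.
move=> /eqP; rewrite sqrtr_eq0 => xy; apply: sqd_eq0.
by apply/le_anti/andP; split => //; exact: sqd_ge0.
Qed.

Lemma eucl_dist_lt x y x' y' :
  (eucl_dist x y < eucl_dist x' y') = (sqd x y < sqd x' y').
Proof.
have [h|h] := boolP (0 < sqd x' y'); first by rewrite ltr_sqrt.
have e0 : sqd x' y' = 0.
  by apply/le_anti; rewrite sqd_ge0 andbT leNgt.
by rewrite !eucl_distE e0 sqrtr0 !ltNge sqrtr_ge0 sqd_ge0.
Qed.

Lemma eucl_dist_taddr x y h : eucl_dist (tadd x h) (tadd y h) = eucl_dist x y.
Proof.
congr Num.sqrt; apply: eq_bigr => i _.
by rewrite !tE opprD addrACA subrr addr0.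
Qed.

(** Comparing the distance with single coordinates places balls between cubes,
    the only sets whose measure is computed explicitly. *)
Lemma abs_tnth_le_dist x y i : `|tnth x i - tnth y i| <= eucl_dist x y.
Proof.
rewrite -sqrtr_sqr ler_wsqrtr// /sqd (bigD1 i)//= lerDl.
by apply: sumr_ge0 => j _; exact: sqr_ge0.
Qed.

Lemma cauchy_schwarz x y : dot x y ^+ 2 <= dot x x * dot y y.
Proof.
have q0 : 0 <= \sum_(i < n) (dot y y * tnth x i - dot x y * tnth y i) ^+ 2.
  by apply: sumr_ge0 => i _; exact: sqr_ge0.
have : 0 <= dot y y * (dot x x * dot y y - dot x y ^+ 2).
  move: q0; congr (_ <= _).
  transitivity (\sum_(i < n) (dot y y ^+ 2 * (tnth x i * tnth x i) -
    2 * dot y y * dot x y * (tnth x i * tnth y i) +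
    dot x y ^+ 2 * (tnth y i * tnth y i))).
    by apply: eq_bigr => i _; ring.
  rewrite !big_split/= sumrN -!mulr_sumr -!/(dot _ _); ring.
have : 0 <= dot y y by apply: sumr_ge0 => i _; rewrite -expr2 sqr_ge0.
rewrite le_eqVlt => /orP[/eqP yy0 _|yy0]; last by rewrite pmulr_rge0// subr_ge0.
suff -> : dot x y = 0 by rewrite -yy0 mulr0 expr0n.
rewrite /dot big1// => i _.
have /eqP := esym yy0; rewrite psumr_eq0 => [/allP h|j _]; last first.
  by rewrite -expr2 sqr_ge0.
by have := h i (mem_index_enum _); rewrite -expr2 sqrf_eq0 => /eqP ->; rewrite mulr0.
Qed.

(** The middle point comes first, as it is the only one which unification cannot
    find. *)
Lemma eucl_dist_triangle y x z : eucl_dist x z <= eucl_dist x y + eucl_dist y z.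
Proof.
rewrite -(ler_pXn2r (n := 2)) ?nnegrE ?addr_ge0 ?eucl_dist_ge0//.
rewrite !eucl_distE sqrrD !sqr_sqrtr ?sqd_ge0//.
pose a := tadd x (topp y); pose b := tadd y (topp z).
have -> : sqd x z = sqd x y + dot a b *+ 2 + sqd y z.
  rewrite mulr2n /sqd /dot -!big_split/=.
  by apply: eq_bigr => i _; rewrite !tE; ring.
rewrite lerD2r lerD2l lerMn2r/=.
apply: le_trans (ler_norm _) _.
rewrite -sqrtr_sqr -sqrtrM ?sqd_ge0// ler_wsqrtr//.
apply: le_trans (cauchy_schwarz a b) _.
rewrite le_eqVlt; apply/orP; left; apply/eqP.
by congr (_ * _); apply: eq_bigr => i _; rewrite !tE; ring.
Qed.

Lemma measurable_tmap d (T : measurableType d) (F : T -> 'I_n -> R) :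
  (forall i, measurable_fun setT (F ^~ i)) ->
  measurable_fun setT (fun t => tmap (F t)).
Proof.
move=> mF; apply/measurable_fun_tnthP => i.
by apply: (eq_measurable_fun (F ^~ i)) => // t _ /=; rewrite tnth_tmap.
Qed.

Lemma measurable_fun_tnth d (T : measurableType d) (f : T -> X) i :
  measurable_fun setT f -> measurable_fun setT (fun t => tnth (f t) i : R).
Proof. by move=> mf; exact: measurableT_comp (@measurable_tnth _ _ n i) mf. Qed.

Lemma measurable_tadd d (T : measurableType d) (f g : T -> X) :
  measurable_fun setT f -> measurable_fun setT g ->
  measurable_fun setT (fun t => tadd (f t) (g t)).
Proof.
move=> mf mg; apply: measurable_tmap => i.
by apply: measurable_funD; exact: measurable_fun_tnth.
Qed.

Lemma measurable_topp d (T : measurableType d) (f : T -> X) :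
  measurable_fun setT f -> measurable_fun setT (fun t => topp (f t)).
Proof.
move=> mf; apply: measurable_tmap => i.
by apply: measurableT_comp => //; exact: measurable_fun_tnth.
Qed.

Lemma measurable_dot d (T : measurableType d) (f g : T -> X) :
  measurable_fun setT f -> measurable_fun setT g ->
  measurable_fun setT (fun t => dot (f t) (g t)).
Proof.
move=> mf mg; apply: measurable_sum => i.
by apply: measurable_funM; exact: measurable_fun_tnth.
Qed.

Lemma measurable_eucl_dist d (T : measurableType d) (f g : T -> X) :
  measurable_fun setT f -> measurable_fun setT g ->
  measurable_fun setT (fun t => eucl_dist (f t) (g t)).
Proof.
move=> mf mg; rewrite /eucl_dist.
have ms : measurable_fun setT (@Num.sqrt R).
  by apply: continuous_measurable_fun; exact: sqrt_continuous.
have mfg : measurable_fun setT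
    (fun t => \sum_(i < n) (tnth (f t) i - tnth (g t) i) ^+ 2).
  apply: measurable_sum => i; apply: measurable_funX.
  by apply: measurable_funB; exact: measurable_fun_tnth.
exact: (measurableT_comp ms mfg).
Qed.

Lemma measurable_eball c r : measurable (eball c r : set X).
Proof.
have m : measurable_fun setT (fun x : X => eucl_dist x c).
  by apply: measurable_eucl_dist.
have -> : eball c r = (fun x : X => eucl_dist x c) @^-1` `]-oo, r[%classic.
  by apply/seteqP; split => x /=; rewrite in_itv.
by rewrite -[X in measurable X]setTI; exact: m.
Qed.

End vectors.
Arguments tE {R n}.

Section leb_translation.
Context (R : realType).

(** Coordinate by coordinate: in dimension [n.+1] a translation is the product
    of a translation of the line and of one in dimension [n]. *)
Lemma leb_translation n (h : Rspace R n) :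
  mpres (leb R n) (fun x => tadd x h).
Proof.
elim: n h => [|n IH] h.
  have -> : (fun x : Rspace R 0 => tadd x h) = id.
    by apply/funext => x; rewrite (tuple0 x); exact: tuple0.
  by split.
pose sh (z : measurableTypeR R * Rspace R n) : measurableTypeR R * Rspace R n :=
  (z.1 + thead h, tadd z.2 [tuple of behead h]).
have shE z : tadd (tuple_of_pair z) h = tuple_of_pair (sh z).
  case: z => a t; apply/eq_from_tnth => i; rewrite tnth_tadd /tuple_of_pair /sh /=.
  have [->|i0] := eqVneq i ord0; first by rewrite !tnth0.
  have [j ->] : exists j, i = lift ord0 j.
    by case: (unliftP ord0 i) i0 => [j ->|->]; [exists j|rewrite eqxx].
  by rewrite !tnthS tnth_tadd [in LHS](tuple_eta h) tnthS.
split; first by apply: measurable_tadd.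
move=> A mA.
have mA' : measurable (@tuple_of_pair R n @^-1` A).
  by rewrite -[X in measurable X]setTI; exact: measurable_tuple_of_pair.
have [_ pres] := mpres_prod (mpres_translation1 (thead h))
  (IH [tuple of behead h]).
rewrite [RHS](_ : _ = (@lebesgue_measure R \x leb R n)%E (@tuple_of_pair R n @^-1` A))//.
rewrite -(pres _ mA').
rewrite [LHS](_ : _ = (@lebesgue_measure R \x leb R n)%E
  (@tuple_of_pair R n @^-1` ((fun x => tadd x h) @^-1` A)))//.
congr ((_ \x _)%E _).
apply/seteqP; split => z; rewrite /preimage /mkset shE; exact.
Qed.

Lemma tnth_lift0 n (z : Rspace R n.+1) (j : 'I_n) :
  tnth z (lift ord0 j) = tnth [tuple of behead z] j.
Proof. by rewrite [in LHS](tuple_eta z) tnthS. Qed.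

Lemma leb_cube n (x : Rspace R n) (a : R) : 0 <= a ->
  leb R n [set z | forall i, `|tnth z i - tnth x i| < a] =
  ((2 * a) ^+ n)%:E /\
  measurable [set z : Rspace R n | forall i, `|tnth z i - tnth x i| < a].
Proof.
move=> a0; elim: n x => [|n IH] x.
  have -> : [set z | forall i, `|tnth z i - tnth x i| < a] = [set: Rspace R 0].
    by apply/seteqP; split => // z _ [].
  by rewrite /= diracT expr0.
have [IH1 IH2] := IH [tuple of behead x].
set B := [set z | _] in IH1 IH2.
have -> : [set z | forall i, `|tnth z i - tnth x i| < a] =
    [set z : Rspace R n.+1 | `](thead x - a)%R, (thead x + a)%R[%classic (thead z)
        /\ B [tuple of behead z]].
  apply/seteqP; split => z /=.
    move=> zx; rewrite in_itv/=; split.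
      by have := zx ord0; rewrite ltr_distl.
    move=> i; have := zx (lift ord0 i).
    by rewrite !tnth_lift0.
  move=> [zx1 zx2] i.
  have [->|i0] := eqVneq i ord0.
    by move: zx1; rewrite in_itv/= -ltr_distl.
  have [j ->] : exists j, i = lift ord0 j.
    by case: (unliftP ord0 i) i0 => [j ->|->]; [exists j|rewrite eqxx].
  by rewrite !tnth_lift0; exact: zx2.
split.
  rewrite leb_box// IH1 lebesgue_measure_itv/= lte_fin.
  case: ifPn => [_|]; last first.
    rewrite -leNgt => xa; have -> : a = 0 by apply/le_anti; rewrite a0 andbT; lra.
    by rewrite mul0e mulr0 expr0n.
  by rewrite -EFinB -EFinM exprS; congr (_ * _)%:E; ring.
rewrite (_ : [set z | _] =
  (fun z : Rspace R n.+1 => thead z) @^-1` `](thead x - a)%R, (thead x + a)%R[ `&`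
  (fun z : Rspace R n.+1 => [tuple of behead z]) @^-1` B)//.
apply: measurableI; rewrite -[X in measurable X]setTI.
  by apply: (@measurable_tnth _ _ n.+1 ord0).
exact: measurable_behead.
Qed.

(** The ball contains the cube of half-side [e / n]. Only the order of magnitude
    [e ^ n] matters below: it is what beats the kernel in the Lebesgue point
    argument. *)
Lemma leb_ball_ge n (x : Rspace R n) (e : R) : (2 <= n)%N -> 0 < e ->
  (((2 / n%:R) ^+ n * e ^+ n)%:E <= leb R n (eball x e))%E.
Proof.
move=> n2 e0; have n0 : 0 < n%:R :> R by rewrite ltr0n; case: n n2 x.
have a0 : 0 <= e / n%:R by rewrite divr_ge0 ?ltW.
have [l m] := leb_cube x a0.
rewrite (_ : (2 / n%:R) ^+ n * e ^+ n = (2 * (e / n%:R)) ^+ n); last first.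
  by rewrite -exprMn; congr (_ ^+ _); ring.
rewrite -l; apply: le_measure; rewrite ?inE//; first exact: measurable_eball.
move=> z/= zx; rewrite /eball/= eucl_distE.
rewrite -(ltr_pXn2r (n := 2)) ?nnegrE ?sqrtr_ge0//; last exact: ltW.
rewrite sqr_sqrtr ?sqd_ge0//.
have : sqd z x <= \sum_(i < n) (e / n%:R) ^+ 2.
  apply: ler_sum => i _; rewrite -real_normK ?num_real// lerXn2r ?nnegrE//.
  exact: ltW.
move/le_lt_trans; apply.
rewrite sumr_const card_ord -mulr_natr.
set w := (X in X < _); have -> : w = e ^+ 2 / n%:R.
  by rewrite /w; field; rewrite gt_eqF.
by rewrite ltr_pdivrMr// ltr_pMr ?exprn_gt0// ltr1n.
Qed.

Lemma leb_ball_lty n (x : Rspace R n) (e : R) : (leb R n (eball x e) < +oo)%E.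
Proof.
have [e0|e0] := leP 0 e; last first.
  rewrite (_ : eball x e = set0) ?measure0//; apply/seteqP; split => // z.
  by rewrite /eball/= => /lt_trans/(_ e0); rewrite ltNge eucl_dist_ge0.
have [l m] := leb_cube x e0.
apply: (@le_lt_trans _ _ ((2 * e) ^+ n)%:E); last exact: ltry.
rewrite -l; apply: le_measure; rewrite ?inE//; first exact: measurable_eball.
by move=> z/= zx i; exact: le_lt_trans (abs_tnth_le_dist _ _ _) zx.
Qed.

(** The proof of the uniqueness of Haar measure, applied to Lebesgue measure and
    its image under [T]: for a symmetric set [B] that [T] preserves, here the
    unit ball, both [mu (T^-1 A) * mu B] and [mu A * mu B] are the double
    integral of [1_B y * 1_A (T x + y)], by Tonelli and translations in one
    variable or the other; and [mu B] can be divided out. *)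
Lemma leb_linear_isometry n (T : Rspace R n -> Rspace R n) : (2 <= n)%N ->
  measurable_fun setT T -> involutive T ->
  (forall x y, T (tadd x y) = tadd (T x) (T y)) ->
  (forall x y, eucl_dist (T x) (T y) = eucl_dist x y) ->
  mpres (leb R n) T.
Proof.
move=> n2 mT TK TD Td; split => // A mA.
pose B : set (Rspace R n) := eball (tzero R n) 1.
have mB : measurable B by exact: measurable_eball.
have T0 : T (tzero R n) = tzero R n.
  have := TD (tzero R n) (tzero R n).
  have -> : tadd (tzero R n) (tzero R n) = tzero R n.
    by apply/eq_from_tnth => i; rewrite !tE addr0.
  move=> h; apply/eq_from_tnth => i; rewrite tE.
  have := congr1 (fun t => tnth t i) h; rewrite tE => /eqP.
  by rewrite eq_sym -subr_eq0 addrK => /eqP.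
have TN x : T (topp x) = topp (T x).
  have : tadd (T (topp x)) (T x) = tzero R n.
    by rewrite -TD -T0; congr T; apply/eq_from_tnth => i; rewrite !tE addNr.
  move=> h; apply/eq_from_tnth => i.
  have := congr1 (fun t => tnth t i) h; rewrite !tE => /eqP.
  by rewrite addr_eq0 => /eqP.
have BN x : B (topp x) = B x.
  rewrite /B /eball/=; congr (is_true (_ < _)); congr Num.sqrt.
  by apply: eq_bigr => i _; rewrite !tE; ring.
have BT x : B (T x) = B x by rewrite /B /eball/= -{1}T0 Td.
have mi d (U : measurableType d) (C : set U) : measurable C ->
    measurable_fun setT (fun x => (\1_C x)%:E : \bar R).
  by move=> mC; apply/measurable_EFinP; exact: measurable_indic.
have muE (C : set (Rspace R n)) : measurable C -> leb R n C = (\int[leb R n]_x (\1_C x)%:E)%E.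
  by move=> mC; rewrite integral_indic// setIT.
have mTA : measurable (T @^-1` A) by rewrite -[X in measurable X]setTI; exact: mT.
have i0 d (U : measurableType d) (C : set U) z : (0 <= (\1_C z)%:E :> \bar R)%E.
  by rewrite lee_fin.
have b0 : (0 < leb R n B)%E.
  apply: lt_le_trans (leb_ball_ge (tzero R n) n2 ltr01).
  by rewrite lte_fin expr1n mulr1 exprn_gt0// divr_gt0// ltr0n (leq_trans _ n2).
have bfin : leb R n B \is a fin_num.
  by rewrite ge0_fin_numE ?leb_ball_lty.
suff : (leb R n (T @^-1` A) * leb R n B = leb R n A * leb R n B)%E.
  move=> h; rewrite -[LHS]mule1 -[RHS]mule1.
  rewrite -(@divee _ (leb R n B)) ?gt_eqF//.
  by rewrite !muleA h.
transitivity (\int[leb R n]_y ((\1_B y)%:E * \int[leb R n]_x (\1_A (tadd (T x) y))%:E))%E.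
  rewrite muleC (muE B)// -ge0_integralZr//; [|exact: mi].
  apply: eq_integral => y _; congr (_ * _)%E.
  rewrite muE//.
  rewrite -(mpres_ge0_integral (leb_translation (T y))
    (g := fun x => (\1_(T @^-1` A) x)%:E))//; last exact: mi.
  apply: eq_integral => x _; rewrite !indicE.
  have -> : (tadd x (T y) \in T @^-1` A) = (tadd (T x) y \in A).
    by apply/idP/idP; rewrite !inE /preimage/= TD TK.
  by [].
have mf1 : measurable_fun setT (fun z : Rspace R n * Rspace R n =>
   ((\1_B z.2)%:E * (\1_A (tadd (T z.1) z.2))%:E)%E : \bar R).
  have m1 := measurable_indic_comp (R := R) mB
    (@measurable_snd _ _ (Rspace R n) (Rspace R n)).
  have m2 : measurable_fun setT (fun z : Rspace R n * Rspace R n => tadd (T z.1) z.2).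
    by apply: measurable_tadd => //; exact: measurableT_comp.
  have m3 := emeasurable_funM m1 (measurable_indic_comp (R := R) mA m2).
  exact: m3.
have mf2 : measurable_fun setT (fun z : Rspace R n * Rspace R n =>
   ((\1_A z.2)%:E * (\1_B (tadd z.2 (topp (T z.1))))%:E)%E : \bar R).
  have m1 := measurable_indic_comp (R := R) mA
    (@measurable_snd _ _ (Rspace R n) (Rspace R n)).
  have m2 : measurable_fun setT
      (fun z : Rspace R n * Rspace R n => tadd z.2 (topp (T z.1))).
    by apply: measurable_tadd => //; apply: measurable_topp; exact: measurableT_comp.
  have m3 := emeasurable_funM m1 (measurable_indic_comp (R := R) mB m2).
  exact: m3.
transitivity (\int[leb R n]_y \int[leb R n]_x ((\1_B y)%:E * (\1_A (tadd (T x) y))%:E))%E.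
  apply: eq_integral => y _; rewrite ge0_integralZl//.
  apply: (measurable_indic_comp mA).
  by apply: measurable_tadd.
rewrite -(fubini_tonelli _ mf1); last by move=> z; rewrite mule_ge0.
transitivity (\int[leb R n]_x \int[leb R n]_y
    ((\1_A y)%:E * (\1_B (tadd y (topp (T x))))%:E))%E.
  apply: eq_integral => x _.
  rewrite -(mpres_ge0_integral (leb_translation (T x))
    (g := fun y => ((\1_A y)%:E * (\1_B (tadd y (topp (T x))))%:E)%E)).
  - by apply: eq_integral => y _; rewrite taddK taddC muleC.
  - exact: (measurableT_comp mf2 (measurable_pair1 x)).
  - by move=> y; rewrite mule_ge0.
rewrite (fubini_tonelli _ mf2); last by move=> z; rewrite mule_ge0.
rewrite (muE A)// -ge0_integralZr//; [|exact: mi].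
apply: eq_integral => y _ /=; rewrite ge0_integralZl//; last first.
  apply: (measurable_indic_comp mB).
  by apply: measurable_tadd => //; exact: measurable_topp.
congr (_ * _)%E.
rewrite (muE B mB).
rewrite -(mpres_ge0_integral (leb_translation (topp (T y)))
  (mi _ _ _ mB) (i0 _ _ _)).
apply: eq_integral => x _; congr (_%:E); rewrite !indicE; congr (_%:R).
have -> : tadd x (topp (T y)) = topp (T (tadd y (topp (T x)))).
  by rewrite TD TN TK; apply/eq_from_tnth => i; rewrite !tE; ring.
have e z : (topp (T z) \in B) = (z \in B).
  by apply/idP/idP; rewrite !inE BN BT.
by rewrite e.
Qed.

End leb_translation.

(** * Lebesgue measure versus the kernel *)

Lemma measurable_ltr_set d (T : measurableType d) (R : realType) (f g : T -> R) :
  measurable_fun setT f -> measurable_fun setT g ->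
  measurable [set x | f x < g x].
Proof.
move=> mf mg.
have m : measurable_fun setT (fun x => f x - g x) by exact: measurable_funB.
have -> : [set x | f x < g x] = (fun x => f x - g x) @^-1` `]-oo, 0[%classic.
  by apply/seteqP; split => x /=; rewrite in_itv/= subr_lt0.
by rewrite -[X in measurable X]setTI; exact: m.
Qed.

Lemma measurable_ler_set d (T : measurableType d) (R : realType) (f g : T -> R) :
  measurable_fun setT f -> measurable_fun setT g ->
  measurable [set x | f x <= g x].
Proof.
move=> mf mg.
rewrite (_ : [set x | _] = ~` [set x | g x < f x]).
  by apply: measurableC; exact: measurable_ltr_set.
by apply/seteqP; split => x /=; rewrite leNgt => /negP.
Qed.

(** The form in which vanishing integrals are used throughout: positivity of the
    integrand need only be known on the set that is to be shown null. *)
Lemma ge0_integral_le0_set d (T : measurableType d) (R : realType)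
    (mu : {measure set T -> \bar R}) (f : T -> R) (A : set T) :
  measurable A -> measurable_fun setT f -> (forall x, 0 <= f x) ->
  (forall x, A x -> 0 < f x) -> (\int[mu]_x (f x)%:E <= 0)%E -> mu A = 0%E.
Proof.
move=> mA mf f0 fA i0.
have mfE : measurable_fun setT (EFin \o f) by apply/measurable_EFinP.
have [N [mN N0 fN]] : ae_eq mu setT (EFin \o f) (cst 0%E).
  apply/ae_eq_integral_abs => //.
  apply/le_anti; rewrite integral_ge0 ?andbT//.
  apply: le_trans i0; rewrite le_eqVlt; apply/orP; left; apply/eqP.
  by apply: eq_integral => x _ /=; rewrite ger0_norm.
apply: (subset_measure0 mA mN _ N0).
move=> x Ax; apply: fN => /= /(_ I) [] fx0.
by have := fA _ Ax; rewrite fx0 ltxx.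
Qed.

(** The equality case of a comparison of integrals. Finiteness of the smaller
    integral is what allows to subtract; the larger one is then finite too. *)
Lemma integral_gap_set d (T : measurableType d) (R : realType)
    (mu : {measure set T -> \bar R}) (f1 f2 : T -> R) (A : set T) :
  measurable A -> measurable_fun setT f1 -> measurable_fun setT f2 ->
  (forall x, 0 <= f2 x) -> (forall x, f2 x <= f1 x) ->
  (forall x, A x -> f2 x < f1 x) ->
  (\int[mu]_x (f1 x)%:E <= \int[mu]_x (f2 x)%:E)%E ->
  (\int[mu]_x (f2 x)%:E < +oo)%E -> mu A = 0%E.
Proof.
move=> mA mf1 mf2 f20 f21 f21A i12 i2.
have mB : measurable_fun setT (fun x => f1 x - f2 x) by exact: measurable_funB.
apply: (@ge0_integral_le0_set _ _ _ mu (fun x => f1 x - f2 x)) => //.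
- by move=> x; rewrite subr_ge0.
- by move=> x /f21A; rewrite subr_gt0.
have i2fin : (\int[mu]_x (f2 x)%:E)%E \is a fin_num.
  by rewrite ge0_fin_numE// integral_ge0// => x _; rewrite lee_fin.
rewrite -(leeD2lE _ _ i2fin) adde0; apply: le_trans i12.
rewrite -ge0_integralD//; last 4 first.
- by move=> x _; rewrite lee_fin.
- exact/measurable_EFinP.
- by move=> x _; rewrite lee_fin subr_ge0.
- exact/measurable_EFinP.
rewrite le_eqVlt; apply/orP; left; apply/eqP.
by apply: eq_integral => x _; rewrite -EFinD; congr EFin; ring.
Qed.

Lemma normr_sin_le (R : realType) (t : R) : `|sin t| <= `|t|.
Proof.
wlog t0 : t / 0 <= t.
  move=> h; have [/h//|/ltW t0] := leP 0 t.
  by have := h (- t); rewrite sinN !normrN; apply; rewrite oppr_ge0.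
have [c _ ] := MVT_segment t0 (fun x _ => is_derive_sin x)
  (continuous_subspaceT (@continuous_sin R)).
by rewrite sin0 !subr0 => ->; rewrite normrM ler_piMl// ler_norml cos_geN1 cos_le1.
Qed.

Lemma onem_cosE (R : realType) (t : R) : 1 - cos t = 2 * sin (t / 2) ^+ 2.
Proof.
have -> : cos t = cos ((t / 2) *+ 2) by congr cos; rewrite -mulr_natr divfK.
by rewrite cos_mulr2n sin2cos2; ring.
Qed.

(** This is the bound which makes the integral in the constant of the fractional
    Laplacian converge at the origin as well as at infinity. *)
Lemma onem_cos_le (R : realType) (t : R) : 1 - cos t <= 2 * Num.min 1 (t ^+ 2).
Proof.
rewrite onem_cosE ler_pM2l// le_min; apply/andP; split.
  by rewrite sin2cos2 lerBlDr lerDl sqr_ge0.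
rewrite -(real_normK (num_real (sin _))) -(real_normK (num_real t)).
rewrite lerXn2r ?nnegrE//; apply: le_trans (normr_sin_le _) _.
by rewrite normrM [`|2^-1|]ger0_norm// ler_pdivrMr// ler_peMr// ler1n.
Qed.

Section dyadic.
Context (R : realType).

Lemma dyadic_ge1 (x : R) : 1 <= x ->
  exists k : nat, 2 ^+ k <= x /\ x < 2 ^+ k.+1.
Proof.
move=> x1.
have ex : exists k : nat, x < 2 ^+ k.+1.
  exists (Num.truncn x); apply: (lt_le_trans (truncnS_gt x)).
  by rewrite -natrX ler_nat ltnW// ltn_expl.
have [[|k] xk kmin] := ex_minnP ex.
  by exists 0%N; rewrite expr0.
exists k.+1; split => //; rewrite leNgt; apply/negP => /kmin.
by rewrite ltnn.
Qed.

Lemma nneseries_geometric_lty (M q : R) : 0 <= M -> 0 <= q -> q < 1 ->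
  (\sum_(k <oo) (M * q ^+ k)%:E < +oo)%E.
Proof.
move=> M0 q0 q1.
have t0 (k : nat) : (0 <= (M * q ^+ k)%:E)%E by rewrite lee_fin mulr_ge0 ?exprn_ge0.
apply: (@le_lt_trans _ _ (M / (1 - q))%:E); last exact: ltry.
apply: lime_le; first by apply: is_cvg_nneseries => n _ _; exact: t0.
apply: nearW => n.
rewrite sumEFin lee_fin -mulr_sumr ler_wpM2l//.
rewrite -[leRHS]mul1r ler_pdivlMr ?subr_gt0//.
have -> : (\sum_(0 <= i < n) q ^+ i) * (1 - q) = 1 - q ^+ n.
  by rewrite big_mkord -[RHS]opprB subrX1; ring.
by rewrite lerBlDr lerDl exprn_ge0.
Qed.

End dyadic.

Section kernel.
Context (R : realType) (n : nat).
Local Notation X := (Rspace R n).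
Local Notation mu := (leb R n).

Definition kern (a : R) (x y : X) : R := eucl_dist x y `^ (- a).

Lemma kern_ge0 a x y : 0 <= kern a x y. Proof. exact: powR_ge0. Qed.

Lemma kernC a x y : kern a x y = kern a y x.
Proof. by rewrite /kern eucl_distC. Qed.

Lemma kern_gt0 a x y : x != y -> 0 < kern a x y.
Proof.
move=> xy; apply: powR_gt0; rewrite lt_neqAle eucl_dist_ge0 andbT eq_sym.
by apply: contra_neq xy; exact: eucl_dist_eq0.
Qed.

Lemma measurable_kern d (T : measurableType d) a (f g : T -> X) :
  measurable_fun setT f -> measurable_fun setT g ->
  measurable_fun setT (fun t => kern a (f t) (g t)).
Proof.
move=> mf mg.
exact: (measurableT_comp (measurable_powR (- a)) (measurable_eucl_dist mf mg)).
Qed.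

Lemma kern_lt a x y x' y' : 0 < a -> x != y ->
  eucl_dist x y < eucl_dist x' y' -> kern a x' y' < kern a x y.
Proof.
move=> a0 xy d; rewrite /kern !powRN.
have d0 : 0 < eucl_dist x y.
  rewrite lt_neqAle eucl_dist_ge0 andbT eq_sym.
  by apply: contra_neq xy; exact: eucl_dist_eq0.
rewrite ltf_pV2 ?posrE ?powR_gt0//; last exact: lt_trans d.
by apply: gt0_ltr_powR; rewrite ?nnegrE ?eucl_dist_ge0.
Qed.

Lemma kern_ge a (e : R) x y : 0 < a -> 0 < eucl_dist x y -> eucl_dist x y <= e ->
  e `^ (- a) <= kern a x y.
Proof.
move=> a0 d0 d; rewrite /kern !powRN lef_pV2 ?posrE ?powR_gt0//.
  by apply: ge0_ler_powR; rewrite ?nnegrE ?(ltW a0)// ?(ltW d0)// (le_trans (ltW d0)).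
exact: lt_le_trans d.
Qed.

(** Near the origin [|z|^2 |z|^(- n - 2 s)] is integrable because [s < 1], at
    infinity [|z|^(- n - 2 s)] is because [0 < s]. On the shell
    [2^k <= |z| < 2^(k+1)] the kernel is at most [2^(- k a)], while the shell has
    measure of order [2^(k n)]: the shells contribute a geometric series of
    ratio [2^(- 2 s)]. On [2^(- k - 1) < |z| <= 2^(- k)] the same count gives the
    ratio [2^(2 s - 2)]. *)
Lemma kern_integral_lty (s : R) : (2 <= n)%N -> 0 < s -> s < 1 ->
  (\int[mu]_z (Num.min 1 (eucl_dist z (tzero R n) ^+ 2) *
     kern (n%:R + 2 * s) z (tzero R n))%:E < +oo)%E.
Proof.
move=> n2 s0 s1; set a := n%:R + 2 * s; set o := tzero R n.
have n2R : 2 <= n%:R :> R by rewrite ler_nat.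
pose r := 2 `^ (- (2 * s)) : R.
pose r' := 2 `^ (2 * s - 2) : R.
have lt1 (p : R) : p < 0 -> 2 `^ p < 1 :> R.
  move=> p0; rewrite -[p]opprK powRN invf_lt1 ?powR_gt0//.
  have h := @gt0_ltr_powR R (- p).
  have e1 : 1 `^ (- p) = 1 :> R by rewrite powR1.
  rewrite -[ltLHS]e1; apply: h; rewrite ?oppr_gt0 ?nnegrE//.
  by rewrite ltr1n.
have r1 : r < 1 by apply: lt1; nra.
have r'1 : r' < 1 by apply: lt1; nra.
(* [C k] and [D k] bound the integrand on the outer and the inner shell. For the
   latter, [|z|^(2 - a)] is a negative power, as [2 <= n], so that it is largest at
   the inner radius [2^(- k - 1)]. The indicators in [t] are those of balls that
   contain the shells. *)
pose C k : R := 2 `^ (- a) ^+ k.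
pose D k : R := 2 `^ (a - 2) * (2 `^ (a - 2)) ^+ k.
pose B (e : R) : set X := eball o e.
have Ble (e : R) : 0 <= e -> (mu (B e) <= ((2 * e) ^+ n)%:E)%E.
  move=> e0; have [<- mc] := leb_cube o e0.
  apply: le_measure; rewrite ?inE//; first exact: measurable_eball.
  by move=> z /= zx i; exact: le_lt_trans (abs_tnth_le_dist _ _ _) zx.
pose t k (z : X) : \bar R := ((C k)%:E * (\1_(B (2 ^+ k.+1)) z)%:E +
  (D k)%:E * (\1_(B (2 * 2^-1 ^+ k)) z)%:E)%E.
have C0 k : 0 <= C k by rewrite exprn_ge0// powR_ge0.
have D0 k : 0 <= D k by rewrite mulr_ge0 ?exprn_ge0// powR_ge0.
have mi e : measurable_fun setT (fun z => (\1_(B e) z)%:E : \bar R).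
  by apply: measurable_indic_comp => //; exact: measurable_eball.
have mt1 k e : measurable_fun setT (fun z => (k%:E * (\1_(B e) z)%:E)%E : \bar R).
  by apply: measurable_funeM.
have mt k : measurable_fun setT (t k) by apply: emeasurable_funD.
have t0 k z : (0 <= t k z)%E.
  by rewrite adde_ge0// mule_ge0 ?lee_fin.
apply: (@le_lt_trans _ _ (\int[mu]_z (\sum_(k <oo) t k z))%E).
  apply: ge0_le_integral => //.
  - by move=> z _; rewrite lee_fin mulr_ge0 ?kern_ge0// le_min ler01 sqr_ge0.
  - apply/measurable_EFinP; apply: measurable_funM; last exact: measurable_kern.
    by apply: measurable_minr => //; apply: measurable_funX; exact: measurable_eucl_dist.
  - exact: ge0_emeasurable_sum.
  move=> z _.
  have key k : (((Num.min 1 (eucl_dist z o ^+ 2) * kern a z o)%:E <= t k z) ->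
     ((Num.min 1 (eucl_dist z o ^+ 2) * kern a z o)%:E <= \sum_(k <oo) t k z))%E.
    move=> h; apply: le_trans (nneseries_lim_ge k.+1 _) => //.
    rewrite big_mkord big_ord_recr/=; apply: (le_trans h).
    by rewrite leeDr// sume_ge0.
  have [d0|] := eqVneq (eucl_dist z o) 0.
    apply: (key 0%N); rewrite d0 expr0n/= min_r// mul0r; exact: t0.
  move=> d0; have {}d0 : 0 < eucl_dist z o by rewrite lt_neqAle eq_sym d0 eucl_dist_ge0.
  have [d1|d1] := leP 1 (eucl_dist z o).
    have [k [k1 k2]] := dyadic_ge1 d1.
    apply: (key k); rewrite min_l ?exprn_ege1// mul1r /t.
    rewrite (_ : \1_(B (2 ^+ k.+1)) z = 1) ?mule1; last first.
      by rewrite indicE mem_set.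
    apply: (@le_trans _ _ (C k)%:E); last by rewrite leeDl// mule_ge0 ?lee_fin.
    rewrite lee_fin /kern /C.
    rewrite -powR_mulrn ?powR_ge0// -powRrM mulrC powRrM powR_mulrn//.
    have p2 : 0 < 2 ^+ k :> R by rewrite exprn_gt0.
    rewrite !powRN lef_pV2 ?posrE ?powR_gt0//.
    apply: ge0_ler_powR; rewrite ?nnegrE ?exprn_ge0 ?eucl_dist_ge0//.
    by rewrite addr_ge0// ?mulr_ge0// ltW.
  have d1' : 1 <= (eucl_dist z o)^-1 by rewrite invf_ge1// ltW.
  have [k [k1 k2]] := dyadic_ge1 d1'.
  apply: (key k); rewrite min_r ?exprn_ile1 ?(ltW d1)// /t; last first.
    by rewrite ltW.
  rewrite (_ : \1_(B (2 * 2^-1 ^+ k)) z = 1) ?mule1; last first.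
    rewrite indicE mem_set// /B /eball/=.
    have : eucl_dist z o <= 2^-1 ^+ k.
      by rewrite exprVn -[leLHS]invrK lef_pV2 ?posrE ?invr_gt0 ?exprn_gt0.
    move/le_lt_trans; apply; rewrite ltr_pMl ?ltr1n//.
  apply: (@le_trans _ _ (D k)%:E); last by rewrite leeDr// mule_ge0 ?lee_fin.
  rewrite lee_fin /kern /D.
  have -> : 2 `^ (a - 2) * (2 `^ (a - 2)) ^+ k = (2 ^+ k.+1) `^ (a - 2) :> R.
    by rewrite -exprS -powR_mulrn ?powR_ge0// -powRrM mulrC powRrM powR_mulrn.
  have -> : eucl_dist z o ^+ 2 * eucl_dist z o `^ (- a) =
      (eucl_dist z o)^-1 `^ (a - 2).
    rewrite -powR_inv1 ?eucl_dist_ge0// -powRrM -powR_mulrn ?eucl_dist_ge0//.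
    rewrite -powRD; last by rewrite (gt_eqF d0) implybT.
    by congr (_ `^ _); ring.
  apply: ge0_ler_powR; rewrite ?nnegrE ?exprn_ge0 ?invr_ge0 ?eucl_dist_ge0//.
    by rewrite /a; nra.
  exact: ltW.
rewrite integral_nneseries//.
pose M := (4 ^+ n + 2 `^ (a - 2) * 4 ^+ n : R).
pose q := Num.max r r'.
apply: le_lt_trans (nneseries_geometric_lty (M := M) (q := q) _ _ _); last 3 first.
- by rewrite addr_ge0 ?mulr_ge0 ?exprn_ge0 ?powR_ge0.
- by rewrite le_max powR_ge0.
- by rewrite gt_max r1.
apply: lee_nneseries => [k _ _|k _]; first exact: integral_ge0.
rewrite ge0_integralD//; last 2 first.
- by move=> z _; rewrite mule_ge0 ?lee_fin.
- by move=> z _; rewrite mule_ge0 ?lee_fin.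
rewrite !ge0_integralZl ?lee_fin//.
rewrite !integral_indic ?setIT//; try exact: measurable_eball.
have -> : M * q ^+ k = 4 ^+ n * q ^+ k + 2 `^ (a - 2) * 4 ^+ n * q ^+ k.
  by rewrite /M; ring.
rewrite EFinD; apply: leeD.
- apply: (@le_trans _ _ ((C k)%:E * ((2 * 2 ^+ k.+1) ^+ n)%:E)%E).
    by apply: lee_wpmul2l; [rewrite lee_fin|apply: Ble; rewrite exprn_ge0].
  rewrite -EFinM lee_fin.
  have -> : C k * (2 * 2 ^+ k.+1) ^+ n = 4 ^+ n * r ^+ k.
    rewrite exprS mulrA -[2 * 2](_ : 4 = _)//; last by ring.
    rewrite exprMn mulrCA; congr (_ * _).
    rewrite -exprM mulnC exprM -exprMn; congr (_ ^+ _).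
    rewrite -powR_mulrn// -powRD; last by rewrite pnatr_eq0 implybT.
    by rewrite /r; congr (_ `^ _); rewrite /a; ring.
  by rewrite ler_wpM2l ?exprn_ge0// lerXn2r ?nnegrE ?le_max ?lexx ?powR_ge0.
- apply: (@le_trans _ _ ((D k)%:E * ((2 * (2 * 2^-1 ^+ k)) ^+ n)%:E)%E).
    by apply: lee_wpmul2l; [rewrite lee_fin|apply: Ble; rewrite mulr_ge0 ?exprn_ge0].
  rewrite -EFinM lee_fin.
  have -> : D k * (2 * (2 * 2^-1 ^+ k)) ^+ n = 2 `^ (a - 2) * 4 ^+ n * r' ^+ k.
    rewrite mulrA -[2 * 2](_ : 4 = _)//; last by ring.
    rewrite exprMn /D -!mulrA; congr (_ * _); rewrite mulrCA; congr (_ * _).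
    rewrite -exprM mulnC exprM -exprMn; congr (_ ^+ _).
    rewrite exprVn -powR_invn// -powRD; last by rewrite pnatr_eq0 implybT.
    by rewrite /r'; congr (_ `^ _); rewrite /a; ring.
  rewrite ler_wpM2l ?mulr_ge0 ?exprn_ge0 ?powR_ge0//.
  by rewrite lerXn2r ?nnegrE ?le_max ?lexx ?powR_ge0 ?orbT.
Qed.

Lemma kern_intE (s : R) (y : X) :
  (\int[mu]_z (Num.min 1 (eucl_dist z y ^+ 2) *
     kern (n%:R + 2 * s) z y)%:E =
   \int[mu]_z (Num.min 1 (eucl_dist z (tzero R n) ^+ 2) *
     kern (n%:R + 2 * s) z (tzero R n))%:E)%E.
Proof.
have m : measurable_fun setT (fun z : X => (Num.min 1 (eucl_dist z y ^+ 2) *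
     kern (n%:R + 2 * s) z y)%:E : \bar R).
  apply/measurable_EFinP; apply: measurable_funM; last exact: measurable_kern.
  by apply: measurable_minr => //; apply: measurable_funX; exact: measurable_eucl_dist.
rewrite -(mpres_ge0_integral (leb_translation y) m); last first.
  by move=> z; rewrite lee_fin mulr_ge0 ?kern_ge0// le_min ler01 sqr_ge0.
apply: eq_integral => z _.
have d : eucl_dist (tadd z y) y = eucl_dist z (tzero R n).
  rewrite -(eucl_dist_taddr z (tzero R n) y); congr eucl_dist.
  by apply/eq_from_tnth => i; rewrite !tE add0r.
by rewrite /kern d.
Qed.

(** Were the integral infinite or zero, the constant would be [0], all Rayleigh
    quotients would vanish and minimality would say nothing. It is finite by
    the previous estimate, and positive because its integrand is positive on
    the cube of side [1] centred at [(1, ..., 1)]. *)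
Lemma fraclap_const_gt0 (s : R) : (2 <= n)%N -> 0 < s -> s < 1 ->
  0 < fraclap_const n s :> R.
Proof.
move=> n2 s0 s1; rewrite /fraclap_const invr_gt0.
have -> : [tuple of nseq n 0] = tzero R n.
  by apply/eq_from_tnth => i; rewrite tE tnth_nseq.
pose f (z : X) := (1 - cos (nth 0 z 0%N)) /
  eucl_dist z (tzero R n) `^ (n%:R + 2 * s).
have n0 : (0 < n)%N by exact: leq_trans n2.
pose i0 := Ordinal n0.
have fE z : f z = (1 - cos (tnth z i0)) * kern (n%:R + 2 * s) z (tzero R n).
  by rewrite /f /kern powRN (tnth_nth 0).
have f0 z : 0 <= f z.
  by rewrite fE mulr_ge0 ?kern_ge0// subr_ge0 cos_le1.
have mf : measurable_fun setT f.
  apply: (eq_measurable_fun (fun z => (1 - cos (tnth z i0)) *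
     kern (n%:R + 2 * s) z (tzero R n))).
    by move=> z _; rewrite fE.
  apply: measurable_funM; last exact: measurable_kern.
  apply: measurable_funB => //.
  have mc : measurable_fun setT (@cos R).
    by apply: continuous_measurable_fun; exact: continuous_cos.
  have mt : measurable_fun setT (fun z : X => tnth z i0 : R).
    exact: measurable_fun_tnth.
  exact: (measurableT_comp mc mt).
have mfE : measurable_fun setT (fun z => (f z)%:E) by apply/measurable_EFinP.
have lt : (\int[mu]_z (f z)%:E < +oo)%E.
  have m : measurable_fun setT (fun z : X => (Num.min 1 (eucl_dist z (tzero R n) ^+ 2) *
     kern (n%:R + 2 * s) z (tzero R n))%:E : \bar R).
    apply/measurable_EFinP; apply: measurable_funM; last exact: measurable_kern.
    by apply: measurable_minr => //; apply: measurable_funX; exact: measurable_eucl_dist.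
  have p z : (0 <= (Num.min 1 (eucl_dist z (tzero R n) ^+ 2) *
     kern (n%:R + 2 * s) z (tzero R n))%:E)%E.
    by rewrite lee_fin mulr_ge0 ?kern_ge0// le_min ler01 sqr_ge0.
  apply: (@le_lt_trans _ _ (2%:E * \int[mu]_z (Num.min 1 (eucl_dist z (tzero R n) ^+ 2) *
     kern (n%:R + 2 * s) z (tzero R n))%:E)%E).
    rewrite -ge0_integralZl ?lee_fin//.
    apply: ge0_le_integral => //.
    - by move=> z _; rewrite lee_fin.
    - by apply: measurable_funeM.
    move=> z _; rewrite -EFinM lee_fin fE mulrA ler_wpM2r ?kern_ge0//.
    apply: le_trans (onem_cos_le _) _; rewrite ler_pM2l// le_min !ge_min lexx/=.
    apply/orP; right; rewrite -(real_normK (num_real (tnth z i0))).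
    rewrite lerXn2r ?nnegrE ?eucl_dist_ge0//.
    by have := abs_tnth_le_dist z (tzero R n) i0; rewrite tE subr0.
  by rewrite lte_mul_pinfty// kern_integral_lty.
rewrite /Rintegral fine_gt0// lt andbT ltNge; apply/negP => h0.
pose x1 : X := tmap (fun=> 1).
have h2 : 0 <= 2^-1 :> R by rewrite invr_ge0.
have [lc mc] := leb_cube x1 h2.
have : mu [set z : X | forall i, `|tnth z i - tnth x1 i| < 2^-1] = 0%E.
  apply: (ge0_integral_le0_set mc mf f0 _ h0) => z /= zx.
  have := zx i0; rewrite tE ltr_distl => /andP[z1 z2].
  rewrite fE mulr_gt0//; last first.
    apply: kern_gt0; apply/eqP => z0; move: z1; rewrite z0 tE; lra.
  rewrite onem_cosE mulr_gt0// exprn_gt0// sin2_gt0//.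
  by apply/andP; split; lra.
by rewrite lc mulfV// expr1n => -[] /eqP; rewrite oner_eq0.
Qed.

End kernel.

(** * Reflections and polarisation *)

Section swap.
Context d (T : measurableType d) (R : realType).
Variables (mu : {measure set T -> \bar R}) (f g : T -> T) (P : set T).
Hypotheses (fK : cancel f g) (gK : cancel g f).
Hypotheses (muf : mpres mu f) (mug : mpres mu g).
Hypotheses (mP : measurable P) (Pf : forall x, P x -> ~ P (f x)).

(** The map exchanging [P] and [f P], two disjoint sets by [Pf]. It is the only
    way in which functions get rearranged here: along a reflection to polarise
    them, and along a translation to reorder the weight. *)
Definition swap (x : T) : T :=
  if x \in P then f x else if g x \in P then g x else x.

Lemma swap_in x : P x -> swap x = f x.
Proof. by move=> Px; rewrite /swap mem_set. Qed.

Lemma swap_im x : P (g x) -> swap x = g x.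
Proof.
move=> Px; rewrite /swap memNset ?mem_set// => Pxx.
by apply: (Pf Px); rewrite gK.
Qed.

Lemma swap_out x : ~ P x -> ~ P (g x) -> swap x = x.
Proof. by move=> ? ?; rewrite /swap !memNset. Qed.

(** The preimage of [A] splits into three disjoint pieces, in [P], in [f P] and in
    neither; the first two are carried by [f] and [g] onto the parts of [A] in
    [f P] and in [P]. *)
Lemma mpres_swap : mpres mu swap.
Proof.
have [mf pf] := muf; have [mg pg] := mug.
have mpre (h : T -> T) (A : set T) : measurable_fun setT h -> measurable A ->
    measurable (h @^-1` A) by move=> mh mA; rewrite -[X in measurable X]setTI; exact: mh.
have swE A : swap @^-1` A = (P `&` f @^-1` A) `|` (g @^-1` P `&` g @^-1` A) `|`
    (~` P `&` ~` (g @^-1` P) `&` A).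
  apply/seteqP; split => x /=.
    move=> Ax; have [Px|Px] := pselect (P x).
      by left; left; rewrite swap_in in Ax.
    have [Pgx|Pgx] := pselect (P (g x)).
      by left; right; rewrite swap_im in Ax.
    by right; rewrite swap_out in Ax.
  move=> [[[Px Ax]|[Px Ax]]|[[Px Pgx] Ax]].
  - by rewrite swap_in.
  - by rewrite swap_im.
  - by rewrite swap_out.
have m1 A : measurable A -> measurable (P `&` f @^-1` A).
  by move=> mA; apply: measurableI => //; exact: mpre.
have m2 A : measurable A -> measurable (g @^-1` P `&` g @^-1` A).
  by move=> mA; apply: measurableI => //; exact: mpre.
have m3 A : measurable A -> measurable (~` P `&` ~` (g @^-1` P) `&` A).
  move=> mA; apply: measurableI => //; apply: measurableI; apply: measurableC => //.
  exact: mpre.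
have muU A B : measurable A -> measurable B -> A `&` B = set0 ->
    mu (A `|` B) = (mu A + mu B)%E by move=> mA mB AB; rewrite measureU.
split.
  move=> _ A mA; rewrite setTI swE.
  by apply: measurableU; [apply: measurableU; [exact: m1|exact: m2]|exact: m3].
move=> A mA; rewrite swE muU; last 3 first.
- by apply: measurableU; [exact: m1|exact: m2].
- exact: m3.
- by apply/seteqP; split => // x /= [[[? ?]|[? ?]] [[? ?] ?]].
rewrite muU; last 3 first.
- exact: m1.
- exact: m2.
- apply/seteqP; split => // x /= [[Px _] [Pgx _]].
  by apply: (Pf Pgx); rewrite gK.
have -> : P `&` f @^-1` A = f @^-1` (g @^-1` P `&` A).
  by apply/seteqP; split => x /=; rewrite fK.
have -> : g @^-1` P `&` g @^-1` A = g @^-1` (P `&` A) by [].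
rewrite pf; last by apply: measurableI => //; exact: mpre.
rewrite pg; last exact: measurableI.
rewrite -muU; last 3 first.
- by apply: measurableI => //; exact: mpre.
- exact: measurableI.
- apply/seteqP; split => // x /= [[Pgx _] [Px _]].
  by apply: (Pf Pgx); rewrite gK.
rewrite -muU; last 3 first.
- by apply: measurableU; apply: measurableI => //; exact: mpre.
- exact: m3.
- by apply/seteqP; split => // x /= [[[? ?]|[? ?]] [[? ?] ?]].
congr (mu _); apply/seteqP; split => x /=.
  by move=> [[[_ Ax]|[_ Ax]]|[_ Ax]].
move=> Ax; have [Px|Px] := pselect (P x); first by left; right.
by have [Pgx|Pgx] := pselect (P (g x)); [left; left|right].
Qed.

End swap.

Section reflection.
Context (R : realType) (n : nat).
Local Notation X := (Rspace R n).
Variables (x y : X).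
Hypothesis xy : x != y.

Let e : X := tadd y (topp x).

(** The inner product of [y - x] with the vector from the midpoint of [x] and [y]
    to [z]: negative on the half-space of the points closer to [x] than to
    [y]. *)
Definition side (z : X) : R :=
  \sum_(i < n) (tnth z i - (tnth x i + tnth y i) / 2) * (tnth y i - tnth x i).

(** The orthogonal reflection exchanging [x] and [y]. *)
Definition refl (z : X) : X :=
  tmap (fun i => tnth z i - 2 * side z / sqd y x * (tnth y i - tnth x i)).

Lemma sqd_gt0 : 0 < sqd y x.
Proof.
rewrite lt_neqAle sqd_ge0 andbT eq_sym.
by apply: contra_neq xy => /sqd_eq0.
Qed.

Lemma sqd_side z : sqd z x = sqd z y + 2 * side z.
Proof.
rewrite /sqd /side mulr_sumr -big_split/=.
by apply: eq_bigr => i _; field.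
Qed.

Lemma side_lt0 z : (side z < 0) = (eucl_dist z x < eucl_dist z y).
Proof. by rewrite eucl_dist_lt sqd_side; apply/idP/idP; lra. Qed.

Definition along (z : X) (k : R) : X :=
  tmap (fun i => tnth z i - k * (tnth y i - tnth x i)).

Lemma side_along z k : side (along z k) = side z - k * sqd y x.
Proof.
rewrite /side /sqd mulr_sumr -sumrB.
by apply: eq_bigr => i _; rewrite tE; ring.
Qed.

Lemma sqd_along z z' k :
  sqd z (along z' k) = sqd z z' + 2 * k * (side z - side z') + k ^+ 2 * sqd y x.
Proof.
rewrite /side /sqd -sumrB !mulr_sumr -!big_split/=.
by apply: eq_bigr => i _; rewrite tE; ring.
Qed.

Lemma side_refl z : side (refl z) = - side z.
Proof. by rewrite side_along divfK ?gt_eqF ?sqd_gt0//; ring. Qed.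

Lemma reflK : involutive refl.
Proof.
move=> z; apply/eq_from_tnth => i; rewrite tE side_refl tE; ring.
Qed.

Lemma refl_fix z : side z = 0 -> refl z = z.
Proof.
by move=> z0; apply/eq_from_tnth => i; rewrite tE z0 mulr0 !mul0r subr0.
Qed.

(** The identity behind polarisation: reflecting one of two points increases
    their distance exactly when they lie on the same side of the mirror. *)
Lemma refl_sqd z z' : sqd z (refl z') = sqd z z' + 4 * (side z * side z') / sqd y x.
Proof.
rewrite sqd_along; field; rewrite gt_eqF ?sqd_gt0//.
Qed.

Lemma refl_dist z z' : eucl_dist (refl z) (refl z') = eucl_dist z z'.
Proof.
rewrite !eucl_distE; congr Num.sqrt.
rewrite refl_sqd sqdC refl_sqd side_refl sqdC; ring.
Qed.

Lemma refl_dist_swap z z' : eucl_dist (refl z) z' = eucl_dist z (refl z').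
Proof. by rewrite -refl_dist reflK. Qed.

Lemma refl_lt z z' : 0 < side z * side z' ->
  eucl_dist z z' < eucl_dist z (refl z').
Proof.
move=> h; rewrite eucl_dist_lt refl_sqd ltrDl divr_gt0 ?sqd_gt0//.
by rewrite mulr_gt0.
Qed.

Lemma refl_x : refl x = y.
Proof.
have h : side x = - (sqd y x / 2).
  by rewrite /side /sqd mulr_suml -sumrN; apply: eq_bigr => i _; field.
apply/eq_from_tnth => i; rewrite tE h.
by field; rewrite gt_eqF ?sqd_gt0.
Qed.

Lemma measurable_side : measurable_fun setT side.
Proof.
apply: measurable_sum => i; apply: measurable_funM => //.
by apply: measurable_funB => //; exact: measurable_fun_tnth.
Qed.

Lemma measurable_refl : measurable_fun setT refl.
Proof.
apply: measurable_tmap => i; apply: measurable_funB; first exact: measurable_fun_tnth.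
apply: measurable_funM => //; apply: measurable_funM => //.
by apply: measurable_funM => //; exact: measurable_side.
Qed.

(** A linear isometric involution followed by a translation. *)
Lemma mpres_refl : (2 <= n)%N -> mpres (leb R n) refl.
Proof.
move=> n2.
pose L (z : X) : X := tmap (fun i => tnth z i -
   2 * dot z e / sqd y x * tnth e i).
pose t : X := tmap (fun i => 2 * (\sum_(i < n) (tnth x i + tnth y i) / 2 *
    (tnth y i - tnth x i)) / sqd y x * tnth e i).
have side_dot z : side z = dot z e - \sum_(i < n) (tnth x i + tnth y i) / 2 *
    (tnth y i - tnth x i).
  rewrite /side /dot -sumrB; apply: eq_bigr => i _; rewrite !tE; ring.
have -> : refl = (fun z => tadd z t) \o L.
  apply/funext => z; apply/eq_from_tnth => i /=; rewrite !tE side_dot; ring.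
have LD u w : L (tadd u w) = tadd (L u) (L w).
  have dD : dot (tadd u w) e = dot u e + dot w e.
    by rewrite /dot -big_split/=; apply: eq_bigr => i _; rewrite !tE; ring.
  by apply/eq_from_tnth => i; rewrite !tE dD; ring.
have LE z : L z = tadd (refl z) (topp t).
  by apply/eq_from_tnth => i; rewrite !tE side_dot; ring.
apply: mpres_comp; first exact: leb_translation.
apply: leb_linear_isometry => //.
- apply: measurable_tmap => i; apply: measurable_funB; first exact: measurable_fun_tnth.
  apply: measurable_funM => //; apply: measurable_funM => //.
  by apply: measurable_funM => //; exact: measurable_dot.
- move=> z.
  have dL : dot (L z) e = - dot z e.
    have dk k : dot (tmap (fun i => tnth z i - k * tnth e i)) e =
        dot z e - k * sqd y x.
      rewrite /dot /sqd mulr_sumr -sumrB.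
      by apply: eq_bigr => i _; rewrite !tE; ring.
    by rewrite dk divfK ?gt_eqF ?sqd_gt0//; ring.
  by apply/eq_from_tnth => i; rewrite [LHS]tE dL [tnth (L z) i]tE; ring.
- by move=> u w; rewrite !LE eucl_dist_taddr refl_dist.
Qed.

End reflection.

Section energy.
Context (R : realType) (n : nat) (a : R).
Hypotheses (a0 : 0 < a).
Local Notation X := (Rspace R n).
Local Notation mu := (leb R n).
Local Notation mu2 := (leb R n \x leb R n)%E.

(** The density, for the product measure, of the squared Gagliardo seminorm. *)
Definition eden (f : X -> R) (z : X * X) : R :=
  (f z.1 - f z.2) ^+ 2 * kern a z.1 z.2.

Definition energy (f : X -> R) : \bar R := (\int[mu2]_z (eden f z)%:E)%E.

Lemma eden_ge0 f z : 0 <= eden f z.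
Proof. by rewrite mulr_ge0 ?sqr_ge0 ?kern_ge0. Qed.

Lemma energy_ge0 f : (0 <= energy f)%E.
Proof. by apply: integral_ge0 => z _; rewrite lee_fin eden_ge0. Qed.

Lemma measurable_fst_comp (f : X -> R) : measurable_fun setT f ->
  measurable_fun setT (fun z : X * X => f z.1).
Proof. by move=> mf; exact: (measurableT_comp mf measurable_fst). Qed.

Lemma measurable_snd_comp (f : X -> R) : measurable_fun setT f ->
  measurable_fun setT (fun z : X * X => f z.2).
Proof. by move=> mf; exact: (measurableT_comp mf measurable_snd). Qed.

Lemma measurable_kern2 : measurable_fun setT (fun z : X * X => kern a z.1 z.2).
Proof. exact: measurable_kern. Qed.

Lemma measurable_eden f : measurable_fun setT f -> measurable_fun setT (eden f).
Proof.
move=> mf; apply: measurable_funM; last exact: measurable_kern2.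
apply: measurable_funX; apply: measurable_funB.
  exact: measurable_fst_comp.
exact: measurable_snd_comp.
Qed.

Lemma prod_null (A B : set X) : measurable A -> measurable B ->
  mu2 (A `*` B) = 0%E -> mu A = 0%E \/ mu B = 0%E.
Proof.
move=> mA mB; rewrite product_measure1E// => /eqP.
by rewrite mule_eq0 => /orP[] /eqP ->; [left|right].
Qed.

Lemma mpres_id : mpres mu (fun x => x).
Proof. by split; first exact: measurable_id. Qed.

Section polarization.
Variables (x0 y0 : X) (v : X -> R).
Hypotheses (n2 : (2 <= n)%N) (xy0 : x0 != y0) (mv : measurable_fun setT v).
Local Notation sg := (refl x0 y0).
Local Notation bt := (side x0 y0).

Definition wdiff (z : X) : R := v z - v (sg z).

(** The points where the larger of the values at [z] and at its mirror image is
    taken on the side of [y0]. Polarisation brings it to the side of [x0]. *)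
Definition misplaced : set X := [set z | 0 < bt z * wdiff z].

Definition polarize (z : X) : X := if z \in misplaced then sg z else z.

Lemma measurable_wdiff : measurable_fun setT wdiff.
Proof.
apply: measurable_funB => //.
exact: (measurableT_comp mv (measurable_refl x0 y0)).
Qed.

Lemma measurable_misplaced : measurable misplaced.
Proof.
apply: measurable_ltr_set => //.
by apply: measurable_funM; [exact: measurable_side|exact: measurable_wdiff].
Qed.

Lemma misplaced_refl z : (sg z \in misplaced) = (z \in misplaced).
Proof.
have h : bt (sg z) * wdiff (sg z) = bt z * wdiff z.
  by rewrite side_refl// /wdiff reflK//; ring.
by apply/idP/idP; rewrite !inE /misplaced/= h.
Qed.

(** [misplaced] is invariant under the reflection and does not meet the mirror,
    hence it is the union of its part on the side of [x0] and of the mirror image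
    of that part. *)
Lemma mpres_polarize : mpres mu polarize.
Proof.
pose P := misplaced `&` [set z | bt z < 0].
have PE z : (z \in P) = (z \in misplaced) && (bt z < 0).
  by apply/idP/andP; rewrite !inE.
have -> : polarize = swap sg sg P.
  apply/funext => z; rewrite /polarize /swap !PE misplaced_refl side_refl//.
  case: (boolP (z \in misplaced)) => [|//]; rewrite inE /misplaced/= => h.
  case: ifPn => //; rewrite -leNgt => h2.
  case: ifPn => //; rewrite -leNgt oppr_ge0 => h3.
  have b0 : bt z = 0 by apply/le_anti; rewrite h3.
  by move: h; rewrite b0 mul0r ltxx.
have mP : measurable P.
  apply: measurableI; first exact: measurable_misplaced.
  by apply: measurable_ltr_set => //; exact: measurable_side.
apply: (mpres_swap (reflK xy0) (reflK xy0)) => //; try exact: mpres_refl.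
by move=> z [_ /= h] [_ /=]; rewrite side_refl//; lra.
Qed.

(** Reflecting either variable preserves the product measure. Summing over the
    four images of a pair of points gathers all the terms in which the four
    values of [v] at [z], [z'] and their images interact, and reduces a
    comparison of integrals to a pointwise one. *)
Let fold4 (f : X * X -> R) (z : X * X) : R :=
  f z + f (sg z.1, sg z.2) + f (z.1, sg z.2) + f (sg z.1, z.2).

Let measurable_fold4 (f : X * X -> R) : measurable_fun setT f ->
  measurable_fun setT (fold4 f).
Proof.
move=> mf.
have [p1 _] := mpres_prod (mpres_refl xy0 n2) (mpres_refl xy0 n2).
have [p2 _] := mpres_prod mpres_id (mpres_refl xy0 n2).
have [p3 _] := mpres_prod (mpres_refl xy0 n2) mpres_id.
apply: measurable_funD; last exact: (measurableT_comp mf p3).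
apply: measurable_funD; last exact: (measurableT_comp mf p2).
by apply: measurable_funD => //; exact: (measurableT_comp mf p1).
Qed.

Let fold4_integral (f : X * X -> R) : measurable_fun setT f ->
  (forall z, 0 <= f z) ->
  (\int[mu2]_z (fold4 f z)%:E = 4%:E * \int[mu2]_z (f z)%:E)%E.
Proof.
move=> mf f0.
have mfE : measurable_fun setT (fun z => (f z)%:E) by apply/measurable_EFinP.
have fE0 z : (0 <= (f z)%:E)%E by rewrite lee_fin.
have p1 := mpres_prod (mpres_refl xy0 n2) (mpres_refl xy0 n2).
have p2 := mpres_prod mpres_id (mpres_refl xy0 n2).
have p3 := mpres_prod (mpres_refl xy0 n2) mpres_id.
have i1 := mpres_ge0_integral p1 mfE fE0.
have i2 := mpres_ge0_integral p2 mfE fE0.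
have i3 := mpres_ge0_integral p3 mfE fE0.
have m1 := measurableT_comp mfE p1.1.
have m2 := measurableT_comp mfE p2.1.
have m3 := measurableT_comp mfE p3.1.
rewrite /fold4; under eq_integral do rewrite !EFinD.
rewrite ge0_integralD//; last 2 first.
- by move=> z _; rewrite !adde_ge0.
- by apply: emeasurable_funD => //; apply: emeasurable_funD.
rewrite ge0_integralD//; last 2 first.
- by move=> z _; rewrite !adde_ge0.
- by apply: emeasurable_funD.
rewrite ge0_integralD// i1 i2 i3.
have : (0 <= \int[mu2]_z (f z)%:E)%E by apply: integral_ge0.
case: (\int[mu2]_z (f z)%:E)%E => [r| |]// _.
  by rewrite -!EFinD -EFinM; congr EFin; ring.
by rewrite gt0_muley// lte_fin.
Qed.

Let K1 z z' : kern a (sg z) (sg z') = kern a z z'.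
Proof. by rewrite /kern refl_dist. Qed.

Let K2 z z' : kern a (sg z) z' = kern a z (sg z').
Proof. by rewrite /kern refl_dist_swap. Qed.

(** If both points are misplaced or neither is, polarisation merely permutes the
    four terms. If only [u] is misplaced, the values meeting at distance
    [|u - u'|] and those meeting at distance [|u - refl u'|] are exchanged, and
    the sum changes by a positive multiple of
    [wdiff u * wdiff u' * (kern a u u' - kern a u (refl u'))]: by [refl_lt] and
    the monotonicity of the kernel, its sign is that of
    [(side u * wdiff u) * (side u' * wdiff u')], a product of a positive and of
    a nonpositive number. *)
Let fold4_le z : fold4 (eden (v \o polarize)) z <= fold4 (eden v) z /\
  (z.1 \in misplaced -> bt z.2 * wdiff z.2 < 0 ->
   fold4 (eden (v \o polarize)) z < fold4 (eden v) z).
Proof.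
case: z => z z'; rewrite /fold4 /eden /= /polarize !misplaced_refl !reflK// !K1 !K2.
set k1 := kern a z z'; set k2 := kern a z (sg z').
have key u u' : u \in misplaced -> u' \notin misplaced ->
    wdiff u * wdiff u' * (kern a u u' - kern a u (sg u')) <= 0 /\
    (bt u' * wdiff u' < 0 ->
     wdiff u * wdiff u' * (kern a u u' - kern a u (sg u')) < 0).
  move=> uS u'S.
  have uu' : u != u' by apply: contraNneq u'S => <-.
  have usu' : u != sg u'.
    by apply: contraNneq u'S => h; rewrite -misplaced_refl -h.
  move: uS u'S; rewrite inE notin_setE /misplaced/= => uS /negP; rewrite -leNgt => u'S.
  have E : wdiff u * wdiff u' * (bt u * bt u') =
      (bt u * wdiff u) * (bt u' * wdiff u') by ring.
  have [h|h|h] := ltgtP 0 (bt u * bt u').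
  - have := kern_lt a0 uu' (refl_lt xy0 h) => h2.
    have w1 : wdiff u * wdiff u' <= 0.
      by rewrite -(pmulr_lle0 _ h) E pmulr_rle0.
    split; first by rewrite pmulr_lle0// subr_gt0.
    move=> h3; rewrite pmulr_llt0 ?subr_gt0//.
    by rewrite -(pmulr_llt0 _ h) E pmulr_rlt0.
  - have h' : 0 < bt u * bt (sg u') by rewrite side_refl// mulrN oppr_gt0.
    have := kern_lt a0 usu' (refl_lt xy0 h'); rewrite reflK// => h2.
    have w1 : 0 <= wdiff u * wdiff u'.
      by rewrite -(nmulr_lle0 _ h) E pmulr_rle0.
    split; first by rewrite mulr_ge0_le0// subr_le0 ltW.
    move=> h3; rewrite nmulr_llt0 ?subr_lt0//.
    by rewrite -(nmulr_llt0 _ h) E pmulr_rlt0.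
  - have /eqP := esym h; rewrite mulf_eq0 => /orP[] /eqP h2.
      by move: uS; rewrite h2 mul0r ltxx.
    have -> : wdiff u' = 0 by rewrite /wdiff refl_fix// subrr.
    by rewrite !mulr0 mul0r lexx ltxx.
have [zS|zS] := boolP (z \in misplaced); have [z'S|z'S] := boolP (z' \in misplaced).
- split; first by rewrite le_eqVlt; apply/orP; left; apply/eqP; ring.
  by move=> _; move: z'S; rewrite inE /misplaced/= => h1 h2; move: (lt_trans h1 h2); rewrite ltxx.
- have [h1 h2] := key _ _ zS z'S.
  move: h1 h2; rewrite /wdiff -/k1 -/k2 => h1 h2.
  set p := v z in h1 h2 *; set p' := v (sg z) in h1 h2 *.
  set r := v z' in h1 h2 *; set r' := v (sg z') in h1 h2 *.
  split; first by rewrite -subr_ge0; move: h1; nra.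
  by move=> _ /h2 h3; rewrite -subr_gt0; move: h3; nra.
- have [h1 _] := key _ _ z'S zS; split => //.
  move: h1; rewrite /wdiff ![kern a z' _]kernC [kern a (sg z) z']K2 -/k1 -/k2 => h1.
  set p := v z in h1 *; set p' := v (sg z) in h1 *.
  set r := v z' in h1 *; set r' := v (sg z') in h1 *.
  by rewrite -subr_ge0; move: h1; nra.
- by split.
Qed.

Lemma energy_polarize : (energy (v \o polarize) <= energy v)%E.
Proof.
have mvp : measurable_fun setT (v \o polarize).
  exact: (measurableT_comp mv mpres_polarize.1).
have h0 : (0 < 4%:E :> \bar R)%E by rewrite lte_fin.
rewrite -(lee_pmul2l _ h0)// /energy.
have e1 := fold4_integral (measurable_eden mvp) (eden_ge0 _).
have e2 := fold4_integral (measurable_eden mv) (eden_ge0 _).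
rewrite -e1 -e2; apply: ge0_le_integral => //.
- by move=> z _; rewrite lee_fin !addr_ge0 ?eden_ge0.
- by apply/measurable_EFinP; apply: measurable_fold4; apply: measurable_eden.
- by apply/measurable_EFinP; apply: measurable_fold4; apply: measurable_eden.
- by move=> z _; rewrite lee_fin; exact: (fold4_le z).1.
Qed.

(** The equality case: the pointwise comparison is strict on the product of the
    two sets, which must therefore be null. *)
Lemma energy_polarize_eq : (energy v < +oo)%E ->
  (energy v <= energy (v \o polarize))%E ->
  mu misplaced = 0%E \/ mu [set z | bt z * wdiff z < 0] = 0%E.
Proof.
move=> vfin vle.
have mvp : measurable_fun setT (v \o polarize).
  exact: (measurableT_comp mv mpres_polarize.1).
have mB : measurable [set z | bt z * wdiff z < 0].
  apply: measurable_ltr_set => //.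
  by apply: measurable_funM; [exact: measurable_side|exact: measurable_wdiff].
apply: prod_null => //; first exact: measurable_misplaced.
have e1 := fold4_integral (measurable_eden mvp) (eden_ge0 _).
have e2 := fold4_integral (measurable_eden mv) (eden_ge0 _).
have h0 : (0 < 4%:E :> \bar R)%E by rewrite lte_fin.
apply: (@integral_gap_set _ _ _ mu2 (fold4 (eden v)) (fold4 (eden (v \o polarize)))).
- by apply: measurableX => //; exact: measurable_misplaced.
- by apply: measurable_fold4; apply: measurable_eden.
- by apply: measurable_fold4; apply: measurable_eden.
- by move=> z; rewrite !addr_ge0 ?eden_ge0.
- by move=> z; exact: (fold4_le z).1.
- move=> z [/= z1 z2]; apply: (fold4_le z).2 => //.
  exact/mem_set.
- by rewrite e1 e2 lee_pmul2l.
- rewrite e1 lte_mul_pinfty//.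
  exact: le_lt_trans energy_polarize vfin.
Qed.

End polarization.
End energy.

(** * Integrals and distribution functions *)

Section layer_cake.
Context d (T : measurableType d) (R : realType).
Variable mu : {sigma_finite_measure set T -> \bar R}.
Local Notation lam := (@lebesgue_measure R).

(** Tonelli for the region [B] under the graph of [f]: cut vertically its measure
    is the integral of [f], cut horizontally that of the measures of the level
    sets. *)
Lemma integral_layers (B : set (T * measurableTypeR R)) (f : T -> R) :
  measurable B -> (forall x, lam (xsection B x) = (f x)%:E) ->
  (\int[mu]_x (f x)%:E = \int[lam]_t mu (ysection B t))%E.
Proof.
move=> mB lf.
have := indic_fubini_tonelli mu lam mB.
rewrite indic_fubini_tonelli_FE// indic_fubini_tonelli_GE// => <-.
by apply: eq_integral => x _ /=; rewrite lf.
Qed.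

(** Layer cake formula for the positive and the negative parts. For the
    latter, the superlevel sets determine the sublevel sets because [W] has
    finite measure. This passes integrability from one function to all its
    rearrangements. *)
Lemma same_tails_integral (W : set T) (h1 h2 : T -> R) :
  measurable W -> (mu W < +oo)%E ->
  measurable_fun W h1 -> measurable_fun W h2 ->
  (forall t, mu (W `&` [set x | t < h1 x]) = mu (W `&` [set x | t < h2 x])) ->
  (\int[mu]_x (`|(h1 \_ W) x|)%:E = \int[mu]_x (`|(h2 \_ W) x|)%:E)%E.
Proof.
move=> mW Wfin mh1 mh2 tails.
have mres h : measurable_fun W h -> measurable_fun setT (h \_ W : T -> R).
  by move=> mh; apply/(measurable_restrict _ mW measurableT); rewrite setTI.
have WE (h : T -> R) x : W x -> (h \_ W) x = h x by move=> Wx; rewrite patchE mem_set.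
have NWE (h : T -> R) x : ~ W x -> (h \_ W) x = 0 by move=> Wx; rewrite patchE memNset.
have m1 : measurable_fun setT (fun z : T * measurableTypeR R => z.2 : R).
  exact: measurable_snd.
have mh (h : T -> R) : measurable_fun W h ->
    measurable_fun setT (fun z : T * measurableTypeR R => (h \_ W) z.1).
  by move=> mh; exact: (measurableT_comp (mres _ mh) measurable_fst).
have pos (h : T -> R) : measurable_fun W h ->
  (\int[mu]_x (Num.max ((h \_ W) x) 0)%:E =
   \int[lam]_t (if (0 <= t)%R then mu (W `&` [set x | (t < h x)%R]) else 0))%E.
  move=> mhW.
  pose B : set (T * measurableTypeR R) :=
    [set z | 0 <= z.2] `&` [set z | z.2 < (h \_ W) z.1].
  rewrite (integral_layers (B := B)); last 2 first.
  - apply: measurableI; first exact: measurable_ler_set.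
    by apply: measurable_ltr_set => //; exact: mh.
  - move=> x; have -> : xsection B x = `[0, (h \_ W) x[%classic.
      apply/seteqP; split => t.
        by rewrite /xsection/= inE /B/= in_itv/= => -[-> ->].
      by rewrite /xsection/= inE /B/= in_itv/= => /andP[].
    rewrite lebesgue_measure_itv/= lte_fin.
    by case: ltP => h0; rewrite ?sube0.
  apply: eq_integral => t _; case: ifPn => [t0|t0].
    congr (mu _); apply/seteqP; split => x.
      rewrite /ysection/= inE /B/= => -[_].
      have [Wx|Wx] := pselect (W x); first by rewrite WE.
      by rewrite NWE// => /lt_le_trans /(_ t0); rewrite ltxx.
    by move=> [Wx /= tx]; rewrite /ysection/= inE /B/= WE.
  rewrite (_ : ysection B t = set0) ?measure0//.
  apply/seteqP; split => // x; rewrite /ysection/= inE /B/= => -[h0 _].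
  by rewrite h0 in t0.
have neg (h : T -> R) : measurable_fun W h ->
  (\int[mu]_x (Num.max (- (h \_ W) x) 0)%:E =
   \int[lam]_t (if (0 < t)%R then mu W - mu (W `&` [set x | (- t < h x)%R]) else 0))%E.
  move=> mhW.
  pose B : set (T * measurableTypeR R) :=
    [set z | 0 < z.2] `&` [set z | z.2 <= - (h \_ W) z.1].
  rewrite (integral_layers (B := B)); last 2 first.
  - apply: measurableI; first exact: measurable_ltr_set.
    apply: measurable_ler_set => //.
    by apply: measurableT_comp => //; exact: mh.
  - move=> x; have -> : xsection B x = `]0, (- (h \_ W) x)]%classic.
      apply/seteqP; split => t.
        by rewrite /xsection/= inE /B/= in_itv/= => -[-> ->].
      by rewrite /xsection/= inE /B/= in_itv/= => /andP[].
    rewrite lebesgue_measure_itv/= lte_fin.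
    by case: ltP => h0; rewrite ?sube0.
  apply: eq_integral => t _; case: ifPn => [t0|t0].
    have mI : measurable (W `&` [set x | - t < h x]).
      rewrite (_ : [set x | _] = h @^-1` `]- t, +oo[%classic); first exact: mhW.
      by apply/seteqP; split => x /=; rewrite in_itv/= andbT.
    have -> : (mu W - mu (W `&` [set x | (- t < h x)%R]) =
        mu (W `\` (W `&` [set x | (- t < h x)%R])))%E.
      by rewrite measureD// setIA setIid.
    congr (mu _); apply/seteqP; split => x.
      rewrite /ysection/= inE /B/= => -[_].
      have [Wx|Wx] := pselect (W x).
        rewrite WE// lerNr => hx; split => // -[_ /=].
        by rewrite ltNge hx.
      by rewrite NWE// oppr0 => /(lt_le_trans t0); rewrite ltxx.
    move=> [Wx /= nx]; rewrite /ysection/= inE /B/= WE//; split => //.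
    by rewrite lerNr leNgt; apply/negP => ?; apply: nx.
  rewrite (_ : ysection B t = set0) ?measure0//.
  apply/seteqP; split => // x; rewrite /ysection/= inE /B/= => -[h0 _].
  by rewrite h0 in t0.
have abs (h : T -> R) : measurable_fun W h ->
  (\int[mu]_x (`|(h \_ W) x|)%:E = \int[mu]_x (Num.max ((h \_ W) x) 0)%:E +
    \int[mu]_x (Num.max (- (h \_ W) x) 0)%:E)%E.
  move=> mhW; rewrite -ge0_integralD//; last 4 first.
  - by move=> x _; rewrite lee_fin le_max lexx orbT.
  - by apply/measurable_EFinP; apply: measurable_maxr => //; exact: mres.
  - by move=> x _; rewrite lee_fin le_max lexx orbT.
  - apply/measurable_EFinP; apply: measurable_maxr => //.
    by apply: measurableT_comp => //; exact: mres.
  apply: eq_integral => x _; rewrite -EFinD; congr EFin.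
  have /orP[h0|h0] := le_total 0 ((h \_ W) x).
    by rewrite ger0_norm// max_l// max_r ?oppr_le0// addr0.
  by rewrite ler0_norm// max_r// max_l ?oppr_ge0// add0r.
rewrite !abs// !pos// !neg//; congr (_ + _)%E; apply: eq_integral => t _.
  by case: ifP => // _; rewrite tails.
by case: ifP => // _; rewrite tails.
Qed.

End layer_cake.

(** For finite [q], [|f| <= 1 + |f|^q] on the set of finite measure [W]. *)
Lemma Lfun_ge1_integrable d (T : measurableType d) (R : realType)
    (mu : {measure set T -> \bar R}) (W : set T) (f : T -> R) (q : \bar R) :
  measurable W -> (mu W < +oo)%E -> (1 <= q)%E -> f \_ W \in Lfun mu q ->
  (\int[mu]_x (`|(f \_ W) x|)%:E < +oo)%E.
Proof.
move=> mW Wfin q1 fL.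
have mf : measurable_fun setT (f \_ W).
  by move: fL; rewrite inE => /andP[]; rewrite inE.
have mfE : measurable_fun setT (fun x => (`|(f \_ W) x|)%:E).
  by apply/measurable_EFinP; exact: measurableT_comp.
have mi : measurable_fun setT (fun x => (\1_W x)%:E : \bar R).
  by apply/measurable_EFinP; exact: measurable_indic.
have NW x : ~ W x -> (f \_ W) x = 0 by move=> Wx; rewrite patchE memNset.
case: q q1 fL => [q| |]// q1 fL.
  have /integrableP[mq iq] := Lfun_integrable q1 fL.
  apply: (@le_lt_trans _ _ (\int[mu]_x ((\1_W x)%:E + (`|(f \_ W) x| `^ q)%:E))%E).
    apply: ge0_le_integral => //.
    - by apply: emeasurable_funD.
    move=> x _; rewrite -EFinD lee_fin.
    have [Wx|Wx] := pselect (W x); last first.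
      by rewrite NW// normr0 addr_ge0// powR_ge0.
    rewrite indicE mem_set//=.
    have [h|h] := leP `|(f \_ W) x| 1.
      by apply: (le_trans h); rewrite lerDl powR_ge0.
    apply: (@le_trans _ _ (`|(f \_ W) x| `^ q)); last by rewrite lerDr.
    by apply: le1r_powR; rewrite ?(ltW h)// -lee_fin.
  rewrite ge0_integralD//.
  rewrite integral_indic// setIT lte_add_pinfty//.
  apply: le_lt_trans iq; apply: ge0_le_integral => //.
  - exact: measurableT_comp.
  - by move=> x _; rewrite lee_fin ler_norm.
have [T0|T0] := eqVneq (mu setT) 0%E.
  have mfW : measurable_fun setT (EFin \o (f \_ W)) by apply/measurable_EFinP.
  by have := integral_abs_eq0 measurableT mfW T0 => /= ->.
move: fL; rewrite inE => /andP[_]; rewrite inE/= /finite_norm unlock /=.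
rewrite lt0e T0 measure_ge0/= => Ey.
set E := ess_sup mu _ in Ey.
pose M := Num.max (fine E) 0.
have leM : {ae mu, forall x, setT x ->
    ((`|(f \_ W) x|)%:E <= M%:E * (\1_W x)%:E)%E}.
  have := ess_sup_ge mu (abse \o (EFin \o (f \_ W))); apply: filterS => x /= hx _.
  have [Wx|Wx] := pselect (W x); last first.
    by rewrite NW// normr0 mule_ge0// lee_fin // le_max lexx orbT.
  rewrite indicE mem_set//= mule1; apply: (le_trans hx).
  rewrite -/E; case: (E) Ey @M => [e| |]//= _; last by rewrite leNye.
  by rewrite lee_fin le_max lexx.
apply: (@le_lt_trans _ _ (\int[mu]_x (M%:E * (\1_W x)%:E))%E).
  apply: ae_ge0_le_integral => //.
  - by move=> x _; rewrite mule_ge0// lee_fin// le_max lexx orbT.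
  - exact: measurable_funeM.
rewrite ge0_integralZl//; last by rewrite lee_fin le_max lexx orbT.
by rewrite integral_indic// setIT lte_mul_pinfty// lee_fin le_max lexx orbT.
Qed.

(** * The Gagliardo energy *)

Section energy_algebra.
Context (R : realType) (n : nat) (a : R).
Local Notation X := (Rspace R n).
Local Notation mu := (leb R n).
Local Notation mu2 := (leb R n \x leb R n)%E.
Local Notation eden := (@eden R n a).
Local Notation energy := (@energy R n a).

Lemma measurable_edenE (f : X -> R) : measurable_fun setT f ->
  measurable_fun setT (fun z => (eden f z)%:E : \bar R).
Proof. by move=> mf; apply/measurable_EFinP; exact: measurable_eden. Qed.

Lemma null_prod (M : set X) : measurable M -> mu M = 0%E ->
  measurable (M `*` setT `|` setT `*` M : set (X * X)) /\
  mu2 (M `*` setT `|` setT `*` M) = 0%E.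
Proof.
move=> mM M0.
have m1 : measurable (M `*` setT : set (X * X)) by exact: measurableX.
have m2 : measurable (setT `*` M : set (X * X)) by exact: measurableX.
split; first exact: measurableU.
have M1 : mu2 (M `*` setT) = 0%E.
  transitivity (mu M * mu setT)%E; first exact: product_measure1E.
  by rewrite M0 mul0e.
have M2 : mu2 (setT `*` M) = 0%E.
  transitivity (mu setT * mu M)%E; first exact: product_measure1E.
  by rewrite M0 mule0.
by rewrite measureU0.
Qed.

Lemma energy_ae_eq (f g : X -> R) (M : set X) :
  measurable_fun setT f -> measurable_fun setT g ->
  measurable M -> mu M = 0%E -> (forall x, ~ M x -> f x = g x) ->
  energy f = energy g.
Proof.
move=> mf mg mM M0 fg; have [mN N0] := null_prod mM M0.
apply: ge0_ae_eq_integral => //; try exact: measurable_edenE.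
- by move=> z _; rewrite lee_fin eden_ge0.
- by move=> z _; rewrite lee_fin eden_ge0.
exists (M `*` setT `|` setT `*` M); split => // -[x y] /=.
move=> h; apply: contrapT => /not_orP[] /= h1 h2; apply: h => _.
by rewrite /eden/= !fg// => ?; [apply: h2|apply: h1].
Qed.

Lemma energy_le (f g : X -> R) :
  measurable_fun setT f -> measurable_fun setT g ->
  (forall x y, `|f x - f y| <= `|g x - g y|) -> (energy f <= energy g)%E.
Proof.
move=> mf mg fg; apply: ge0_le_integral => //; try exact: measurable_edenE.
  by move=> z _; rewrite lee_fin eden_ge0.
move=> -[x y] _; rewrite lee_fin /eden/= ler_wpM2r ?kern_ge0//.
by rewrite -real_normK ?num_real// -[leRHS]real_normK ?num_real// lerXn2r ?nnegrE.
Qed.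

Lemma energyZ (f : X -> R) (t : R) : measurable_fun setT f ->
  (energy (fun x => t * f x)%R = (t ^+ 2)%:E * energy f)%E.
Proof.
move=> mf; have m := measurable_edenE mf.
have e0 (z : X * X) : (0 <= (eden f z)%:E)%E by rewrite lee_fin eden_ge0.
rewrite /energy -ge0_integralZl ?lee_fin ?sqr_ge0//.
by apply: eq_integral => z _; rewrite -EFinM /eden; congr EFin; ring.
Qed.

(** The cross terms cancel pointwise, before integration. Adding the energies of
    two opposite perturbations thus eliminates the first variation. *)
Lemma energy_parallelogram (f g : X -> R) :
  measurable_fun setT f -> measurable_fun setT g ->
  (energy (fun x => f x + g x)%R + energy (fun x => f x - g x)%R =
   2%:E * energy f + 2%:E * energy g)%E.
Proof.
move=> mf mg.
have m1 : measurable_fun setT (fun x => f x + g x) by exact: measurable_funD.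
have m2 : measurable_fun setT (fun x => f x - g x) by exact: measurable_funB.
have e0 h (z : X * X) : (0 <= (eden h z)%:E)%E by rewrite lee_fin eden_ge0.
have m3 := measurable_edenE m1.
have m4 := measurable_edenE m2.
have m5 := measurable_edenE mf.
have m6 := measurable_edenE mg.
rewrite /energy -!ge0_integralZl// -!ge0_integralD//; last 4 first.
- by move=> z _; rewrite mule_ge0.
- exact: measurable_funeM.
- by move=> z _; rewrite mule_ge0.
- exact: measurable_funeM.
by apply: eq_integral => z _; rewrite -!EFinM -!EFinD /eden; congr EFin; ring.
Qed.

(** The energies of [max f g] and [min f g] add up to at most those of [f] and
    [g], and the defect is the interaction between the points where [f > g] and
    those where [f < g]. The minimum is dropped here, and [I] stands for any
    lower bound of the defect. *)
Lemma energy_max (f g : X -> R) (I : X * X -> R) :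
  measurable_fun setT f -> measurable_fun setT g ->
  measurable_fun setT I -> (forall z, 0 <= I z) ->
  (forall x y, I (x, y) <= 2 * Num.max (f x - g x) 0 * Num.max (g y - f y) 0) ->
  (energy (fun x => Num.max (f x) (g x)) + \int[mu2]_z (I z * kern a z.1 z.2)%:E <=
   energy f + energy g)%E.
Proof.
move=> mf mg mI I0 Ile.
have mm : measurable_fun setT (fun x => Num.max (f x) (g x)) by exact: measurable_maxr.
have e0 h (z : X * X) : (0 <= (eden h z)%:E)%E by rewrite lee_fin eden_ge0.
have m4 := measurable_edenE mm.
have m5 := measurable_edenE mf.
have m6 := measurable_edenE mg.
have m7 : measurable_fun setT (fun z => (I z * kern a z.1 z.2)%:E : \bar R).
  apply/measurable_EFinP; apply: measurable_funM => //; exact: measurable_kern2.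
have i0 z : (0 <= (I z * kern a z.1 z.2)%:E)%E by rewrite lee_fin mulr_ge0 ?kern_ge0.
rewrite /energy -!ge0_integralD//; apply: ge0_le_integral => //.
- by move=> z _; rewrite adde_ge0.
- exact: emeasurable_funD.
- exact: emeasurable_funD.
move=> -[x y] _; rewrite -!EFinD lee_fin /eden/= -!mulrDl ler_wpM2r ?kern_ge0//.
apply: (le_trans (lerD (lexx _) (Ile x y))).
(* Comparing [f] with [g] at [x] and at [y] leaves four polynomial inequalities. *)
have mE (u v : R) :
   (u <= v /\ Num.max u v = v /\ Num.max (u - v) 0 = 0 /\
     Num.max (v - u) 0 = v - u)%R \/
   (v <= u /\ Num.max u v = u /\ Num.max (u - v) 0 = u - v /\ Num.max (v - u) 0 = 0) :> Prop.
  have /orP[h|h] := le_total u v; [left|right]; split => //.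
    by rewrite max_r// max_r ?subr_le0// max_l ?subr_ge0.
  by rewrite max_l// max_l ?subr_ge0// max_r ?subr_le0.
have [[h1 [-> [-> _]]]|[h1 [-> [-> _]]]] := mE (f x) (g x);
  have [[h2 [-> [_ ->]]]|[h2 [-> [_ ->]]]] := mE (f y) (g y).
- by have := sqr_ge0 (f x - f y); lra.
- have := sqr_ge0 (f x - g y).
  have : 0 <= (g x - f x) * (f y - g y) by rewrite mulr_ge0// subr_ge0.
  lra.
- by have := sqr_ge0 (g x - f y); lra.
- by have := sqr_ge0 (g x - g y); lra.
Qed.

(** Only pairs with a point in [W] contribute; for either of the two points, the
    integral over the other one is bounded by translation invariance and the
    integrability of [min 1 |z|^2] against the kernel. *)
Lemma energy_lip_lty (s : R) (f : X -> R) (W : set X) (C : R) :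
  (2 <= n)%N -> 0 < s -> s < 1 -> a = n%:R + 2 * s ->
  measurable W -> (mu W < +oo)%E -> measurable_fun setT f ->
  (forall x, ~ W x -> f x = 0) -> 0 <= C ->
  (forall x y, (f x - f y) ^+ 2 <= C * Num.min 1 (eucl_dist x y ^+ 2)) ->
  (energy f < +oo)%E.
Proof.
move=> n2 s0 s1 aE mW Wfin mf fW C0 fC.
pose A0 := (\int[mu]_z (Num.min 1 (eucl_dist z (tzero R n) ^+ 2) *
     kern (n%:R + 2 * s) z (tzero R n))%:E)%E.
have A0fin : (A0 < +oo)%E by exact: kern_integral_lty.
pose ph (z : X * X) : R := Num.min 1 (eucl_dist z.1 z.2 ^+ 2) * kern a z.1 z.2.
have ph0 z : 0 <= ph z by rewrite mulr_ge0 ?kern_ge0// le_min ler01 sqr_ge0.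
have mph : measurable_fun setT ph.
  apply: measurable_funM; last exact: measurable_kern2.
  by apply: measurable_minr => //; apply: measurable_funX; exact: measurable_eucl_dist.
pose J1 (z : X * X) : \bar R := ((\1_W z.1)%:E * (ph z)%:E)%E.
pose J2 (z : X * X) : \bar R := ((\1_W z.2)%:E * (ph z)%:E)%E.
have mphE : measurable_fun setT (fun z => (ph z)%:E : \bar R) by apply/measurable_EFinP.
have mJ1 : measurable_fun setT J1.
  have m1 := measurable_indic_comp (R := R) mW (@measurable_fst _ _ X X).
  exact: (emeasurable_funM m1 mphE).
have mJ2 : measurable_fun setT J2.
  have m1 := measurable_indic_comp (R := R) mW (@measurable_snd _ _ X X).
  exact: (emeasurable_funM m1 mphE).
have J10 z : (0 <= J1 z)%E by rewrite mule_ge0 ?lee_fin.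
have J20 z : (0 <= J2 z)%E by rewrite mule_ge0 ?lee_fin.
have intW : (\int[mu]_x (\1_W x)%:E = mu W)%E by rewrite integral_indic// setIT.
have mWi : measurable_fun setT (fun x : X => (\1_W x)%:E : \bar R).
  by apply/measurable_EFinP; exact: measurable_indic.
have A00 : (0 <= A0)%E.
  apply: integral_ge0 => z _; rewrite lee_fin mulr_ge0 ?kern_ge0//.
  by rewrite le_min ler01 sqr_ge0.
have fin : (A0 * mu W < +oo)%E.
  by rewrite lte_mul_pinfty// ge0_fin_numE.
have iph2 y : (\int[mu]_x (ph (x, y))%:E = A0)%E.
  by apply: (eq_trans _ (kern_intE s y)); apply: eq_integral => x _; rewrite /ph/= aE.
have iph1 x : (\int[mu]_y (ph (x, y))%:E = A0)%E.
  apply: (eq_trans _ (iph2 x)); apply: eq_integral => y _.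
  by rewrite /ph/= eucl_distC kernC.
have iJ1 : (\int[mu2]_z J1 z < +oo)%E.
  rewrite (fubini_tonelli1 _ mJ1 J10).
  rewrite (_ : (\int[mu]_x _ = A0 * mu W)%E)//.
  rewrite -intW -ge0_integralZl//; apply: eq_integral => x _.
  rewrite /fubini_F /J1 /= ge0_integralZl//; last 2 first.
  - exact: (measurableT_comp mphE (measurable_pair1 x)).
  - by move=> ? _; rewrite lee_fin.
  by rewrite iph1 muleC.
have iJ2 : (\int[mu2]_z J2 z < +oo)%E.
  rewrite (fubini_tonelli2 _ mJ2 J20).
  rewrite (_ : (\int[mu]_x _ = A0 * mu W)%E)//.
  rewrite -intW -ge0_integralZl//; apply: eq_integral => x _.
  rewrite /fubini_G /J2 /= ge0_integralZl//; last 2 first.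
  - exact: (measurableT_comp mphE (measurable_pair2 x)).
  - by move=> ? _; rewrite lee_fin.
  by rewrite iph2 muleC.
apply: (@le_lt_trans _ _ (\int[mu2]_z (C%:E * (J1 z + J2 z)))%E).
  apply: ge0_le_integral => //.
  - by move=> z _; rewrite lee_fin eden_ge0.
  - exact: measurable_edenE.
  - by apply: measurable_funeM; exact: emeasurable_funD.
  move=> -[x y] _; rewrite /J1 /J2.
  rewrite -[X in (_ <= X)%E]/((C * (\1_W x * ph (x, y) + \1_W y * ph (x, y)))%:E).
  rewrite lee_fin -mulrDl /eden /ph/=.
  rewrite !mulrA ler_wpM2r ?kern_ge0//.
  have m0 : 0 <= Num.min 1 (eucl_dist x y ^+ 2) by rewrite le_min ler01 sqr_ge0.
  have [Wx|Wx] := pselect (W x).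
    apply: le_trans (fC x y) _; rewrite ler_wpM2r// ler_peMr//.
    by rewrite [\1_W x]indicE mem_set//= lerDl.
  have [Wy|Wy] := pselect (W y).
    apply: le_trans (fC x y) _; rewrite ler_wpM2r// ler_peMr//.
    by rewrite [\1_W y]indicE mem_set//= lerDr.
  by rewrite !fW// subrr expr0n/= !mulr_ge0// addr_ge0.
have mJ : measurable_fun setT (fun z => (J1 z + J2 z)%E) by exact: emeasurable_funD.
have J0 z : (0 <= J1 z + J2 z)%E by rewrite adde_ge0.
rewrite ge0_integralZl ?lee_fin//.
by rewrite ge0_integralD// lte_mul_pinfty// lte_add_pinfty.
Qed.

(** The seminorm is an iterated integral; as a single integral over the product,
    the energy is amenable to maps of pairs of points. *)
Lemma gagliardoE (s : R) (f : X -> R) : a = n%:R + 2 * s ->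
  measurable_fun setT f -> gagliardo s f = (energy f `^ 2^-1)%E.
Proof.
move=> aE mf; rewrite /gagliardo /energy; congr (_ `^ _)%E.
rewrite (fubini_tonelli2 _ (measurable_edenE mf)); last first.
  by move=> z; rewrite lee_fin eden_ge0.
apply: eq_integral => y _; apply: eq_integral => x _.
by rewrite /eden /kern /= powRN aE real_normK ?num_real.
Qed.

Lemma gagliardo_sqr (s : R) (f : X -> R) : a = n%:R + 2 * s ->
  measurable_fun setT f -> fine (gagliardo s f) ^+ 2 = fine (energy f).
Proof.
move=> aE mf; rewrite (gagliardoE aE mf) fine_poweR powR12_sqrt ?fine_ge0 ?energy_ge0//.
by rewrite sqr_sqrtr// fine_ge0 ?energy_ge0.
Qed.

Lemma H0sP (s : R) (W : set X) (f : X -> R) : a = n%:R + 2 * s ->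
  H0s s W f <-> [/\ measurable_fun setT f, (\int[mu]_x (f x ^+ 2)%:E < +oo)%E,
    (energy f < +oo)%E & {ae mu, forall x, ~ W x -> f x = 0}].
Proof.
move=> aE; split.
  move=> [f2 gf faeW].
  have mf : measurable_fun setT f by move: (f2); rewrite inE => /andP[]; rewrite inE.
  split => //.
    have /integrableP[_] := Lfun2_integrable_sqr f2; apply: le_lt_trans.
    rewrite le_eqVlt; apply/orP; left; apply/eqP; apply: eq_integral => x _ /=.
    by rewrite ger0_norm// sqr_ge0.
  by move: gf; rewrite (gagliardoE aE mf) => /lty_poweRy; apply.
move=> [mf f2 ef faeW]; split => //; last first.
  by rewrite (gagliardoE aE mf) poweR_lty.
rewrite inE; apply/andP; split; rewrite inE/=; first exact: mf.
rewrite /finite_norm unlock/= poweR_lty//; apply: le_lt_trans f2.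
rewrite le_eqVlt; apply/orP; left; apply/eqP; apply: eq_integral => x _ /=.
by rewrite powR_mulrn// real_normK ?num_real.
Qed.

End energy_algebra.

(** * Optimal pairs and positivity of the eigenfunction *)

Section integrability.
Context d (T : measurableType d) (R : realType) (mu : {measure set T -> \bar R}).
Local Notation L1 f := (mu.-integrable setT (fun x => (f x)%:E)).

Lemma integrable_dom (f h : T -> R) : measurable_fun setT f ->
  (forall x, `|f x| <= h x) -> L1 h -> L1 f.
Proof.
move=> mf fh; apply: le_integrable => //; first exact/measurable_EFinP.
move=> x _ /=; rewrite lee_fin; apply: (le_trans (fh x)); exact: ler_norm.
Qed.

Lemma integrable_lin (f h : T -> R) (k l : R) : L1 f -> L1 h ->
  L1 (fun x => k * f x + l * h x) /\
  \int[mu]_x (k * f x + l * h x) = k * (\int[mu]_x f x) + l * (\int[mu]_x h x).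
Proof.
move=> if_ ih.
have i1 : L1 (fun x => k * f x).
  by apply: (eq_integrable _ _ _ _ (integrableZl measurableT k if_)) => // x _; rewrite EFinM.
have i2 : L1 (fun x => l * h x).
  by apply: (eq_integrable _ _ _ _ (integrableZl measurableT l ih)) => // x _; rewrite EFinM.
split.
  by apply: (eq_integrable _ _ _ _ (integrableD measurableT i1 i2)) => // x _; rewrite EFinD.
by rewrite RintegralD// !RintegralZl.
Qed.

Lemma ge0_integrable (f : T -> R) : measurable_fun setT f -> (forall x, 0 <= f x) ->
  (\int[mu]_x (f x)%:E < +oo)%E -> L1 f.
Proof.
move=> mf f0 fi; apply/integrableP; split; first exact/measurable_EFinP.
apply: le_lt_trans fi; rewrite le_eqVlt; apply/orP; left; apply/eqP.
by apply: eq_integral => x _ /=; rewrite ger0_norm.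
Qed.

Lemma mpres_Rintegral (f : T -> T) (h : T -> R) : mpres mu f ->
  measurable_fun setT h -> \int[mu]_x h (f x) = \int[mu]_x h x.
Proof.
move=> pf mh; rewrite /Rintegral; congr fine.
have mhE : measurable_fun setT (EFin \o h) by apply/measurable_EFinP.
have p0 x : (0 <= (EFin \o h)^\+ x)%E by exact: funepos_ge0.
have n0 x : (0 <= (EFin \o h)^\- x)%E by exact: funeneg_ge0.
rewrite integralE [RHS]integralE.
rewrite -(mpres_ge0_integral pf (measurable_funepos mhE) p0).
rewrite -(mpres_ge0_integral pf (measurable_funeneg mhE) n0).
by congr (_ - _)%E; apply: eq_integral => x _; rewrite ?funeposE ?funenegE.
Qed.

End integrability.

(** How first variations are read off: a quantity bounded by [O(t)] for small
    [t > 0] is nonpositive. *)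
Lemma le0_small (R : realType) (q K tau : R) : 0 < tau -> 0 <= K ->
  (forall t, 0 < t -> t <= tau -> q <= t * K) -> q <= 0.
Proof.
move=> tau0 K0 h; rewrite leNgt; apply/negP => q0.
have K1 : 0 < K + 1 by rewrite ltr_wpDl.
have t0 : 0 < Num.min tau (q / (K + 1) / 2).
  by rewrite lt_min tau0/= !divr_gt0.
have := h _ t0; rewrite ge_min lexx => /(_ isT).
apply/negP; rewrite -ltNge.
have : Num.min tau (q / (K + 1) / 2) * K <= q / (K + 1) / 2 * K.
  by rewrite ler_wpM2r// ge_min lexx orbT.
move/le_lt_trans; apply.
rewrite (_ : q / (K + 1) / 2 * K = q * (K / (K + 1) / 2)); last by ring.
rewrite gtr_pMr// ltr_pdivrMr// ltr_pdivrMr//; lra.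
Qed.

Section optimal.
Context (R : realType) (n : nat) (s r : R) (c : Rspace R n).
Hypotheses (n2 : (2 <= n)%N) (s0 : 0 < s) (s1 : s < 1) (r0 : 0 < r).
Local Notation X := (Rspace R n).
Local Notation mu := (leb R n).
Local Notation a := (n%:R + 2 * s).
Local Notation W := (eball c r : set X).
Local Notation L1 f := (mu.-integrable setT (fun x => (f x)%:E)).

(** Representatives of the elements of the fractional Sobolev space that vanish
    at every point outside the ball. *)
Definition adm (f : X -> R) : Prop :=
  [/\ measurable_fun setT f, (\int[mu]_x (f x ^+ 2)%:E < +oo)%E,
      (energy a f < +oo)%E & forall x, ~ W x -> f x = 0].

Definition mass (h f : X -> R) : R := \int[mu]_x (h x * f x ^+ 2).

(** Weights are extended by zero, so that they can be composed with maps of the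
    whole space. *)
Definition equimeasurable (g h : X -> R) : Prop :=
  [/\ measurable_fun setT h, forall x, ~ W x -> h x = 0 &
      forall t, mu (W `&` [set x | t < h x]) = mu (W `&` [set x | t < g x])].

Lemma aexp_gt0 : 0 < a :> R.
Proof. by rewrite addr_gt0 ?mulr_gt0// ltr0n; case: n n2. Qed.

Lemma mW : measurable W. Proof. exact: measurable_eball. Qed.

(** An admissible function which is positive in the ball and strictly decreasing
    in the distance to the centre. *)
Definition tent (x : X) : R := Num.max 0 (1 - eucl_dist x c / r).

Lemma tent_ge0 x : 0 <= tent x. Proof. by rewrite le_max lexx. Qed.

Lemma tent_le1 x : tent x <= 1.
Proof. by rewrite ge_max ler01 lerBlDr lerDl divr_ge0 ?eucl_dist_ge0 ?ltW. Qed.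

Lemma tent_out x : ~ W x -> tent x = 0.
Proof.
move=> /negP; rewrite -leNgt => xr; rewrite /tent max_l// subr_le0.
by rewrite ler_pdivlMr// mul1r.
Qed.

Lemma tentE x : W x -> tent x = 1 - eucl_dist x c / r.
Proof.
by rewrite /eball/= => xr; rewrite /tent max_r// subr_ge0 ler_pdivrMr// mul1r ltW.
Qed.

Lemma tent_gt0 x : W x -> 0 < tent x.
Proof.
by move=> Wx; rewrite tentE// subr_gt0 ltr_pdivrMr// mul1r.
Qed.

Lemma measurable_tent : measurable_fun setT tent.
Proof.
apply: measurable_maxr => //; apply: measurable_funB => //.
by apply: measurable_funM => //; exact: measurable_eucl_dist.
Qed.

Lemma tent_lip x y : `|tent x - tent y| <= eucl_dist x y / r.
Proof.
wlog h : x y / tent y <= tent x.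
  move=> H; have /orP[|] := le_total (tent y) (tent x); first exact: H.
  by rewrite distrC eucl_distC; exact: H.
rewrite ger0_norm ?subr_ge0//.
have d : eucl_dist y c <= eucl_dist x y + eucl_dist x c.
  by rewrite (eucl_distC x y); exact: eucl_dist_triangle.
have h1 : 1 - eucl_dist y c / r <= tent y by rewrite le_max lexx orbT.
have [Wx|Wx] := pselect (W x); last first.
  rewrite tent_out// sub0r; apply: (@le_trans _ _ 0).
    by rewrite oppr_le0 tent_ge0.
  by rewrite divr_ge0 ?eucl_dist_ge0 ?ltW.
rewrite (tentE Wx); apply: (le_trans (lerB (lexx _) h1)).
rewrite (_ : _ - _ = (eucl_dist y c - eucl_dist x c) / r); last by ring.
by rewrite ler_pM2r ?invr_gt0// lerBlDr.
Qed.

Lemma adm_tent : adm tent.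
Proof.
have m := measurable_tent; split => //; last exact: tent_out.
- apply: (@le_lt_trans _ _ (\int[mu]_x (\1_W x)%:E)%E).
    apply: ge0_le_integral => //.
    - by move=> x _; rewrite lee_fin sqr_ge0.
    - by apply/measurable_EFinP; exact: measurable_funX.
    - by apply/measurable_EFinP; apply: measurable_indic; exact: mW.
    move=> x _; rewrite lee_fin; have [Wx|Wx] := pselect (W x).
      by rewrite indicE mem_set//= exprn_ile1 ?tent_ge0 ?tent_le1.
    by rewrite tent_out// expr0n.
  by rewrite integral_indic ?setIT ?leb_ball_lty//; exact: mW.
- apply: (@energy_lip_lty _ _ _ s tent W (1 + r^-1 ^+ 2)) => //.
  + exact: mW.
  + exact: leb_ball_lty.
  + exact: tent_out.
  + by rewrite addr_ge0// sqr_ge0.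
  move=> x y; have d0 := eucl_dist_ge0 x y.
  have h1 : (tent x - tent y) ^+ 2 <= 1.
    rewrite -real_normK ?num_real// exprn_ile1// ler_norml.
    by have := (tent_ge0 x, tent_le1 x, tent_ge0 y, tent_le1 y) => -[[[? ?] ?] ?]; lra.
  have h2 : (tent x - tent y) ^+ 2 <= r^-1 ^+ 2 * eucl_dist x y ^+ 2.
    rewrite -exprMn -real_normK ?num_real// lerXn2r ?nnegrE//.
      by rewrite mulr_ge0// invr_ge0 ltW.
    by rewrite mulrC tent_lip.
  have r2 : 0 <= r^-1 ^+ 2 by rewrite sqr_ge0.
  have [h|h] := leP 1 (eucl_dist x y ^+ 2).
    by rewrite mulr1; apply: (le_trans h1); rewrite lerDl.
  apply: (le_trans h2); rewrite mulrDl mul1r lerDr sqr_ge0//.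
Qed.

(** What is kept of the minimality of a weight [g] and of its eigenfunction. The
    last field compares Rayleigh quotients, with the denominators cleared: it
    also makes sense, and holds, when [mass h f] is not positive. Both the
    weight and the function may vary in it, which makes it apt to
    rearrangements. *)
Record optimal_pair (g v : X -> R) : Prop := OptimalPair {
  optimal_weight_measurable : measurable_fun setT g ;
  optimal_weight_out : forall x, ~ W x -> g x = 0 ;
  optimal_weight_L1 : L1 g ;
  optimal_adm : adm v ;
  optimal_ge0 : forall x, 0 <= v x ;
  optimal_L1 : L1 (fun x => g x * v x ^+ 2) ;
  optimal_mass : 0 < mass g v ;
  optimal_min : forall h f, equimeasurable g h -> adm f ->
     fine (energy a v) * mass h f <= fine (energy a f) * mass g v }.

Variables (g v : X -> R) (gv : optimal_pair g v).

Let mg := optimal_weight_measurable gv.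
Let gL1 := optimal_weight_L1 gv.
Let admv := optimal_adm gv.
Let v0 := optimal_ge0 gv.
Let gvL1 := optimal_L1 gv.
Let mass0 := optimal_mass gv.
Let opt := optimal_min gv.

Local Notation E f := (fine (energy a f)).

Let mv : measurable_fun setT v. Proof. by case: admv. Qed.
Let vW x : ~ W x -> v x = 0. Proof. by case: admv => _ _ _; apply. Qed.

Lemma equimeasurable_refl : equimeasurable g g.
Proof. by split => //; exact: (optimal_weight_out gv). Qed.

Lemma fineE_ge0 (f : X -> R) : 0 <= E f. Proof. by rewrite fine_ge0// energy_ge0. Qed.

Lemma adm_energy_fin (f : X -> R) : adm f -> energy a f \is a fin_num.
Proof. by case=> _ _ h _; rewrite ge0_fin_numE// energy_ge0. Qed.

Lemma adm_sqr_L1 (f : X -> R) : adm f -> L1 (fun x => f x ^+ 2).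
Proof.
case=> mf f2 _ _; apply: ge0_integrable => //; first exact: measurable_funX.
by move=> x; rewrite sqr_ge0.
Qed.

(** Otherwise [v] would vanish almost everywhere, and its mass with it. *)
Lemma eigenfunction_ge_set : exists2 d : R, 0 < d & mu [set x | d <= v x] <> 0%E.
Proof.
apply: contrapT => h.
have h0 k : mu [set x | k.+1%:R^-1 <= v x] = 0%E.
  apply: contrapT => h1; apply: h; exists k.+1%:R^-1 => //.
have m (k : nat) : measurable [set x | k.+1%:R^-1 <= v x] by exact: measurable_ler_set.
have mU : measurable (\bigcup_k [set x | k.+1%:R^-1 <= v x]) by exact: bigcupT_measurable.
have U0 : mu (\bigcup_k [set x | k.+1%:R^-1 <= v x]) = 0%E.
  apply/negligibleP => //; apply: negligible_bigcup => k.
  by apply/negligibleP => //; exact: h0.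
move: mass0; rewrite /mass /Rintegral.
rewrite (_ : \int[mu]_x _ = 0)%E ?ltxx//.
apply: (eq_trans _ (integral0 mu setT)).
apply: ae_eq_integral => //.
  by apply/measurable_EFinP; apply: measurable_funM => //; exact: measurable_funX.
exists (\bigcup_k [set x | k.+1%:R^-1 <= v x]); split => // x /= hx.
apply: contrapT => nU; apply: hx => _; congr EFin.
suff -> : v x = 0 by rewrite expr0n/= mulr0.
apply/le_anti; rewrite v0 andbT leNgt; apply/negP => vx; apply: nU.
exists (Num.truncn (v x)^-1) => //=; rewrite invf_ple ?posrE//.
exact/ltW/truncnS_gt.
Qed.

(** Where [t * e] exceeds [v], the two squares differ by at most [t ^ 2]: the mass
    loses at most a term of second order. *)
Lemma mass_max_ge (e : X -> R) : adm e -> (forall x, 0 <= e x) -> (forall x, e x <= 1) ->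
  forall t, 0 <= t ->
  adm (fun x => Num.max (v x) (t * e x)) /\
  mass g v - t ^+ 2 * (\int[mu]_x `|g x|) <=
    mass g (fun x => Num.max (v x) (t * e x)).
Proof.
move=> adme e0 e1 t t0; set f := fun x => _.
have [me e2 efin eW] := adme; have [_ v2 vfin _] := admv.
have mte : measurable_fun setT (fun x => t * e x) by exact: measurable_funM.
have mf : measurable_fun setT f by exact: measurable_maxr.
have f2 x : f x ^+ 2 <= v x ^+ 2 + t ^+ 2 * e x ^+ 2.
  rewrite /f; have /orP[h|h] := le_total (v x) (t * e x).
    by rewrite max_r// exprMn lerDr sqr_ge0.
  by rewrite max_l// lerDl mulr_ge0// sqr_ge0.
have [i2 _] := integrable_lin 1 (t ^+ 2) (adm_sqr_L1 admv) (adm_sqr_L1 adme).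
have admf : adm f.
  split => //.
  - have if2 : L1 (fun x => f x ^+ 2).
      apply: integrable_dom i2; first exact: measurable_funX.
      by move=> x; rewrite ger0_norm ?sqr_ge0// mul1r.
    have /integrableP[_] := if2; apply: le_lt_trans.
    rewrite le_eqVlt; apply/orP; left; apply/eqP.
    by apply: eq_integral => x _ /=; rewrite ger0_norm ?sqr_ge0.
  - have := energy_max a mv mte (I := fun=> 0) (measurable_cst _) (fun _ => lexx _).
    have h x y : 0 <= 2 * Num.max (v x - t * e x) 0 * Num.max (t * e y - v y) 0.
      by rewrite !mulr_ge0// le_max lexx orbT.
    move=> /(_ h); rewrite energyZ// => h2.
    have h3 : (energy a v + (t ^+ 2)%:E * energy a e < +oo)%E.
      by rewrite lte_add_pinfty// lte_mul_pinfty// lee_fin sqr_ge0.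
    apply: le_lt_trans h3; apply: le_trans h2; rewrite leeDl//.
    by apply: integral_ge0 => z _; rewrite mul0r.
  - by move=> x Wx; rewrite /f vW// eW// mulr0 maxxx.
split => //.
have ig : L1 (fun x => `|g x|).
  by have := integrable_abse gL1; apply: eq_integrable => // x _.
have [i3 ei3] := integrable_lin 1 (- t ^+ 2) gvL1 ig.
have [i4 _] := integrable_lin 1 (t ^+ 2) (integrable_abse gvL1 : L1 (fun x => `|g x * v x ^+ 2|)) ig.
rewrite -mulNr -[mass g v]mul1r /mass -ei3.
have gf_le x : `|g x * f x ^+ 2| <= 1 * `|g x * v x ^+ 2| + t ^+ 2 * `|g x|.
  have nE (b : R) : `|g x * b ^+ 2| = `|g x| * b ^+ 2.
    by rewrite normrM [X in _ * X]ger0_norm ?sqr_ge0.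
  rewrite mul1r !nE [t ^+ 2 * _]mulrC -mulrDr.
  rewrite ler_wpM2l//; apply: (le_trans (f2 x)); rewrite lerD2l ler_piMr ?sqr_ge0//.
  by rewrite exprn_ile1.
have igf : L1 (fun x => g x * f x ^+ 2).
  apply: integrable_dom i4 => //.
  by apply: measurable_funM => //; exact: measurable_funX.
apply: le_Rintegral => // x _; rewrite mul1r /f.
have t2 : 0 <= t ^+ 2 * `|g x| by rewrite mulr_ge0 ?sqr_ge0.
have /orP[h|h] := le_total (v x) (t * e x); last first.
  by rewrite max_l// mulNr gerDl oppr_le0.
rewrite max_r//.
have D0 : 0 <= (t * e x) ^+ 2 - v x ^+ 2.
  by rewrite subr_ge0 lerXn2r ?nnegrE ?mulr_ge0.
have D1 : (t * e x) ^+ 2 - v x ^+ 2 <= t ^+ 2.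
  rewrite lerBlDr; apply: (@le_trans _ _ (t ^+ 2)); last by rewrite lerDl sqr_ge0.
  by rewrite exprMn ler_piMr ?sqr_ge0// exprn_ile1.
have g1 : 0 <= g x + `|g x| by have := ler_norm (- g x); rewrite normrN; lra.
have h1 := mulr_ge0 g1 D0.
have h2 : 0 <= `|g x| * (t ^+ 2 - ((t * e x) ^+ 2 - v x ^+ 2)).
  by rewrite mulr_ge0// subr_ge0.
lra.
Qed.

(** The strong maximum principle, by testing optimality with
    [max v (t * tent)]. The nonlocal energy lets the set [A] where [v >= d]
    interact with the zero set [B] of [v]: raising [v] to [t * tent] on [B]
    brings an energy gain of first order in [t] by [energy_max], while the mass
    and the energy lose terms of order [t ^ 2]. The interaction [J] between [A]
    and [B] is thus zero, and so is the measure of [B] since that of [A] is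
    not. *)
Lemma eigenfunction_positive : mu (W `&` [set x | v x <= 0]) = 0%E.
Proof.
have [d d0 Ad] := eigenfunction_ge_set.
pose A : set X := [set x | d <= v x].
pose B : set X := W `&` [set x | v x <= 0].
have mA : measurable A by exact: measurable_ler_set.
have mB : measurable B by apply: measurableI; [exact: mW|exact: measurable_ler_set].
pose I0 (z : X * X) : R := \1_A z.1 * (\1_B z.2 * tent z.2).
have mt := measurable_tent.
have mI0 : measurable_fun setT I0.
  apply: measurable_funM.
    by apply: measurable_fst_comp; exact: measurable_indic.
  apply: measurable_funM; last exact: (measurable_snd_comp mt).
  by apply: measurable_snd_comp; exact: measurable_indic.
have I00 z : 0 <= I0 z by rewrite !mulr_ge0// tent_ge0.
pose mu2 := (mu \x mu)%E.
have mIK : measurable_fun setT (fun z => I0 z * kern a z.1 z.2).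
  by apply: measurable_funM => //; exact: measurable_kern2.
have IK0 z : 0 <= I0 z * kern a z.1 z.2 by rewrite mulr_ge0 ?kern_ge0.
pose J := (\int[mu2]_z (I0 z * kern a z.1 z.2)%:E)%E.
have J0 : (0 <= J)%E by apply: integral_ge0 => z _; rewrite lee_fin.
have [_ _ vfin _] := admv; have [_ _ efin _] := adm_tent.
have key t : 0 < t -> t <= d / 2 ->
   (energy a (fun x => Num.max (v x) (t * tent x)%R) + (d * t)%:E * J <=
    energy a v + (t ^+ 2)%:E * energy a tent)%E.
  move=> t0 td.
  have mte : measurable_fun setT (fun x => t * tent x) by exact: measurable_funM.
  rewrite -energyZ//; apply: le_trans (energy_max a mv mte (I := fun z => d * t * I0 z) _ _ _).
  - rewrite leeD2l// le_eqVlt; apply/orP; left; apply/eqP.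
    rewrite -ge0_integralZl//; last 3 first.
    + exact/measurable_EFinP.
    + by move=> z _; rewrite lee_fin.
    + by rewrite lee_fin mulr_ge0 ?ltW.
    by apply: eq_integral => z _; rewrite -EFinM mulrA.
  - exact: measurable_funM.
  - by move=> z; rewrite mulr_ge0 ?I00// mulr_ge0// ltW.
  move=> x y; rewrite /I0/=.
  have p1 : 0 <= Num.max (v x - t * tent x) 0 by rewrite le_max lexx orbT.
  have p2 : 0 <= Num.max (t * tent y - v y) 0 by rewrite le_max lexx orbT.
  have [Ax|Ax] := pselect (A x); last first.
    by rewrite [\1_A x]indicE memNset//= mul0r mulr0 !mulr_ge0.
  have [By|By] := pselect (B y); last first.
    by rewrite [\1_B y]indicE memNset//= mul0r !mulr0 !mulr_ge0.
  rewrite !indicE !mem_set//= !mul1r.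
  have vy : v y = 0 by case: By => _ /= h; apply/le_anti; rewrite h v0.
  have q1 : d / 2 <= Num.max (v x - t * tent x) 0.
    rewrite le_max; apply/orP; left; rewrite lerBrDr.
    have : t * tent x <= d / 2 by rewrite -[leRHS]mulr1 ler_pM ?tent_ge0 ?tent_le1// ltW.
    by move: Ax; rewrite /A/=; lra.
  have q2 : t * tent y <= Num.max (t * tent y - v y) 0.
    by rewrite vy subr0 le_max lexx.
  rewrite -mulrA; apply: (@le_trans _ _ (2 * (d / 2) * (t * tent y))).
    by rewrite le_eqVlt; apply/orP; left; apply/eqP; field.
  by rewrite ler_pM// ?mulr_ge0 ?tent_ge0 ?ler_pM2l// ltW// divr_gt0.
(* [J] is bounded by the energies of [v] and of the tent, by [key]. *)
have Jfin : J \is a fin_num.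
  rewrite ge0_fin_numE// ltNge leye_eq; apply/eqP => Joo.
  have d2 : 0 < d / 2 by rewrite divr_gt0.
  have := key _ d2 (lexx _); rewrite Joo gt0_muley ?lte_fin ?mulr_gt0//.
  rewrite addey; last first.
    by rewrite gt_eqF// (lt_le_trans _ (energy_ge0 _ _)).
  rewrite leye_eq => /eqP e.
  have : (energy a v + ((d / 2) ^+ 2)%:E * energy a tent < +oo)%E.
    by rewrite lte_add_pinfty// lte_mul_pinfty// ?ge0_fin_numE ?energy_ge0// lee_fin sqr_ge0.
  by rewrite e ltxx.
have J_le0 : d * fine J * mass g v <= 0.
  pose G := \int[mu]_x `|g x|.
  have G0 : 0 <= G by apply: Rintegral_ge0.
  apply: (@le0_small _ _ (mass g v * E tent + E v * G) (d / 2)).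
  - by rewrite divr_gt0.
  - by rewrite addr_ge0// mulr_ge0 ?fineE_ge0// ltW.
  move=> t t0 td; have [admf mf] := mass_max_ge adm_tent tent_ge0 tent_le1 (ltW t0).
  have := key t t0 td; have := opt equimeasurable_refl admf.
  move: mf; rewrite -/G; pose f (x : X) : R := Num.max (v x) (t * tent x).
  rewrite -/f => mf of_.
  rewrite -(fineK (adm_energy_fin admf)) -(fineK (adm_energy_fin admv)).
  rewrite -(fineK (adm_energy_fin adm_tent)) -(fineK Jfin).
  rewrite -!EFinM -!EFinD lee_fin => ke.
  rewrite -(ler_pM2l t0).
  have h1 : E v * (mass g v - t ^+ 2 * G) <= E v * mass g f by rewrite ler_wpM2l ?fineE_ge0.
  have h2 : E f * mass g v <= (E v + t ^+ 2 * E tent - d * t * fine J) * mass g v.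
    by rewrite ler_pM2r// lerBrDr.
  have := le_trans h1 (le_trans of_ h2); nra.
have JJ : (J <= 0)%E.
  rewrite -(fineK Jfin) lee_fin; move: J_le0.
  by rewrite pmulr_lle0// pmulr_rle0.
have : mu A = 0%E \/ mu B = 0%E.
  apply: prod_null => //.
  apply: (ge0_integral_le0_set _ mIK IK0 _ JJ); first exact: measurableX.
  move=> -[x y] [/= Ax By]; rewrite mulr_gt0//.
    rewrite /I0/= !indicE !mem_set//= !mul1r.
    by apply: tent_gt0; case: By.
  apply: kern_gt0; apply/eqP => xy; case: By => _ /=.
  by rewrite leNgt -xy (lt_le_trans d0 Ax).
by case.
Qed.

End optimal.

(** * The eigenfunction decreases radially *)

Lemma leb_ball_gt0 (R : realType) (n : nat) (x : Rspace R n) (e : R) :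
  (2 <= n)%N -> 0 < e -> (0 < leb R n (eball x e))%E.
Proof.
move=> n2 e0; apply: lt_le_trans (leb_ball_ge x n2 e0).
by rewrite lte_fin mulr_gt0// exprn_gt0// divr_gt0// ltr0n (leq_trans _ n2).
Qed.

Section radial_eigenfunction.
Context (R : realType) (n : nat) (s r : R) (c : Rspace R n).
Hypotheses (n2 : (2 <= n)%N) (s0 : 0 < s) (s1 : s < 1) (r0 : 0 < r).
Local Notation X := (Rspace R n).
Local Notation mu := (leb R n).
Local Notation a := (n%:R + 2 * s).
Local Notation W := (eball c r : set X).
Local Notation L1 f := (mu.-integrable setT (fun x => (f x)%:E)).
Local Notation E f := (fine (energy a f)).

Variables (g v : X -> R) (gv : optimal_pair s r c g v).

Let mg := optimal_weight_measurable gv.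
Let gW := optimal_weight_out gv.
Let gL1 := optimal_weight_L1 gv.
Let admv := optimal_adm gv.
Let v0 := optimal_ge0 gv.
Let gvL1 := optimal_L1 gv.
Let mass0 := optimal_mass gv.
Let opt := optimal_min gv.
Let mv : measurable_fun setT v. Proof. by case: admv. Qed.
Let vW x : ~ W x -> v x = 0. Proof. by case: admv => _ _ _; apply. Qed.
Let a_gt0 : 0 < a. Proof. exact: aexp_gt0. Qed.

(** [v] is at least [d] on a set of positive measure and vanishes outside the
    ball, which has a complement of positive measure. *)
Lemma eigenfunction_energy_gt0 : 0 < E v.
Proof.
rewrite lt_neqAle fineE_ge0 andbT; apply/eqP => /esym Ev.
have ev : (\int[mu \x mu]_z (eden a v z)%:E <= 0)%E.
  rewrite -[X in (X <= _)%E]/(energy a v) -(fineK (adm_energy_fin admv)).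
  by rewrite Ev.
have [d d0 Ad] := eigenfunction_ge_set gv.
have mA : measurable [set x : X | d <= v x] by exact: measurable_ler_set.
have mC : measurable (~` W) by apply: measurableC; exact: measurable_eball.
have : mu [set x : X | d <= v x] = 0%E \/ mu (~` W) = 0%E.
  apply: prod_null => //.
  apply: (ge0_integral_le0_set _ (measurable_eden a mv) (eden_ge0 a v) _ ev).
    exact: measurableX.
  move=> -[x y] [/= dx Wy]; rewrite /eden/= (vW Wy) subr0 mulr_gt0//.
    by rewrite exprn_gt0// (lt_le_trans d0).
  apply: kern_gt0; apply/eqP => xy; move: dx.
  by rewrite xy (vW Wy) leNgt d0.
case=> // Wnull.
pose c' := tadd c (tmap (fun=> r + 1)) : X.
have n0 : (0 < n)%N by exact: leq_trans n2.
have cc' : r + 1 <= eucl_dist c' c.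
  apply: le_trans (abs_tnth_le_dist c' c (Ordinal n0)).
  rewrite !tE (_ : _ - _ = r + 1); last by ring.
  exact: ler_norm.
have := leb_ball_gt0 c' n2 ltr01.
have : (mu (eball c' 1) <= mu (~` W))%E.
  apply: le_measure; rewrite ?inE//; first exact: measurable_eball.
  move=> z; rewrite /eball/= => zc' zc.
  have := eucl_dist_triangle z c' c; rewrite (eucl_distC c' z); lra.
by rewrite Wnull => h /lt_le_trans /(_ h); rewrite ltxx.
Qed.

Section rearrange.
Variable tau : X -> X.
Hypotheses (ptau : mpres mu tau) (tauW : forall x, W (tau x) <-> W x).

Lemma equimeasurable_comp : equimeasurable r c g (g \o tau).
Proof.
have [mt pt] := ptau.
split.
- exact: (measurableT_comp mg mt).
- by move=> x Wx /=; apply: gW => /tauW.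
- move=> t; have -> : W `&` [set x | t < (g \o tau) x] =
      tau @^-1` (W `&` [set x | t < g x]).
    by apply/seteqP; split => x /= -[Wx tx]; split => //; apply/tauW.
  by apply: pt; apply: measurableI; [exact: measurable_eball|exact: measurable_ltr_set].
Qed.

Lemma mass_comp : mass (g \o tau) (v \o tau) = mass g v.
Proof.
apply: (mpres_Rintegral ptau (h := fun x => g x * v x ^+ 2)).
by apply: measurable_funM => //; exact: measurable_funX.
Qed.

(** Rearranging the weight and the function by the same map keeps the mass, so
    that optimality forbids a decrease of the energy. *)
Lemma energy_comp_ge : (energy a (v \o tau) <= energy a v)%E ->
  (energy a v <= energy a (v \o tau))%E.
Proof.
move=> le; have [_ v2 vfin _] := admv.
have vfin' : (energy a (v \o tau) < +oo)%E by exact: le_lt_trans vfin.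
have admt : adm s r c (v \o tau).
  split => //.
  - exact: (measurableT_comp mv ptau.1).
  - rewrite (mpres_ge0_integral ptau (g := fun x => (v x ^+ 2)%:E))//.
    + by apply/measurable_EFinP; exact: measurable_funX.
    + by move=> x; rewrite lee_fin sqr_ge0.
  - by move=> x Wx /=; apply: vW => /tauW.
have := opt equimeasurable_comp admt.
rewrite mass_comp ler_pM2r// => h.
by rewrite -(fineK (adm_energy_fin admv)) -(fineK (adm_energy_fin admt)) lee_fin.
Qed.

End rearrange.

Section one_reflection.
Variables (x0 y0 : X).
Hypothesis xy : eucl_dist x0 c < eucl_dist y0 c.

Let xy0 : x0 != y0.
Proof. by apply/eqP => h; move: xy; rewrite h ltxx. Qed.

Let bc : side x0 y0 c < 0.
Proof. by rewrite side_lt0 eucl_distC [ltRHS]eucl_distC. Qed.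

Let refl_closer z : 0 < side x0 y0 z -> eucl_dist (refl x0 y0 z) c < eucl_dist z c.
Proof.
move=> bz; have h : 0 < side x0 y0 c * side x0 y0 (refl x0 y0 z).
  by rewrite side_refl// nmulr_rgt0// oppr_lt0.
by have := refl_lt xy0 h; rewrite reflK// !(eucl_distC c).
Qed.

Let refl_further z : side x0 y0 z < 0 -> eucl_dist z c < eucl_dist (refl x0 y0 z) c.
Proof.
move=> bz; have h : 0 < side x0 y0 c * side x0 y0 z by rewrite nmulr_rgt0.
by have := refl_lt xy0 h; rewrite !(eucl_distC c).
Qed.

(** As the centre is on the side of [x0], a point of the ball on the side of [y0]
    has its image in the ball; and the point of a misplaced pair with the larger
    value lies on that side, and in the ball. Polarisation thus preserves the
    ball. *)
Let misplaced_in z : misplaced x0 y0 v z -> W z /\ W (refl x0 y0 z).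
Proof.
rewrite /misplaced/= /wdiff => h.
have [b|b|b] := ltgtP (side x0 y0 z) 0.
- have w : v z < v (refl x0 y0 z) by rewrite -subr_lt0 -(nmulr_rgt0 _ b).
  have Wr : W (refl x0 y0 z).
    apply: contrapT => /vW e; move: w; rewrite e => /(le_lt_trans (v0 z)).
    by rewrite ltxx.
  by split => //; apply: lt_trans (refl_further b) Wr.
- have w : v (refl x0 y0 z) < v z by rewrite -subr_gt0 -(pmulr_rgt0 _ b).
  have Wz : W z.
    apply: contrapT => /vW e; move: w; rewrite e => /(le_lt_trans (v0 _)).
    by rewrite ltxx.
  by split => //; apply: lt_trans (refl_closer b) Wz.
- by move: h; rewrite b mul0r ltxx.
Qed.

(** By optimality, polarisation does not change the energy: either [v] is already
    polarised, or its larger values are all on the side of [y0]. The latter is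
    excluded by the points of the ball, on the side of [x0], whose images are
    outside: [v] is positive at the former and zero at the latter. *)
Lemma misplaced_null : mu (misplaced x0 y0 v) = 0%E.
Proof.
have tauW z : W (polarize x0 y0 v z) <-> W z.
  rewrite /polarize; case: ifPn => // /set_mem /misplaced_in [? ?].
  by split.
have ge := energy_comp_ge (mpres_polarize n2 xy0 mv) tauW
  (energy_polarize a_gt0 n2 xy0 mv).
have [_ _ vfin _] := admv.
have [//|null] := energy_polarize_eq a_gt0 n2 xy0 mv vfin ge.
exfalso.
pose q := sqd y0 x0; pose nrm := Num.sqrt q.
have q0 : 0 < q by exact: sqd_gt0.
have nrm0 : 0 < nrm by rewrite sqrtr_gt0.
have nq : nrm ^+ 2 = q by rewrite sqr_sqrtr// ltW.
(* [h] is the distance from the centre to the mirror. Starting from the centre and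
   going away from the mirror by [rho = max 0 (r - h)] gives [z0], whose image is
   at distance [rho + 2 * h] from the centre. Since [rho + e <= r] and
   [r <= rho + 2 * h - e] for [e = min h r], the points of the ball of radius [e]
   around [z0] are in the given ball and their images are not. *)
pose h := - side x0 y0 c / nrm.
have h0 : 0 < h by rewrite divr_gt0// oppr_gt0.
pose rho := Num.max 0 (r - h).
have rho0 : 0 <= rho by rewrite le_max lexx.
pose z0 := along x0 y0 c (rho / nrm).
have d1 : eucl_dist z0 c = rho.
  rewrite eucl_distC eucl_distE sqd_along subrr mulr0 addr0.
  rewrite (_ : sqd c c = 0) ?add0r; last first.
    by rewrite /sqd big1// => i _; rewrite subrr expr0n.
  rewrite -/q -nq -exprMn divfK ?gt_eqF// sqrtr_sqr ger0_norm//.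
have d2 : eucl_dist (refl x0 y0 z0) c = rho + 2 * h.
  rewrite eucl_distC eucl_distE refl_sqd//.
  have -> : sqd c z0 = rho ^+ 2.
    by rewrite -d1 eucl_distC eucl_distE sqr_sqrtr// sqd_ge0.
  rewrite side_along -/q -nq.
  have -> : rho ^+ 2 + 4 * (side x0 y0 c * (side x0 y0 c - rho / nrm * nrm ^+ 2)) / nrm ^+ 2
     = (rho + 2 * h) ^+ 2.
    by rewrite /h; field; rewrite gt_eqF.
  by rewrite sqrtr_sqr ger0_norm// addr_ge0// mulr_ge0// ltW.
pose e := Num.min h r.
have e0 : 0 < e by rewrite lt_min h0.
have eh : e <= h by rewrite ge_min lexx.
have er : e <= r by rewrite ge_min lexx orbT.
have sub z : eball z0 e z -> W z /\ ~ W (refl x0 y0 z).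
  rewrite /eball/= => zz.
  have rhoE : (rho = 0 /\ r <= h) \/ rho = r - h.
    have /orP[l|l] := le_total r h; [left|right].
      by split => //; rewrite /rho max_l// subr_le0.
    by rewrite /rho max_r// subr_ge0.
  have t1 := eucl_dist_triangle z0 z c.
  have t2 := eucl_dist_triangle (refl x0 y0 z) (refl x0 y0 z0) c.
  have t3 : eucl_dist (refl x0 y0 z0) (refl x0 y0 z) < e.
    by rewrite refl_dist// eucl_distC.
  rewrite d1 in t1; rewrite d2 in t2.
  have q1 : rho + e <= r by case: rhoE => [[-> _]|->]; lra.
  have q2 : r <= rho + 2 * h - e by case: rhoE => [[-> ?]|->]; lra.
  split.
    change (eucl_dist z c < r).
    by apply: (le_lt_trans t1); apply: lt_le_trans q1; rewrite addrC ltrD2l.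
  move=> h3; change (is_true (eucl_dist (refl x0 y0 z) c < r)) in h3.
  suff : eucl_dist (refl x0 y0 z) c < eucl_dist (refl x0 y0 z) c.
    by rewrite ltxx.
  apply: (lt_le_trans h3); apply: (le_trans q2); rewrite lerBlDr.
  by apply: (le_trans t2); rewrite addrC lerD2l ltW.
have Bsub : eball z0 e `<=`
    [set z | side x0 y0 z * wdiff x0 y0 v z < 0] `|` (W `&` [set x | v x <= 0]).
  move=> z /sub[Wz Wrz].
  have [vz|vz] := leP (v z) 0; first by right.
  left => /=; rewrite /wdiff (vW Wrz) subr0 nmulr_rlt0 ?pmulr_llt0//.
  have [b|b|b] := ltgtP (side x0 y0 z) 0 => //.
    by exfalso; apply: Wrz; apply: lt_trans (refl_closer b) Wz.
  by exfalso; apply: Wrz; rewrite refl_fix.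
have mS : measurable [set z | side x0 y0 z * wdiff x0 y0 v z < 0].
  apply: measurable_ltr_set => //.
  by apply: measurable_funM; [exact: measurable_side|exact: measurable_wdiff].
have mP : measurable (W `&` [set x | v x <= 0]).
  by apply: measurableI; [exact: measurable_eball|exact: measurable_ler_set].
have := leb_ball_gt0 z0 n2 e0.
have : (mu (eball z0 e) <= 0)%E.
  have null2 := eigenfunction_positive n2 s0 s1 r0 gv.
  have <- : mu ([set z | side x0 y0 z * wdiff x0 y0 v z < 0] `|`
      (W `&` [set x | v x <= 0])) = 0%E by rewrite measureU0.
  apply: le_measure; rewrite ?inE//; first exact: measurable_eball.
  exact: measurableU.
by move=> l /lt_le_trans /(_ l); rewrite ltxx.
Qed.

End one_reflection.

(** The part of the energy due to one point. It is finite almost everywhere, and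
    where it is finite the kernel is singular enough to make the point a
    Lebesgue point of [v]. *)
Definition slice (x : X) : \bar R := (\int[mu]_y (eden a v (x, y))%:E)%E.

Lemma slice_fin_ae : exists N, [/\ measurable N, mu N = 0%E &
  forall x, ~ N x -> (slice x < +oo)%E].
Proof.
have e0 (z : X * X) : (0 <= (eden a v z)%:E)%E by rewrite lee_fin eden_ge0.
have mE := measurable_edenE a mv.
have ms := measurable_fun_fubini_tonelli_F (m2 := mu) _ mE e0.
have [_ _ vfin _] := admv.
have int : mu.-integrable setT slice.
  apply/integrableP; split; first exact: ms.
  apply: le_lt_trans vfin; rewrite /energy (fubini_tonelli1 _ mE e0).
  rewrite le_eqVlt; apply/orP; left; apply/eqP; apply: eq_integral => x _.
  by rewrite gee0_abs//; apply: integral_ge0.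
have [N [mN N0 sN]] := integrable_ae measurableT int.
exists N; split => // x Nx; rewrite ltey; apply/eqP => sx.
apply: Nx; apply: sN => /= /(_ I).
by rewrite sx.
Qed.

(** On the ball of radius [e] the kernel is at least [e ^ (- a)]. *)
Lemma slice_ball (x : X) (e : R) : 0 < e ->
  (\int[mu]_z (\1_(eball x e) z * (v z - v x) ^+ 2)%:E <= (e `^ a)%:E * slice x)%E.
Proof.
move=> e0.
have mE : measurable_fun setT (fun y => (eden a v (x, y))%:E : \bar R).
  by have := measurableT_comp (measurable_edenE a mv) (measurable_pair1 x).
rewrite /slice -ge0_integralZl//; last 2 first.
- by move=> y _; rewrite lee_fin eden_ge0.
- by rewrite lee_fin powR_ge0.
apply: ge0_le_integral => //.
- by move=> z _; rewrite lee_fin mulr_ge0// sqr_ge0.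
- apply/measurable_EFinP; apply: measurable_funM.
    by apply: measurable_indic; exact: measurable_eball.
  by apply: measurable_funX; exact: measurable_funB.
- exact: measurable_funeM.
move=> z _; rewrite -EFinM lee_fin /eden/=.
have [Bz|Bz] := pselect (eball x e z); last first.
  by rewrite indicE memNset//= mul0r mulr_ge0 ?powR_ge0// mulr_ge0 ?sqr_ge0 ?kern_ge0.
rewrite indicE mem_set//= mul1r -sqrrN opprB.
have [d0|d0] := eqVneq (eucl_dist x z) 0.
  by rewrite (eucl_dist_eq0 d0) subrr expr0n/= mul0r mulr0.
rewrite mulrCA ler_peMr ?sqr_ge0//.
have dpos : 0 < eucl_dist x z by rewrite lt_neqAle eq_sym d0 eucl_dist_ge0.
have := kern_ge a_gt0 dpos (_ : eucl_dist x z <= e).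
rewrite eucl_distC ltW// => /(_ isT) k.
rewrite -[leLHS](_ : e `^ a * e `^ (- a) = 1).
  by rewrite ler_wpM2l ?powR_ge0.
by rewrite powRN mulfV// gt_eqF// powR_gt0.
Qed.

(** [misplaced_null] gives, for each mirror, an inequality off a null set that
    depends on the mirror. A common null set is obtained by comparing the values
    at two given points [x] and [y] with finite slices, through the mirror that
    exchanges them: if [v x < v y], then for almost every [z] near [x], [v z] is
    at least the value at the image of [z], so that either [v z] is far from
    [v x] or that value is far from [v y]. Integrated over a ball of radius [e],
    this bounds [e ^ n], up to a constant, by [e ^ (n + 2 * s)] times the sum of
    the slices, which is false for small [e]. *)
Lemma eigenfunction_decreasing : exists N, [/\ measurable N, mu N = 0%E &
  forall x y, ~ N x -> ~ N y -> eucl_dist x c < eucl_dist y c -> v y <= v x].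
Proof.
have [N [mN N0 sN]] := slice_fin_ae; exists N; split => // x y Nx Ny xy.
have xy0 : x != y by apply/eqP => h; move: xy; rewrite h ltxx.
rewrite leNgt; apply/negP => vxy.
pose J := fine (slice x) + fine (slice y).
have sl0 z : (0 <= slice z)%E.
  by apply: integral_ge0 => w _; rewrite lee_fin eden_ge0.
have J0 : 0 <= J by rewrite addr_ge0// fine_ge0.
pose dl := (v y - v x) / 2.
have dl0 : 0 < dl by rewrite divr_gt0// subr_gt0.
have dxy : 0 < eucl_dist x y.
  rewrite lt_neqAle eucl_dist_ge0 andbT eq_sym.
  by apply: contra_neq xy0; exact: eucl_dist_eq0.
pose k := ((2 / n%:R) ^+ n : R).
have k0 : 0 < k.
  by rewrite exprn_gt0// divr_gt0// ltr0n (leq_trans _ n2).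
have sqr_le p : dl <= p -> dl ^+ 2 <= p ^+ 2.
  by move=> dp; have p0 := lt_le_trans dl0 dp; rewrite lerXn2r// nnegrE ltW.
have key e : 0 < e -> e <= eucl_dist x y / 2 -> dl ^+ 2 * k <= e `^ (2 * s) * J.
  move=> e0 exy.
  pose B1 : set X := eball x e; pose B2 : set X := eball y e.
  have mB1 : measurable B1 by exact: measurable_eball.
  have mB2 : measurable B2 by exact: measurable_eball.
  have mi (B : set X) w : measurable B ->
      measurable_fun setT (fun z => (\1_B z * (v z - w) ^+ 2)%:E : \bar R).
    move=> mB; apply/measurable_EFinP; apply: measurable_funM.
      exact: measurable_indic.
    by apply: measurable_funX; exact: measurable_funB.
  have i0 (B : set X) w z : (0 <= (\1_B z * (v z - w) ^+ 2)%:E :> \bar R)%E.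
    by rewrite lee_fin mulr_ge0// sqr_ge0.
  have [mr pr] := mpres_refl xy0 n2.
  have mir := measurableT_comp (mi _ (v y) mB2) mr.
  (* [v z] exceeds the mean of [v x] and [v y], or else the value at the image is
     below it: one of the two differs from its target by [dl] at least. *)
  have l1 : ((dl ^+ 2)%:E * mu B1 <=
     \int[mu]_z (\1_B1 z * (v z - v x) ^+ 2)%:E +
     \int[mu]_z (\1_B2 z * (v z - v y) ^+ 2)%:E)%E.
    rewrite -(mpres_ge0_integral (mpres_refl xy0 n2) (mi _ (v y) mB2) (i0 _ _)).
    have ml := misplaced_null xy.
    have mm : measurable (misplaced x y v) by exact: measurable_misplaced.
    have -> : mu B1 = mu (B1 `\` misplaced x y v).
      have z1 : mu (B1 `&` misplaced x y v) = 0%E.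
        by apply: (subset_measure0 _ mm _ ml); [exact: measurableI|exact: subIsetr].
      have z2 : mu (B1 `\` misplaced x y v) =
          (mu B1 - mu (B1 `&` misplaced x y v))%E.
        by apply: measureD => //; exact: leb_ball_lty.
      by rewrite z2 z1 sube0.
    have mD : measurable (B1 `\` misplaced x y v) by exact: measurableD.
    rewrite -ge0_integralD//; last exact: mi.
    have -> : mu (B1 `\` misplaced x y v) =
        (\int[mu]_z (\1_(B1 `\` misplaced x y v) z)%:E)%E.
      by rewrite integral_indic// setIT.
    rewrite -ge0_integralZl//; last 2 first.
    - by apply/measurable_EFinP; exact: measurable_indic.
    - by rewrite lee_fin sqr_ge0.
    apply: ge0_le_integral => //.
    - by move=> z _; rewrite mule_ge0// lee_fin// sqr_ge0.
    - by apply: measurable_funeM; apply/measurable_EFinP; exact: measurable_indic.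
    - by apply: emeasurable_funD => //; exact: mi.
    move=> z _; rewrite -EFinM -EFinD lee_fin.
    have [[B1z Mz]|Dz] := pselect ((B1 `\` misplaced x y v) z); last first.
      rewrite [\1_(B1 `\` _) z]indicE memNset//= mulr0.
      by rewrite addr_ge0// mulr_ge0// sqr_ge0.
    have B2z : B2 (refl x y z).
      by have := refl_dist xy0 z x; rewrite /B2 /eball/= refl_x// => ->.
    rewrite !indicE !mem_set//= mulr1 !mul1r.
    have bz : side x y z < 0.
      rewrite side_lt0; have := eucl_dist_triangle z x y.
      by move: B1z; rewrite /B1 /eball/= (eucl_distC z x); lra.
    have w : v (refl x y z) <= v z.
      rewrite leNgt; apply/negP => w; apply: Mz.
      by rewrite /misplaced/= /wdiff nmulr_rgt0// subr_lt0.
    have [h|h] := leP ((v x + v y) / 2) (v z).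
      have p : dl <= v z - v x by rewrite /dl; lra.
      have : dl ^+ 2 <= (v z - v x) ^+ 2.
        exact: sqr_le.
      by move/le_trans; apply; rewrite lerDl sqr_ge0.
    have p : dl <= v y - v (refl x y z) by rewrite /dl; lra.
    have : dl ^+ 2 <= (v (refl x y z) - v y) ^+ 2.
      by rewrite -[leRHS]sqrrN opprB; exact: sqr_le.
    by move/le_trans; apply; rewrite lerDr sqr_ge0.
  have l2 : ((dl ^+ 2)%:E * mu B1 <= (e `^ a * J)%:E)%E.
    apply: (le_trans l1).
    apply: (le_trans (leeD (slice_ball x e0) (slice_ball y e0))).
    have f1 : slice x \is a fin_num by rewrite ge0_fin_numE//; exact: sN.
    have f2 : slice y \is a fin_num by rewrite ge0_fin_numE//; exact: sN.
    rewrite -(fineK f1) -(fineK f2).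
    rewrite -[X in (X <= _)%E]/((e `^ a * fine (slice x) + e `^ a * fine (slice y))%:E).
    by rewrite lee_fin /J mulrDr.
  have l3 : ((dl ^+ 2 * (k * e ^+ n))%:E <= (e `^ a * J)%:E)%E.
    apply: le_trans l2; rewrite EFinM lee_wpmul2l ?lee_fin ?sqr_ge0//.
    exact: leb_ball_ge.
  have eE : e `^ a = e ^+ n * e `^ (2 * s).
    by rewrite powRD ?powR_mulrn ?(ltW e0)// (gt_eqF a_gt0).
  move: l3; rewrite lee_fin eE => l3.
  rewrite -(ler_pM2r (exprn_gt0 n e0)) -mulrA; apply: (le_trans l3).
  by rewrite le_eqVlt; apply/orP; left; apply/eqP; ring.
have : dl ^+ 2 * k <= 0.
  have dxy2 : 0 < eucl_dist x y / 2 by rewrite divr_gt0.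
  have tau0 : 0 < (eucl_dist x y / 2) `^ (2 * s) by rewrite powR_gt0.
  apply: (le0_small tau0 J0) => t t0 ts.
  have s20 : 0 < 2 * s by rewrite mulr_gt0.
  have tE : (t `^ (2 * s)^-1) `^ (2 * s) = t.
    by rewrite -powRrM mulVf ?gt_eqF// powRr1// ltW.
  have := key (t `^ (2 * s)^-1); rewrite tE; apply; first by rewrite powR_gt0.
  rewrite leNgt; apply/negP => h.
  have := gt0_ltr_powR s20 _ _ h; rewrite !nnegrE ltW// powR_ge0 => /(_ isT isT).
  by rewrite tE ltNge ts.
by rewrite leNgt mulr_gt0// exprn_gt0.
Qed.

End radial_eigenfunction.

(** * Reordering the weight *)

Section translates.
Context (R : realType) (n : nat).
Local Notation X := (Rspace R n).
Local Notation mu := (leb R n).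

(** By Tonelli, the measures of these intersections integrate over [h] to
    [mu P * mu Q]. *)
Lemma exists_translate (P Q : set X) : measurable P -> measurable Q ->
  mu P <> 0%E -> mu Q <> 0%E ->
  exists h, mu (P `&` (fun x => tadd x h) @^-1` Q) <> 0%E.
Proof.
move=> mP mQ P0 Q0; apply: contrapT => /forallNP none.
pose f (z : X * X) : \bar R := ((\1_P z.2)%:E * (\1_Q (tadd z.2 z.1))%:E)%E.
have f0 z : (0 <= f z)%E by rewrite mule_ge0 ?lee_fin.
have mf : measurable_fun setT f.
  have m1 := measurable_indic_comp (R := R) mP (@measurable_snd _ _ X X).
  have m2 : measurable_fun setT (fun z : X * X => tadd z.2 z.1).
    exact: measurable_tadd.
  exact: (emeasurable_funM m1 (measurable_indic_comp (R := R) mQ m2)).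
have := fubini_tonelli (m1 := mu) (m2 := mu) f mf f0.
rewrite (_ : (\int[mu]_x _ = 0)%E); last first.
  apply: (eq_trans _ (integral0 mu setT)); apply: eq_integral => h _.
  have : mu (P `&` (fun x => tadd x h) @^-1` Q) = 0%E.
    by apply: contrapT; exact: none.
  have mPQ : measurable (P `&` (fun x => tadd x h) @^-1` Q).
    apply: measurableI => //; rewrite -[X in measurable X]setTI.
    by apply: measurable_tadd.
  move=> <-; rewrite -[in RHS](setIT (P `&` _)) -integral_indic//.
  by apply: eq_integral => x _; rewrite /f/= indicI EFinM.
move=> /esym; apply/eqP.
rewrite (_ : (\int[mu]_x _ = mu P * mu Q)%E).
  by rewrite mule_eq0; apply/negP => /orP[/eqP|/eqP].
have mi (C : set X) : measurable C -> measurable_fun setT (fun x => (\1_C x)%:E : \bar R).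
  by move=> mC; apply/measurable_EFinP; exact: measurable_indic.
have muE (C : set X) : measurable C -> mu C = (\int[mu]_x (\1_C x)%:E)%E.
  by move=> mC; rewrite integral_indic// setIT.
rewrite [in RHS](muE P mP) -ge0_integralZr//; last exact: mi.
apply: eq_integral => x _; rewrite /f/= ge0_integralZl//; last first.
  by apply: measurable_indic_comp => //; exact: measurable_tadd.
rewrite (muE Q mQ).
have i0 (C : set X) z : (0 <= (\1_C z)%:E :> \bar R)%E by rewrite lee_fin.
rewrite -(mpres_ge0_integral (leb_translation x) (mi _ mQ) (i0 _)).
by congr (_ * _)%E; apply: eq_integral => h _; rewrite taddC.
Qed.

(** Each line parallel to the first axis meets a sphere in at most two points. *)
Lemma sphere_null (c : X) (rho : R) : (0 < n)%N ->
  measurable [set x : X | eucl_dist x c = rho] /\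
  mu [set x : X | eucl_dist x c = rho] = 0%E.
Proof.
move=> n0; set S := [set x | _].
have mS : measurable S.
  have md : measurable_fun setT (fun x : X => eucl_dist x c).
    exact: measurable_eucl_dist.
  rewrite (_ : S = (fun x => eucl_dist x c) @^-1` [set rho])//.
  by rewrite -[X in measurable X]setTI; apply: md.
split => //.
move: n0 c @S mS; case: n => // m _ c S mS.
pose B := @tuple_of_pair R m @^-1` S.
have mB : measurable B.
  by rewrite -[X in measurable X]setTI; exact: measurable_tuple_of_pair.
rewrite (_ : leb R m.+1 S = (@lebesgue_measure R \x leb R m)%E B)//.
have mi : measurable_fun setT (fun z => (\1_B z)%:E : \bar R).
  by apply/measurable_EFinP; exact: measurable_indic.
have i0 z : (0 <= (\1_B z)%:E :> \bar R)%E by rewrite lee_fin.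
transitivity (\int[@lebesgue_measure R \x leb R m]_z (\1_B z)%:E)%E.
  by rewrite integral_indic// setIT.
rewrite (fubini_tonelli2 _ mi i0).
apply: (eq_trans _ (integral0 (leb R m) setT)); apply: eq_integral => t _.
rewrite /fubini_G.
have -> : (fun x => (\1_B (x, t))%:E) = (fun x => (\1_(ysection B t) x)%:E) :> (R -> \bar R).
  by apply/funext => x; rewrite !indicE -mem_ysection.
rewrite integral_indic//; last exact: measurable_ysection.
rewrite setIT.
pose K := \sum_(j < m) (tnth t j - tnth c (lift ord0 j)) ^+ 2.
pose w := Num.sqrt (rho ^+ 2 - K).
apply: countable_lebesgue_measure0.
apply: (@sub_countable _ _ _ [set tnth c ord0 + w; tnth c ord0 - w]); last first.
  by apply: finite_set_countable; exact: finite_set2.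
apply: subset_card_le => x; rewrite /ysection/= inE /B /S /preimage/= => xt.
have d2 : (x - tnth c ord0) ^+ 2 + K = rho ^+ 2.
  rewrite -xt eucl_distE sqr_sqrtr ?sqd_ge0// /sqd big_ord_recl.
  by congr (_ + _); apply: eq_bigr => j _; rewrite /tuple_of_pair tnthS.
have w2 : w ^+ 2 = (x - tnth c ord0) ^+ 2.
  by rewrite sqr_sqrtr -d2 addrK// sqr_ge0.
move/eqP : (esym w2); rewrite eqf_sqr => /orP[] /eqP h; [left|right] => /=; lra.
Qed.

(** A function that decreases with the distance to [c] off a null set [N] can take,
    off [N], values on both sides of a given rational [b] on at most one sphere.
    Off these countably many null spheres it is constant on spheres. *)
Lemma radial_of_monotone (c : X) (W N : set X) (f : X -> R) : (0 < n)%N ->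
  measurable N -> mu N = 0%E ->
  (forall x y, W x -> W y -> ~ N x -> ~ N y ->
     eucl_dist x c < eucl_dist y c -> f y <= f x) ->
  radial_in c W f.
Proof.
move=> n0 mN N0 fmon.
pose D x := W x /\ ~ N x.
pose bad (b : rat) (rho : R) := (exists2 x, D x & eucl_dist x c = rho /\ f x < ratr b)
  /\ (exists2 y, D y & eucl_dist y c = rho /\ ratr b < f y).
have bad_le b rho1 rho2 : bad b rho1 -> bad b rho2 -> rho2 <= rho1.
  move=> [[x [Wx Nx] [xr fx]] _] [_ [y [Wy Ny] [yr fy]]].
  rewrite leNgt; apply/negP; rewrite -xr -yr => /(fmon _ _ Wx Wy Nx Ny).
  by rewrite leNgt (lt_trans fx fy).
pose Z (b : rat) : set X := if pselect (exists rho, bad b rho) is left ex then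
  [set x : X | eucl_dist x c = projT1 (cid ex)] else set0.
have mZ b : measurable (Z b) /\ mu (Z b) = 0%E.
  rewrite /Z; case: pselect => [ex|_]; first exact: sphere_null.
  by split; [exact: measurable0|exact: measure0].
pose ZN k : set X := if unpickle k is Some b then Z b else set0.
have mZN k : measurable (ZN k) /\ mu (ZN k) = 0%E.
  rewrite /ZN; case: unpickle => [b|]; first exact: mZ.
  by split; [exact: measurable0|exact: measure0].
(* The profile is read at a chosen point of the sphere off [N]; the default value
   [c] concerns the radii without such a point. *)
pose rep (rho : R) : X := xget c [set x | D x /\ eucl_dist x c = rho].
exists (fun rho => f (rep rho)).
have mU : measurable (\bigcup_k ZN k) by apply: bigcupT_measurable => k; exact: (mZN k).1.
have U0 : mu (\bigcup_k ZN k) = 0%E.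
  apply/negligibleP => //; apply: negligible_bigcup => k.
  by apply/negligibleP; [exact: (mZN k).1|exact: (mZN k).2].
exists (N `|` \bigcup_k ZN k); split.
- exact: measurableU.
- by rewrite measureU0.
move=> x /= hx; apply: contrapT => /not_orP[Nx Ux]; apply: hx => Wx.
have [Drep repx] : D (rep (eucl_dist x c)) /\ eucl_dist (rep (eucl_dist x c)) c = eucl_dist x c.
  by apply: (@xgetPex _ c [set z | D z /\ eucl_dist z c = eucl_dist x c]); exists x.
set x' := rep _ in Drep repx *.
apply: contrapT => fx; apply: Ux.
have [b bb] : exists b, bad b (eucl_dist x c).
  have [lt|lt|//] := ltgtP (f x) (f x').
  - have [b] := rat_in_itvoo lt; rewrite inE/= => /andP[b1 b2].
    by exists b; split; [exists x|exists x'].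
  - have [b] := rat_in_itvoo lt; rewrite inE/= => /andP[b1 b2].
    by exists b; split; [exists x'|exists x].
exists (pickle b); first exact: I.
rewrite /ZN pickleK /Z.
case: pselect => [ex|]; last by case; exists (eucl_dist x c).
have hb := projT2 (cid ex).
by apply/le_anti; rewrite (bad_le _ _ _ hb bb) (bad_le _ _ _ bb hb).
Qed.

End translates.

Section swapK.
Context d (T : measurableType d) (f g : T -> T) (P : set T).
Hypotheses (fK : cancel f g) (gK : cancel g f) (Pf : forall x, P x -> ~ P (f x)).

Lemma swapK : involutive (swap f g P).
Proof.
move=> x; have [Px|Px] := pselect (P x).
  by rewrite (swap_in _ _ Px) (swap_im gK Pf) fK.
have [Pgx|Pgx] := pselect (P (g x)).
  by rewrite (swap_im gK Pf Pgx) swap_in ?gK.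
by rewrite !swap_out.
Qed.

End swapK.

Section radial_weight.
Context (R : realType) (n : nat) (s r : R) (c : Rspace R n).
Hypotheses (n2 : (2 <= n)%N) (s0 : 0 < s) (s1 : s < 1) (r0 : 0 < r).
Local Notation X := (Rspace R n).
Local Notation mu := (leb R n).
Local Notation a := (n%:R + 2 * s).
Local Notation W := (eball c r : set X).
Local Notation L1 f := (mu.-integrable setT (fun x => (f x)%:E)).
Local Notation E f := (fine (energy a f)).

Variables (g v : X -> R) (gv : optimal_pair s r c g v).

Let mg := optimal_weight_measurable gv.
Let gW := optimal_weight_out gv.
Let gL1 := optimal_weight_L1 gv.
Let admv := optimal_adm gv.
Let v0 := optimal_ge0 gv.
Let gvL1 := optimal_L1 gv.
Let mass0 := optimal_mass gv.
Let opt := optimal_min gv.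
Let mv : measurable_fun setT v. Proof. by case: admv. Qed.
Let vW x : ~ W x -> v x = 0. Proof. by case: admv => _ _ _; apply. Qed.

Lemma mpres_integrable (tau : X -> X) (h : X -> R) : mpres mu tau -> L1 h ->
  L1 (h \o tau).
Proof.
move=> ptau /integrableP[/measurable_EFinP mh ih]; apply/integrableP; split.
  by apply/measurable_EFinP; exact: (measurableT_comp mh ptau.1).
rewrite (mpres_ge0_integral ptau (g := fun x => `|(h x)%:E|%E))//.
by apply: measurableT_comp => //; exact/measurable_EFinP.
Qed.

Lemma adm_shift (f h : X -> R) (t : R) : adm s r c f -> adm s r c h ->
  adm s r c (fun x => f x + t * h x).
Proof.
move=> admf admh; have [mf f2 ef fW] := admf; have [mh h2 eh hW] := admh.
have mth : measurable_fun setT (fun x => t * h x) by exact: measurable_funM.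
have mfh : measurable_fun setT (fun x => f x + t * h x) by exact: measurable_funD.
split => //; last by move=> x Wx; rewrite fW// hW// mulr0 addr0.
  have [i _] := integrable_lin 2 (2 * t ^+ 2) (adm_sqr_L1 admf) (adm_sqr_L1 admh).
  have : L1 (fun x => (f x + t * h x) ^+ 2).
    apply: integrable_dom i; first exact: measurable_funX.
    move=> x; rewrite ger0_norm ?sqr_ge0//.
    by have := sqr_ge0 (f x - t * h x); nra.
  move=> /integrableP[_]; apply: le_lt_trans.
  rewrite le_eqVlt; apply/orP; left; apply/eqP; apply: eq_integral => x _ /=.
  by rewrite ger0_norm// sqr_ge0.
have := energy_parallelogram a mf mth; rewrite energyZ// => e.
apply: (@le_lt_trans _ _ (2%:E * energy a f + 2%:E * ((t ^+ 2)%:E * energy a h))%E).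
  by rewrite -e leeDl// energy_ge0.
by rewrite lte_add_pinfty// ?lte_mul_pinfty ?mule_ge0 ?lee_fin ?sqr_ge0 ?energy_ge0.
Qed.

(** The part of first order in [t] cancels. *)
Lemma energy_pm (f h : X -> R) (t : R) : adm s r c f -> adm s r c h ->
  E (fun x => f x + t * h x) + E (fun x => f x + (- t) * h x) =
  2 * E f + 2 * (t ^+ 2 * E h).
Proof.
move=> admf admh; have [mf _ _ _] := admf; have [mh _ _ _] := admh.
have mth : measurable_fun setT (fun x => t * h x) by exact: measurable_funM.
have := energy_parallelogram a mf mth; rewrite energyZ//.
have -> : (fun x => f x - t * h x) = (fun x => f x + (- t) * h x).
  by apply/funext => x; rewrite mulNr.
rewrite -(fineK (adm_energy_fin admf)) -(fineK (adm_energy_fin admh)).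
rewrite -(fineK (adm_energy_fin (adm_shift t admf admh))).
rewrite -(fineK (adm_energy_fin (adm_shift (- t) admf admh))).
by move=> [].
Qed.

Lemma mass_shift (w f h : X -> R) (t : R) :
  L1 (fun x => w x * f x ^+ 2) -> L1 (fun x => w x * (f x * h x)) ->
  L1 (fun x => w x * h x ^+ 2) ->
  L1 (fun x => w x * (f x + t * h x) ^+ 2) /\
  mass w (fun x => f x + t * h x) = mass w f +
    2 * t * (\int[mu]_x (w x * (f x * h x))) + t ^+ 2 * mass w h.
Proof.
move=> i1 i2 i3.
have [j1 e1] := integrable_lin 1 (2 * t) i1 i2.
have [j2 e2] := integrable_lin 1 (t ^+ 2) j1 i3.
have eqf x : w x * (f x + t * h x) ^+ 2 =
  1 * (1 * (w x * f x ^+ 2) + 2 * t * (w x * (f x * h x))) + t ^+ 2 * (w x * h x ^+ 2).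
  by ring.
split; first by apply: eq_integrable j2 => // x _; rewrite eqf.
rewrite /mass; under eq_Rintegral => x _ do rewrite eqf.
by rewrite e2 e1; ring.
Qed.

Section swap_step.
Variables (N : set X) (rho b k : R).
Hypotheses (mN : measurable N)
  (Nmon : forall x y, ~ N x -> ~ N y -> eucl_dist x c < eucl_dist y c -> v y <= v x)
  (Npos : forall x, W x -> ~ N x -> 0 < v x).

(** With [inner] below, the witnesses that [g] does not decrease: [g] is above [b]
    beyond the radius [rho] and below [b] within it. The bounds by [k] make the
    change of [g] bounded when two such sets are exchanged, which gives
    integrability for free; both sets avoid the exceptional set [N] of [v]. *)
Definition outer : set X :=
  ((W `&` [set x | rho < eucl_dist x c]) `&` [set x | b < g x]) `&`
    ([set x | g x <= k] `\` N).

Definition inner : set X :=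
  ((W `&` [set x | eucl_dist x c < rho]) `&` [set x | g x < b]) `&`
    ([set x | - k <= g x] `\` N).

Let md : measurable_fun setT (fun x : X => eucl_dist x c).
Proof. exact: measurable_eucl_dist. Qed.

Lemma measurable_outer : measurable outer.
Proof.
apply: measurableI; last by apply: measurableD => //; exact: measurable_ler_set.
apply: measurableI; last exact: measurable_ltr_set.
by apply: measurableI; [exact: measurable_eball|exact: measurable_ltr_set].
Qed.

Lemma measurable_inner : measurable inner.
Proof.
apply: measurableI; last by apply: measurableD => //; exact: measurable_ler_set.
apply: measurableI; last exact: measurable_ltr_set.
by apply: measurableI; [exact: measurable_eball|exact: measurable_ltr_set].
Qed.

(** Otherwise some translation carries a non-null part [P] of the outer set into
    the inner set. Let [tau] swap [P] with its translate: [g \o tau] has the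
    larger values of [g] closer to the centre. Adding the optimality
    inequalities of [(g \o tau, v + t * tent)] and [(g, v - t * tent)], the first
    variations of the energy and of the mass for [g] cancel, and what remains,
    with [dg = g \o tau - g], is that
    [\int dg * v ^ 2 + 2 * t * \int dg * v * tent] is at most [O(t ^ 2)]. The
    first integral is nonnegative since [v] decreases, so the second one is
    nonpositive; but it is positive since [v * tent] decreases strictly. The
    perturbation by the tent is needed because [v] could a priori be constant on
    some annulus. *)
Lemma outer_inner_null : mu outer = 0%E \/ mu inner = 0%E.
Proof.
apply: contrapT => /not_orP[p0 q0].
have [h] := exists_translate measurable_outer measurable_inner p0 q0.
set P := outer `&` _ => P0.
pose T (x : X) := tadd x h; pose T' (x : X) := tadd x (topp h).
have TK : cancel T T' by move=> x; exact: taddK.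
have T'K : cancel T' T by move=> x; exact: taddNK.
have mP : measurable P.
  apply: measurableI; first exact: measurable_outer.
  by rewrite -[X in measurable X]setTI; apply: measurable_tadd => //; exact: measurable_inner.
have PT x : P x -> ~ P (T x).
  move=> [_ [[[_ /= d1] _] _]] [[[[_ /= d2] _] _] _].
  by move: (lt_trans d1 d2); rewrite ltxx.
pose tau := swap T T' P.
have ptau : mpres mu tau.
  by apply: mpres_swap => //; exact: leb_translation.
have tauK : involutive tau by exact: swapK.
have tauP x : P x -> tau x = T x by exact: swap_in.
have tauP' x : P (T' x) -> tau x = T' x by move=> ?; apply: swap_im.
have tauN x : ~ P x -> ~ P (T' x) -> tau x = x by exact: swap_out.
have PW x : P x -> W x by move=> [[[[? _] _] _] _].
have PTW x : P x -> W (T x) by move=> [_ [[[? _] _] _]].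
have tauW x : W (tau x) <-> W x.
  have [Px|Px] := pselect (P x).
    by rewrite tauP//; split => _; [exact: PW|exact: PTW].
  have [Px'|Px'] := pselect (P (T' x)); last by rewrite tauN.
  rewrite tauP'//; split => _; last exact: PW.
  by have := PTW _ Px'; rewrite T'K.
pose e := tent r c.
have adme : adm s r c e by exact: adm_tent.
have [me _ _ _] := adme.
have e0 x : 0 <= e x by exact: tent_ge0.
have e1 x : e x <= 1 by exact: tent_le1.
have mtau := ptau.1.
have mgt : measurable_fun setT (g \o tau) by exact: (measurableT_comp mg mtau).
pose dg x := g (tau x) - g x.
have mdg : measurable_fun setT dg by exact: measurable_funB.
have onP x : P x -> [/\ g (T x) < g x, v x <= v (T x), e x < e (T x), 0 < v x &
    `|g (T x) - g x| <= 2 * k].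
  move=> Px; have Wx := PW _ Px; have WTx := PTW _ Px.
  have [[[[_ /= d1] /= b1] [/= k1 N1]] [[[_ /= d2] /= b2] [/= k2 N2]]] := Px.
  have dlt := lt_trans d2 d1.
  split.
  - exact: lt_trans b2 b1.
  - exact: Nmon.
  - by rewrite /e !tentE// ltrD2l ltrN2 ltr_pM2r// invr_gt0.
  - exact: Npos.
  - rewrite /T in b2 k2 *; rewrite ler_norml; apply/andP; split; lra.
have dg_bound x : `|dg x| <= 2 * `|k|.
  have k2 : 0 <= 2 * `|k| by rewrite mulr_ge0.
  have kk : 2 * k <= 2 * `|k| by rewrite ler_pM2l// ler_norm.
  have [Px|Px] := pselect (P x).
    by rewrite /dg tauP//; apply: le_trans kk; case: (onP _ Px).
  have [Px'|Px'] := pselect (P (T' x)); last by rewrite /dg tauN// subrr normr0.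
  rewrite /dg tauP'// distrC; apply: le_trans kk.
  by have [_ _ _ _] := onP _ Px'; rewrite T'K.
pose ph2 x := v x * e x.
have mph2 : measurable_fun setT ph2 by exact: measurable_funM.
have ph2P x : P x -> ph2 x < ph2 (T x).
  move=> /onP[_ v1 e2 vx _]; apply: (@lt_le_trans _ _ (v x * e (T x))).
    by rewrite ltr_pM2l.
  by rewrite ler_wpM2r.
have v2P x : P x -> v x ^+ 2 <= v (T x) ^+ 2.
  by move=> /onP[_ v1 _ vx _]; rewrite lerXn2r// nnegrE.
(* Symmetrising in [x] and [tau x] turns the integral of [dg * ph] into that of
   [dg * (ph - ph \o tau)], whose integrand has a sign. *)
have sgn ph : (forall x, P x -> ph x <= ph (T x)) ->
    forall x, 0 <= dg x * (ph x - ph (tau x)).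
  move=> phP x; have [Px|Px] := pselect (P x).
    rewrite /dg tauP// mulr_le0// subr_le0 ?phP//.
    by have [/ltW] := onP _ Px.
  have [Px'|Px'] := pselect (P (T' x)); last by rewrite /dg tauN// subrr mul0r.
  rewrite /dg tauP'// mulr_ge0// subr_ge0.
    by have [/ltW] := onP _ Px'; rewrite T'K.
  by have := phP _ Px'; rewrite T'K.
have [iv2 ie2] := (adm_sqr_L1 admv, adm_sqr_L1 adme).
have [isum _] := integrable_lin 1 1 iv2 ie2.
have iph2 : L1 ph2.
  apply: integrable_dom isum => // x; rewrite ger0_norm ?mulr_ge0// !mul1r.
  by have := sqr_ge0 (v x - e x); have := mulr_ge0 (v0 x) (e0 x); rewrite /ph2; nra.
have idg ph : measurable_fun setT ph -> L1 ph -> L1 (fun x => dg x * ph x).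
  move=> mph iph.
  have [i _] := integrable_lin (2 * `|k|) 0 (integrable_abse iph : L1 (fun x => `|ph x|)) iph.
  apply: integrable_dom i; first exact: measurable_funM.
  by move=> x; rewrite mul0r addr0 normrM ler_wpM2r.
have sym ph : measurable_fun setT ph -> L1 ph ->
    L1 (fun x => dg x * (ph x - ph (tau x))) /\
    \int[mu]_x (dg x * (ph x - ph (tau x))) = 2 * (\int[mu]_x (dg x * ph x)).
  move=> mph iph; have i1 := idg _ mph iph.
  have i2 := mpres_integrable ptau i1.
  have [i3 e3] := integrable_lin 1 1 i1 i2.
  have eqf x : dg x * (ph x - ph (tau x)) =
      1 * (dg x * ph x) + 1 * (((fun x => dg x * ph x) \o tau) x).
    by rewrite /dg/= tauK; ring.
  split; first by apply: eq_integrable i3 => // x _; rewrite eqf.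
  under eq_Rintegral => x _ do rewrite eqf.
  have mdp : measurable_fun setT (fun x => dg x * ph x) by exact: measurable_funM.
  have e4 : \int[mu]_x (((fun x => dg x * ph x) \o tau) x) = \int[mu]_x (dg x * ph x).
    exact: (mpres_Rintegral ptau mdp).
  by rewrite e3 e4; ring.
have mv2 : measurable_fun setT (fun x => v x ^+ 2) by exact: measurable_funX.
have me2 : measurable_fun setT (fun x => e x ^+ 2) by exact: measurable_funX.
have A0 : 0 <= \int[mu]_x (dg x * v x ^+ 2).
  have [_ e3] := sym _ mv2 iv2.
  rewrite -(pmulr_rge0 _ (ltr0n R 2)) -e3.
  by apply: Rintegral_ge0 => x _; exact: (sgn (fun x => v x ^+ 2) v2P).
have K0 : 0 < \int[mu]_x (dg x * ph2 x).
  have [i3 e3] := sym _ mph2 iph2.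
  rewrite -(pmulr_rgt0 _ (ltr0n R 2)) -e3 ltNge; apply/negP => le0.
  apply: P0; apply: (ge0_integral_le0_set (f := fun x => dg x * (ph2 x - ph2 (tau x)))) => //.
  - apply: measurable_funM => //; apply: measurable_funB => //.
    exact: (measurableT_comp mph2 mtau).
  - by move=> x; apply: (sgn ph2) => y /ph2P/ltW.
  - move=> x Px; rewrite /dg tauP// nmulr_rgt0 ?subr_lt0 ?ph2P//.
    by case: (onP _ Px).
  - rewrite -(fineK (integrable_fin_num measurableT i3)) lee_fin.
    exact: le0.
have gv_ : L1 (fun x => g x * ph2 x).
  have [i _] := integrable_lin 1 1 (integrable_abse gvL1 : L1 (fun x => `|g x * v x ^+ 2|))
    (integrable_abse gL1 : L1 (fun x => `|g x|)).
  apply: integrable_dom i; first exact: measurable_funM.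
  move=> x; rewrite !mul1r normrM [`|g x * _ ^+ 2|]normrM.
  rewrite [X in _ * X + _]ger0_norm ?sqr_ge0// -[X in _ + X]mulr1 -mulrDr.
  rewrite ler_wpM2l// ger0_norm ?mulr_ge0// /ph2.
  apply: (@le_trans _ _ (v x)); first by rewrite ler_piMr.
  by have := sqr_ge0 (v x - 1); have := v0 x; nra.
have ge_ : L1 (fun x => g x * e x ^+ 2).
  apply: integrable_dom (integrable_abse gL1 : L1 (fun x => `|g x|)).
    exact: measurable_funM.
  move=> x; rewrite normrM ler_piMr// ger0_norm ?sqr_ge0//.
  by rewrite exprn_ile1.
pose m := mass g v; pose A := mass dg v; pose kap := \int[mu]_x (dg x * ph2 x).
pose kg := \int[mu]_x (g x * ph2 x).
pose K := `|2 * m * E e - E v * (2 * mass g e + mass dg e)|.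
have Ev0 : 0 < E v by exact: (eigenfunction_energy_gt0 n2 gv).
(* [kap] is the second integral, [A] the first one; [K] bounds the terms of second
   order in [t]. *)
have : 2 * kap * E v <= 0.
  have Kge0 : 0 <= K by exact: normr_ge0.
  apply: (@le0_small _ _ K 1) => // t t0 _.
  have [ig1 eg1] := mass_shift t gvL1 gv_ ge_.
  have [_ eg2] := mass_shift (- t) gvL1 gv_ ge_.
  have [id1 ed1] := mass_shift t (idg _ mv2 iv2) (idg _ mph2 iph2) (idg _ me2 ie2).
  have o1 := opt (equimeasurable_comp gv ptau tauW) (adm_shift t admv adme).
  have o2 := opt (equimeasurable_refl gv) (adm_shift (- t) admv adme).
  have eg3 : mass (g \o tau) (fun x => v x + t * e x) =
      mass g (fun x => v x + t * e x) + mass dg (fun x => v x + t * e x).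
    have [_ e3] := integrable_lin 1 1 ig1 id1.
    rewrite !mul1r in e3; rewrite /mass -e3; apply: eq_Rintegral => x _.
    by rewrite /dg/=; ring.
  have epm := energy_pm t admv adme.
  rewrite eg3 eg1 ed1 in o1; rewrite eg2 in o2.
  rewrite -/ph2 -/kg -/kap -/A -/m in o1 o2.
  have o3 := lerD o1 o2; rewrite -mulrDr -mulrDl epm in o3.
  have KK : 2 * m * E e - E v * (2 * mass g e + mass dg e) <= K by exact: ler_norm.
  rewrite -(ler_pM2l t0).
  have AE : 0 <= E v * A by rewrite mulr_ge0// ltW.
  have t2 : t ^+ 2 * (2 * m * E e - E v * (2 * mass g e + mass dg e)) <= t ^+ 2 * K.
    by rewrite ler_wpM2l// sqr_ge0.
  rewrite [leRHS]mulrA -expr2; apply: le_trans t2.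
  rewrite -subr_ge0; move: o3; rewrite -subr_ge0 => o3.
  apply: (le_trans (addr_ge0 o3 AE)).
  rewrite le_eqVlt; apply/orP; left; apply/eqP; ring.
by rewrite leNgt !mulr_gt0.
Qed.

End swap_step.

(** If [x] is closer to the centre than [y] and [g x < g y], rational numbers
    [rho] and [b] and an integer [k] can be inserted so that [x] is in the inner
    set and [y] in the outer set; for each of these countably many choices one
    of the two sets is null. *)
Lemma weight_decreasing : exists N, [/\ measurable N, mu N = 0%E &
  forall x y, W x -> W y -> ~ N x -> ~ N y ->
    eucl_dist x c < eucl_dist y c -> g y <= g x].
Proof.
have [N1 [mN1 N10 N1mon]] := eigenfunction_decreasing n2 s0 s1 r0 gv.
pose N2 : set X := W `&` [set x | v x <= 0].
have mN2 : measurable N2.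
  by apply: measurableI; [exact: measurable_eball|exact: measurable_ler_set].
have N20 : mu N2 = 0%E by exact: eigenfunction_positive gv.
pose N := N1 `|` N2.
have mN : measurable N by exact: measurableU.
have N0 : mu N = 0%E by rewrite measureU0.
have Nmon x y : ~ N x -> ~ N y -> eucl_dist x c < eucl_dist y c -> v y <= v x.
  by move=> /not_orP[? _] /not_orP[? _]; exact: N1mon.
have Npos x : W x -> ~ N x -> 0 < v x.
  by move=> Wx /not_orP[_ N2x]; rewrite ltNge; apply/negP => vx; exact: N2x.
pose PQ (p : rat * rat * nat) : set X :=
  if mu (outer N (ratr p.1.1) (ratr p.1.2) p.2%:R) == 0%E
  then outer N (ratr p.1.1) (ratr p.1.2) p.2%:R
  else inner N (ratr p.1.1) (ratr p.1.2) p.2%:R.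
have mPQ p : measurable (PQ p) /\ mu (PQ p) = 0%E.
  rewrite /PQ; case: ifPn => [/eqP ?|/eqP o0].
    by split => //; exact: measurable_outer.
  split; first exact: measurable_inner.
  by have [//|] := outer_inner_null (ratr p.1.1) (ratr p.1.2) p.2%:R mN Nmon Npos.
pose Z i : set X := if unpickle i is Some p then PQ p else set0.
have mZ i : measurable (Z i) /\ mu (Z i) = 0%E.
  rewrite /Z; case: unpickle => [p|]; first exact: mPQ.
  by split; [exact: measurable0|exact: measure0].
have mU : measurable (\bigcup_i Z i) by apply: bigcupT_measurable => i; exact: (mZ i).1.
have U0 : mu (\bigcup_i Z i) = 0%E.
  apply/negligibleP => //; apply: negligible_bigcup => i.
  by apply/negligibleP; [exact: (mZ i).1|exact: (mZ i).2].
exists (N `|` \bigcup_i Z i); split; [exact: measurableU|by rewrite measureU0|].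
move=> x y Wx Wy /not_orP[Nx Ux] /not_orP[Ny Uy] dxy.
rewrite leNgt; apply/negP => gxy.
have [q1] := rat_in_itvoo dxy; rewrite inE/= => /andP[q11 q12].
have [q2] := rat_in_itvoo gxy; rewrite inE/= => /andP[q21 q22].
pose k := (Num.truncn (`|g x| + `|g y|)).+1.
have kk : `|g x| + `|g y| <= k%:R by exact/ltW/truncnS_gt.
have gxk : - k%:R <= g x.
  rewrite lerNl; apply: le_trans kk; apply: (@le_trans _ _ `|g x|).
    by rewrite -normrN ler_norm.
  by rewrite lerDl.
have gyk : g y <= k%:R.
  by apply: le_trans kk; apply: (le_trans (ler_norm _)); rewrite lerDr.
have : PQ (q1, q2, k) x \/ PQ (q1, q2, k) y.
  rewrite /PQ/=; case: ifP => _; [right|left]; split => //.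
case=> h; [apply: Ux|apply: Uy]; (exists (pickle (q1, q2, k)); first exact: I);
  rewrite /Z pickleK; exact: h.
Qed.

End radial_weight.

(** * From the eigenvalue problem to optimal pairs *)

(** The real-valued integral is [0] when the extended one is infinite, so that a
    positive value carries integrability. *)
Lemma Rintegral_gt0_integrable d (T : measurableType d) (R : realType)
    (mu : {measure set T -> \bar R}) (f : T -> R) :
  measurable_fun setT f -> 0 < \int[mu]_x f x ->
  mu.-integrable setT (fun x => (f x)%:E).
Proof.
move=> mf f0; have mfE : measurable_fun setT (fun x => (f x)%:E).
  exact/measurable_EFinP.
apply/integrableP; split => //; rewrite integral_fin_num_abs//.
by move: f0; rewrite /Rintegral; case: (\int[mu]_x _)%E => //=; rewrite ltxx.
Qed.

Section bridge.
Context (R : realType) (n : nat) (s r : R) (c : Rspace R n).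
Hypotheses (n2 : (2 <= n)%N) (s0 : 0 < s) (s1 : s < 1) (r0 : 0 < r).
Local Notation X := (Rspace R n).
Local Notation mu := (leb R n).
Local Notation a := (n%:R + 2 * s).
Local Notation W := (eball c r : set X).
Local Notation E f := (fine (energy a f)).

Lemma weighted_mass_restrict (h f : X -> R) :
  weighted_mass W h f = mass (h \_ W) f.
Proof.
rewrite /weighted_mass /mass Rintegral_mkcond; apply: eq_Rintegral => x _.
rewrite !patchE; case: ifPn => _; last by rewrite mul0r.
by rewrite real_normK ?num_real.
Qed.

Lemma rayleighE (h f : X -> R) : measurable_fun setT f ->
  rayleigh s W h f = fraclap_const n s / 2 * E f / mass (h \_ W) f.
Proof.
by move=> mf; rewrite /rayleigh (gagliardo_sqr (erefl a) mf) weighted_mass_restrict.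
Qed.

Variables (g0 g u : X -> R).
Hypotheses (g_min : minimizing_weight s W g0 g) (u_eig : first_eigenfunction s W g u).

Let H0su : H0s s W u. Proof. by case: u_eig => -[]. Qed.
Let u_mass : 0 < mass (g \_ W) u.
Proof. by case: u_eig => -[_]; rewrite weighted_mass_restrict. Qed.
Let mu_ : measurable_fun setT u.
Proof. by have /(H0sP _ _ (erefl a)) [] := H0su. Qed.

(** The first eigenvalue of [g] is at most that of [h], and [u] attains it. If
    [mass h f <= 0], the inequality compares a nonpositive number with a
    nonnegative one. *)
Lemma rayleigh_optimal (h f : X -> R) :
  rearrangement_class W g0 h -> H0s s W f ->
  E u * mass (h \_ W) f <= E f * mass (g \_ W) u.
Proof.
move=> hcls H0f.
have /(H0sP _ _ (erefl a)) [mf _ _ _] := H0f.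
have [hf|hf] := leP (mass (h \_ W) f) 0.
  apply: (@le_trans _ _ 0); first by rewrite mulr_ge0_le0// fineE_ge0.
  by rewrite mulr_ge0 ?fineE_ge0// ltW.
have hadm : admissible s W h f by split => //; rewrite weighted_mass_restrict.
have C0 : 0 < fraclap_const n s / 2 :> R by rewrite divr_gt0// fraclap_const_gt0.
have : rayleigh s W g u <= rayleigh s W h f.
  rewrite -lee_fin u_eig.2; apply: le_trans (g_min.2 _ hcls) _.
  by apply: ereal_inf_lbound; exists f.
rewrite !rayleighE//; set K := fraclap_const n s / 2 in C0 *.
by rewrite ler_pdivrMr// [leRHS]mulrAC ler_pdivlMr// -[leLHS]mulrA -[leRHS]mulrA ler_pM2l.
Qed.

(** [U] is the representative of [u] that vanishes at every point outside the
    ball, and [v] its absolute value. *)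
Let v x := `|u x| * \1_W x.
Let U x := u x * \1_W x.

Let mW' : measurable W. Proof. exact: measurable_eball. Qed.
Let m1 : measurable_fun setT (\1_W : X -> R).
Proof. exact: measurable_indic. Qed.
Let mv : measurable_fun setT v.
Proof. by apply: measurable_funM => //; exact: measurableT_comp. Qed.
Let mU : measurable_fun setT U. Proof. exact: measurable_funM. Qed.
Let inW x : W x -> v x = `|u x| /\ U x = u x.
Proof. by move=> Wx; rewrite /v /U indicE mem_set//= !mulr1. Qed.
Let outW x : ~ W x -> v x = 0 /\ U x = 0.
Proof. by move=> Wx; rewrite /v /U indicE memNset//= !mulr0. Qed.
Let vU x : v x = `|U x|.
Proof. by rewrite /v /U normrM [`|\1_W x|]ger0_norm. Qed.

Let energyU : energy a U = energy a u.
Proof.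
have /(H0sP _ _ (erefl a)) [_ _ _ [M [mM M0 uM]]] := H0su.
apply: (energy_ae_eq a mU mu_ mM M0) => x Mx.
have [Wx|Wx] := pselect (W x); first by case: (inW Wx).
have [_ ->] := outW Wx; apply/esym; apply: contrapT => ux.
by apply: Mx; apply: uM => /= /(_ Wx).
Qed.

Let energyv : (energy a v <= energy a u)%E.
Proof.
rewrite -energyU; apply: energy_le => // x y.
by rewrite !vU; exact: ler_dist_dist.
Qed.

Let mass_v : mass (g \_ W) v = mass (g \_ W) u.
Proof.
apply: eq_Rintegral => x _; have [Wx|Wx] := pselect (W x).
  by have [-> _] := inW Wx; rewrite real_normK ?num_real.
by rewrite patchE memNset// !mul0r.
Qed.

Let adm_v : adm s r c v.
Proof.
have /(H0sP _ _ (erefl a)) [_ u2 ue _] := H0su.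
split => //.
- apply: le_lt_trans u2; apply: ge0_le_integral => //.
  + by move=> x _; rewrite lee_fin sqr_ge0.
  + by apply/measurable_EFinP; exact: measurable_funX.
  + by apply/measurable_EFinP; exact: measurable_funX.
  move=> x _; rewrite lee_fin; have [Wx|Wx] := pselect (W x).
    by have [-> _] := inW Wx; rewrite real_normK ?num_real.
  by have [-> _] := outW Wx; rewrite expr0n/= sqr_ge0.
- exact: le_lt_trans energyv ue.
- by move=> x /outW[].
Qed.

Lemma H0s_adm (f : X -> R) : adm s r c f -> H0s s W f.
Proof.
move=> [mf f2 fe fW]; apply/(H0sP _ _ (erefl a)); split => //.
by apply: aeW => x; exact: fW.
Qed.

(** Taking absolute values keeps the mass and does not increase the energy. The
    weight [g] is integrable because its rearrangement [g0] is. *)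
Lemma optimal_pair_abs (q : \bar R) : (1 <= q)%E -> g0 \_ W \in Lfun mu q ->
  measurable_fun W g0 -> optimal_pair s r c (g \_ W) v.
Proof.
move=> q1 g0q mg0.
have [[mgW tails] _] := g_min.
have mg : measurable_fun setT (g \_ W : X -> R).
  by apply/(measurable_restrict _ mW' measurableT); rewrite setTI.
have gW x : ~ W x -> (g \_ W) x = 0 by move=> Wx; rewrite patchE memNset.
have Wfin := leb_ball_lty c r.
split => //.
- apply/integrableP; split; first exact/measurable_EFinP.
  rewrite (same_tails_integral mW' Wfin mgW mg0 tails).
  exact: Lfun_ge1_integrable g0q.
- by move=> x; rewrite mulr_ge0.
- apply: Rintegral_gt0_integrable.
    by apply: measurable_funM => //; exact: measurable_funX.
  by rewrite -[ltRHS]/(mass (g \_ W) v) mass_v.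
- by rewrite mass_v.
move=> h f [mh hW htails] admf.
have hh : h \_ W = h.
  apply/funext => x; rewrite patchE; case: ifPn => // /negP Wx.
  by rewrite hW// => Wx'; apply: Wx; rewrite inE.
have hcls : rearrangement_class W g0 h.
  split; first exact: measurable_funTS.
  move=> t; rewrite htails -tails; congr (mu _).
  by apply/seteqP; split => x [Wx /=]; rewrite patchE mem_set.
have := rayleigh_optimal hcls (H0s_adm admf); rewrite hh mass_v.
have [m0|m0] := leP 0 (mass h f).
  apply: le_trans; rewrite ler_wpM2r// fine_le ?adm_energy_fin//.
    exact: adm_energy_fin adm_v.
  have /(H0sP _ _ (erefl a)) [_ _ ue _] := H0su.
  by rewrite ge0_fin_numE// energy_ge0.
move=> _; apply: (@le_trans _ _ 0).
  by rewrite mulr_ge0_le0 ?fineE_ge0// ltW.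
by rewrite mulr_ge0 ?fineE_ge0// ltW.
Qed.

(** [|u|] is admissible with the same mass, so it has the same energy as [u],
    whereas [|(|u x| - |u y|)| < |u x - u y|] when [u x] and [u y] have opposite
    signs. *)
Lemma eigenfunction_sign :
  mu (W `&` [set x | 0 < u x]) = 0%E \/ mu (W `&` [set x | u x < 0]) = 0%E.
Proof.
have /(H0sP _ _ (erefl a)) [_ _ ue _] := H0su.
have gcls := g_min.1.
have ufin : energy a u \is a fin_num by rewrite ge0_fin_numE// energy_ge0.
have uv : (energy a u <= energy a v)%E.
  have := rayleigh_optimal gcls (H0s_adm adm_v); rewrite mass_v ler_pM2r// => h.
  by rewrite -(fineK ufin) -(fineK (adm_energy_fin adm_v)) lee_fin.
have mP : measurable (W `&` [set x | 0 < u x]).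
  by apply: measurableI => //; exact: measurable_ltr_set.
have mM : measurable (W `&` [set x | u x < 0]).
  by apply: measurableI => //; exact: measurable_ltr_set.
apply: prod_null => //.
apply: (@integral_gap_set _ _ _ (mu \x mu)%E (eden a U) (eden a v)).
- exact: measurableX.
- exact: measurable_eden.
- exact: measurable_eden.
- exact: eden_ge0.
- move=> [x y]; rewrite /eden/= ler_wpM2r ?kern_ge0// !vU.
  rewrite -real_normK ?num_real// -[leRHS]real_normK ?num_real//.
  by rewrite lerXn2r ?nnegrE// ler_dist_dist.
- move=> [x y] [[/= Wx ux] [/= Wy uy]].
  have [vx Ux] := inW Wx; have [vy Uy] := inW Wy.
  rewrite /eden/= vx vy Ux Uy ltr_pM2r; last first.
    by apply: kern_gt0; apply/eqP => xy; move: (lt_trans uy ux); rewrite xy ltxx.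
  by rewrite gtr0_norm// ltr0_norm//; nra.
- by rewrite -[X in (X <= _)%E]/(energy a U) energyU.
- exact: le_lt_trans energyv ue.
Qed.

Lemma radial_in_ae (f h : X -> R) (N : set X) : measurable N -> mu N = 0%E ->
  (forall x, W x -> ~ N x -> f x = h x) -> radial_in c W h -> radial_in c W f.
Proof.
move=> mN N0 fh [F [M [mM M0 hF]]]; exists F; exists (N `|` M).
split; [exact: measurableU|by rewrite measureU0|].
move=> x /= hx; apply: contrapT => /not_orP[Nx Mx]; apply: hx => Wx.
rewrite fh//; apply: contrapT => hFx; apply: Mx; apply: hF => /= h2.
by apply: hFx; exact: h2.
Qed.

(** [|u|] is radial, and [u] is [|u|] or [- |u|] by its constant sign. *)
Lemma eigenfunction_radial (q : \bar R) : (1 <= q)%E -> g0 \_ W \in Lfun mu q ->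
  measurable_fun W g0 -> radial_in c W u /\ radial_in c W g.
Proof.
move=> q1 g0q mg0; have op := optimal_pair_abs q1 g0q mg0.
have n0 : (0 < n)%N by exact: leq_trans n2.
split; last first.
  have [N [mN N0 gmon]] := weight_decreasing n2 s0 s1 r0 op.
  apply: (radial_in_ae measurable0 (measure0 _) (h := g \_ W)).
    by move=> x Wx _; rewrite patchE mem_set.
  exact: radial_of_monotone gmon.
have [N [mN N0 vmon]] := eigenfunction_decreasing n2 s0 s1 r0 op.
have [F vF] : radial_in c W v.
  by apply: (radial_of_monotone n0 mN N0) => x y _ _; exact: vmon.
have mP : measurable (W `&` [set x | 0 < u x]).
  by apply: measurableI => //; exact: measurable_ltr_set.
have mM : measurable (W `&` [set x | u x < 0]).
  by apply: measurableI => //; exact: measurable_ltr_set.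
have [null|null] := eigenfunction_sign.
  apply: (radial_in_ae mP null (h := fun x => - v x)).
    move=> x Wx Nx; have [-> _] := inW Wx.
    rewrite ler0_norm ?opprK// leNgt; apply/negP => ux; exact: Nx.
  exists (fun t => - F t); apply: filterS vF => x h Wx.
  by rewrite h.
apply: (radial_in_ae mM null (h := v)); last by exists F.
move=> x Wx Nx; have [-> _] := inW Wx.
rewrite ger0_norm// leNgt; apply/negP => ux; exact: Nx.
Qed.

End bridge.

Theorem corollary1p3 (R : realType) (N : nat) (s r : R) (q : \bar R)
    (c : Rspace R N) (g0 g u : Rspace R N -> R)
    (N_ge2 : (2 <= N)%N) (s_gt0 : 0 < s) (s_lt1 : s < 1) (r_gt0 : 0 < r)
    (q_gt : ((N%:R / (2 * s))%:E < q)%E)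
    (g0_Lq : (g0 \_ (eball c r)) \in Lfun (leb R N) q)
    (g0_pos : ~ {ae leb R N, forall x, eball c r x -> g0^\+ x = 0})
    (g_min : minimizing_weight s (eball c r) g0 g)
    (u_eig : first_eigenfunction s (eball c r) g u) :
  radial_in c (eball c r) u /\ radial_in c (eball c r) g.
Proof.
have q1 : (1 <= q)%E.
  apply: le_trans (ltW q_gt); rewrite lee_fin ler_pdivlMr ?mulr_gt0// mul1r.
  apply: (@le_trans _ _ 2); first by rewrite ler_piMr// ltW.
  by rewrite ler_nat.
have mW' := measurable_eball c r.
have mg0 : measurable_fun (eball c r) g0.
  have mg0W : measurable_fun setT (g0 \_ (eball c r)).
    by move: g0_Lq; rewrite inE => /andP[]; rewrite inE.
  by move: mg0W => /(measurable_restrict _ mW' measurableT); rewrite setTI.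
exact: (eigenfunction_radial N_ge2 s_gt0 s_lt1 r_gt0 g_min u_eig q1 g0_Lq mg0).
Qed.
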